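(* Let $X\subset\mathbb{R}^N$ be a closed semialgebraic set and let $F:X\to\mathbb{R}^m$ be a continuous semialgebraic mapping. Let $Y=\operatorname{graph}F$, $d=\max\{2,\kappa(X),\kappa(Y)\}$ and $r=r(X)+r(Y)$. Then there exists a positive constant $C$ such that $$|F(x)|\ge C\left(\frac{\operatorname{dist}(x,F^{-1}(0)\cap X)}{1+|x|^{d}}\right)^{d(6d-3)^{N+r-1}}\quad\text{for } x\in X.$$ In particular, if $X$ is an unbounded set and $F^{-1}(0)\cap X$ is a compact set, then $$\mathcal{L}^{\mathbb{R}}_\infty(F|X)\ge(1-d)\,d(6d-3)^{N+r-1}.$$
   Context: $|\cdot|$ is the Euclidean norm, $\operatorname{dist}$ the Euclidean distance to a set, with the convention $\operatorname{dist}(x,\emptyset)=1$. Łojasiewicz exponent at infinity. $\mathcal{L}^{\mathbb{R}}_\infty(F|X)$ is the supremum of the exponents $\nu$ for which there exist $C,R>0$ with $|F(x)|\ge C|x|^{\nu}$ for all $x\in X$, $|x|\ge R$. Complexity numbers. Every closed semialgebraic set $S\subset\mathbb{R}^M$ has a decomposition $S=S_1\cup\dots\cup S_k$ into closed basic semialgebraic sets $$S_i=\{x\in\mathbb{R}^M: g_{i,1}(x)\ge 0,\dots,g_{i,r_i}(x)\ge 0,\ h_{i,1}(x)=\dots=h_{i,l_i}(x)=0\},\quad i=1,\dots,k,$$ with $g_{i,j},h_{i,s}\in\mathbb{R}[x_1,\dots,x_M]$, where $r_i$ is taken to be the smallest possible number of inequalities in the definition of $S_i$. The number $r(S)$ is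 the minimum of $\max\{r_1,\dots,r_k\}$ over all such decompositions of $S$. The number $\kappa(S)$ is the minimum of the maximal degree of all the polynomials $g_{i,j},h_{i,s}$ over all such decompositions (descriptions) of $S$ that satisfy $r_i\le r(S)$ for all $i$. Here $\operatorname{graph}F$ is regarded as a closed semialgebraic subset of $\mathbb{R}^{N+m}$. *)

(* Defs.v *)
From mathcomp Require Import all_boot all_order all_algebra.
From mathcomp Require Import all_classical all_reals all_analysis.
(* The notations of mpoly clash with those of mathcomp-analysis. *)
From mathcomp Require Import -(notations) mpoly.

Set Implicit Arguments.
Unset Strict Implicit.
Unset Printing Implicit Defensive.

Import Order.TTheory GRing.Theory Num.Theory.
Import numFieldNormedType.Exports.
Local Open Scope classical_set_scope.
Local Open Scope ring_scope.

(* The library norm on ['rV[R]_n] is the max norm; it induces the same topology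
   as this one, so [closed], [compact] and [continuous] are the library's. *)
Definition enorm (R : realType) (n : nat) (x : 'rV[R]_n) : R :=
  Num.sqrt (\sum_(i < n) x 0 i ^+ 2).

Definition dist (R : realType) (n : nat) (x : 'rV[R]_n) (A : set 'rV[R]_n) : R :=
  if `[< A = set0 >] then 1 else inf [set enorm (x - a) | a in A].

Definition unbounded (R : realType) (n : nat) (X : set 'rV[R]_n) : Prop :=
  ~ exists M : R, forall x, X x -> enorm x <= M.

Definition peval (R : realType) (n : nat) (p : mpoly n R) (x : 'rV[R]_n)
  : R := meval (x 0) p.

(* [mmeasure mdeg p] (msize) is one more than the total degree, 0 for [p = 0]. *)
Definition pdeg (R : realType) (n : nat) (p : mpoly n R) : nat :=
  (mmeasure mdeg p).-1.

(* A pair [p] of lists of polynomials: inequalities [p.1], equations [p.2]. *)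
Definition system (R : realType) (n : nat) : Type :=
  (seq (mpoly n R) * seq (mpoly n R))%type.

Definition basic_open (R : realType) (n : nat) (p : system R n)
  : set 'rV[R]_n :=
  [set x | (forall g, g \in p.1 -> 0 < peval g x) /\
           (forall h, h \in p.2 -> peval h x = 0)].

Definition basic_closed (R : realType) (n : nat) (p : system R n)
  : set 'rV[R]_n :=
  [set x | (forall g, g \in p.1 -> 0 <= peval g x) /\
           (forall h, h \in p.2 -> peval h x = 0)].

Definition semialgebraic (R : realType) (n : nat) (S : set 'rV[R]_n) : Prop :=
  exists D : seq (system R n),
    S = [set x | exists2 p, p \in D & basic_open p x].

Definition graph (R : realType) (N m : nat) (X : set 'rV[R]_N)
  (F : 'rV[R]_N -> 'rV[R]_m) : set 'rV[R]_(N + m) :=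
  [set row_mx x (F x) | x in X].

Definition semialgebraic_map (R : realType) (N m : nat) (X : set 'rV[R]_N)
  (F : 'rV[R]_N -> 'rV[R]_m) : Prop := semialgebraic (graph X F).

Definition fewest_ineqs (R : realType) (n : nat) (p : system R n) : Prop :=
  forall q : system R n,
    basic_closed q = basic_closed p -> (size p.1 <= size q.1)%N.

Definition decomposition (R : realType) (n : nat) (S : set 'rV[R]_n)
  (D : seq (system R n)) : Prop :=
  S = [set x | exists2 p, p \in D & basic_closed p x] /\
  (forall p, p \in D -> fewest_ineqs p).

Definition max_ineqs (R : realType) (n : nat) (D : seq (system R n)) : nat :=
  (\max_(p <- D) size p.1)%N.

Definition max_deg (R : realType) (n : nat) (D : seq (system R n)) : nat :=
  (\max_(p <- D) \max_(f <- p.1 ++ p.2) pdeg f)%N.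

(* Least element; the junk value 0 on [set0] never matters below, because every
   closed semialgebraic set has a decomposition. *)
Definition nat_min (A : set nat) : nat :=
  xget 0%N [set n | A n /\ forall k, A k -> (n <= k)%N].

Definition rnum (R : realType) (n : nat) (S : set 'rV[R]_n) : nat :=
  nat_min [set max_ineqs D | D in decomposition S].

Definition kappa (R : realType) (n : nat) (S : set 'rV[R]_n) : nat :=
  nat_min [set max_deg D | D in
    [set D | decomposition S D /\
             forall p, p \in D -> (size p.1 <= rnum S)%N]].

Definition loj_infty (R : realType) (N m : nat) (X : set 'rV[R]_N)
  (F : 'rV[R]_N -> 'rV[R]_m) : \bar R :=
  ereal_sup [set nu%:E | nu in [set nu : R | exists C r : R,
    [/\ 0 < C, 0 < r &
        forall x, X x -> r <= enorm x -> C * enorm x `^ nu <= enorm (F x)]]].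

(* Main.v *)
(* Write the graph of [F] as a union of closed basic sets and put [y = 0] in the polynomials
   describing it.  If [|F x| <= 1], the restricted system is violated at [x] by at most
   [C * |F x| * (1 + |x|) ^ d], while its solutions are zeros of [F].  A slack variable
   [z ^ 2 = g] for each inequality and a sum of squares reduce the theorem to one polynomial
   [f >= 0] of degree [2 * d] in [N + r] variables: if [f] has no zero in a ball of radius
   [delta] around [x], then [f x] is at least a power of [delta].  The affine charts of
   projective space bring [x] into a bounded box, at the cost of powers of [1 + |x|].

   On a box this is a Lojasiewicz inequality with exponent [al = D * (3 * D - 3) ^ (n - 1)],
   [D] being the degree of [f].  By Ekeland's principle for [f ^ (1 / al)] it follows from the
   gradient inequality [f ^ (1 - 1 / al) <= C * |grad f|] near each zero, hence from an upper
   bound on the Legendre-type transform [max (l * f - E)], where [E] is comparable to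
   [|grad f| ^ 2].  At a maximizer a partial derivative of [f] is a root of a polynomial whose
   degree is found by counting dimensions modulo the critical equations (the Jacobian of [f]
   and [E] for [n = 2], a penalized [E] for [n > 2]), and this bounds the maximum.

   Qualitative facts ([f = o(|grad f|)] near a zero of [f], and the existence of
   decompositions into closed basic sets) come from quantifier elimination: a definable
   predicate [P s r] has constant truth value on some region [0 < s < s0, 0 < r < s ^ N]. *)
Require Import Defs.
From HB Require Import structures.
From mathcomp Require Import all_boot all_order all_algebra.
From mathcomp Require Import all_classical all_reals all_analysis.
From mathcomp Require Import -(notations) mpoly.
From mathcomp Require ordered_qelim qe_rcf.
From mathcomp Require Import ring lra zify.
Set Implicit Arguments.
Unset Strict Implicit.
Unset Printing Implicit Defensive.
Import Order.TTheory GRing.Theory Num.Theory.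
Import numFieldNormedType.Exports.
Local Open Scope classical_set_scope.
Local Open Scope ring_scope.

(** * Definable predicates *)

(** Neither curve selection nor Puiseux series are used: a definable family is known to exist for
    all small [s], but not to be continuous, so differentiation along it is replaced by comparing
    [s] with [s - r], where [r < s ^ N].

    The exponent has several sources. A bound of order [t ^ (2 * q + 2)] on the transform at
    [l = t ^ q] means that [f] decays at worst like the power [q + 2] of the distance to its zeros.
    The penalized critical system spans dimension at most [Q = (2 * (D - 1)) ^ n] and gives [q = Q];
    since [D >= 4], [Q + 2 <= D * (3 * D - 3) ^ (n - 1)] holds for [n >= 3] and fails for
    [n = 1, 2]. One variable is settled by the order of vanishing, at most [D]. In the plane, the
    one equation given by a Jacobian of degree at most [3 * D - 3] yields [q + 2 = D * (3 * D - 3)].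
    Finally [D = 2 * d] turns [3 * D - 3] into [6 * d - 3], and since [f] is compared with
    [|F x| ^ 2], a square root turns the factor [2 * d] in front into [d]. *)

Definition polyf (R : realType) (k : nat) (g : 'rV[R]_k -> R) : Prop :=
  exists p : mpoly k R, forall x, g x = peval p x.

Section polyf.
Context {R : realType} {k : nat}.
Implicit Types g h : 'rV[R]_k -> R.

Lemma polyf_peval (p : mpoly k R) : polyf (peval p).
Proof. by exists p. Qed.

Lemma polyf_cst (c : R) : polyf (fun _ : 'rV[R]_k => c).
Proof. by exists (mpolyC k c) => x; rewrite /peval mevalC. Qed.

Lemma polyf_coord (i : 'I_k) : polyf (fun x : 'rV[R]_k => x 0 i).
Proof. by exists (mpolyX R (mnm1 i)) => x; rewrite /peval mevalXU. Qed.

Lemma polyfD g h : polyf g -> polyf h -> polyf (fun x => g x + h x).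
Proof. by move=> [p gp] [q hq]; exists (p + q) => x; rewrite gp hq /peval mevalD. Qed.

Lemma polyfM g h : polyf g -> polyf h -> polyf (fun x => g x * h x).
Proof. by move=> [p gp] [q hq]; exists (p * q) => x; rewrite gp hq /peval mevalM. Qed.

Lemma polyfN g : polyf g -> polyf (fun x => - g x).
Proof. by move=> [p gp]; exists (- p) => x; rewrite gp /peval mevalN. Qed.

Lemma polyfB g h : polyf g -> polyf h -> polyf (fun x => g x - h x).
Proof. by move=> gp hp; apply: polyfD => //; apply: polyfN. Qed.

Lemma polyfX g m : polyf g -> polyf (fun x => g x ^+ m).
Proof. by move=> [p gp]; exists (p ^+ m) => x; rewrite gp /peval rmorphXn. Qed.

Lemma polyf_sum (I : Type) (r : seq I) (P : pred I) (F : I -> 'rV[R]_k -> R) :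
  (forall i, polyf (F i)) -> polyf (fun x => \sum_(i <- r | P i) F i x).
Proof.
move=> Fp; elim: r => [|i r IH].
  by under eq_fun do rewrite big_nil; apply: polyf_cst.
under eq_fun do rewrite big_cons.
by case: (P i) => //; apply: polyfD.
Qed.

Lemma polyf_prod (I : Type) (r : seq I) (P : pred I) (F : I -> 'rV[R]_k -> R) :
  (forall i, polyf (F i)) -> polyf (fun x => \prod_(i <- r | P i) F i x).
Proof.
move=> Fp; elim: r => [|i r IH].
  by under eq_fun do rewrite big_nil; apply: polyf_cst.
under eq_fun do rewrite big_cons.
by case: (P i) => //; apply: polyfM.
Qed.

Lemma polyf_comp n (g : 'rV[R]_n -> R) (h : 'rV[R]_k -> 'rV[R]_n) :
  polyf g -> (forall i, polyf (fun x => h x 0 i)) -> polyf (fun x => g (h x)).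
Proof.
move=> [p gp] hp; under eq_fun do rewrite gp /peval mevalE.
apply: polyf_sum => m; apply: polyfM; first exact: polyf_cst.
by apply: polyf_prod => i; apply: polyfX.
Qed.

End polyf.

(** First-order formulas embedded shallowly, each quantifier binding a whole row vector, so that
    closure properties need no variable indices. Library formulas appear only where quantifier
    elimination is called. *)
Inductive dfn (R : realType) : forall k, ('rV[R]_k -> Prop) -> Prop :=
| dfn_gt0 k (g : 'rV[R]_k -> R) : polyf g -> dfn (fun x => 0 < g x)
| dfn_and k (P Q : 'rV[R]_k -> Prop) : dfn P -> dfn Q -> dfn (fun x => P x /\ Q x)
| dfn_not k (P : 'rV[R]_k -> Prop) : dfn P -> dfn (fun x => ~ P x)
| dfn_ex k n (P : 'rV[R]_(k + n) -> Prop) :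
    dfn P -> dfn (fun x => exists y : 'rV[R]_n, P (row_mx x y)).

Section dfn.
Context {R : realType}.

Lemma dfn_iff k (P Q : 'rV[R]_k -> Prop) : (forall x, P x <-> Q x) -> dfn P -> dfn Q.
Proof. by move=> PQ; have -> : P = Q by apply/funext => x; apply/propext. Qed.

Lemma dfn_comp k n (P : 'rV[R]_n -> Prop) (h : 'rV[R]_k -> 'rV[R]_n) :
  dfn P -> (forall i, polyf (fun x => h x 0 i)) -> dfn (fun x => P (h x)).
Proof.
move=> dP; elim: dP k h => {n P} [n g gp|n P Q _ IP _ IQ|n P _ IP|n m P _ IP] k h hp.
- by apply: dfn_gt0; apply: polyf_comp.
- by apply: dfn_and; [apply: IP|apply: IQ].
- by apply: dfn_not; apply: IP.
(* The substitution is extended by the identity on the bound variables. *)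
- pose h' (z : 'rV[R]_(k + m)) := row_mx (h (lsubmx z)) (rsubmx z).
  apply: (@dfn_iff _ (fun x => exists y : 'rV[R]_m, P (h' (row_mx x y)))) => [x|].
    by split=> -[y Py]; exists y; move: Py; rewrite /h' row_mxKl row_mxKr.
  apply: (@dfn_ex _ k m (fun z => P (h' z))); apply: IP => i; rewrite /h'.
  under eq_fun do rewrite mxE; case: splitP => j _.
    apply: (@polyf_comp _ _ _ (fun w => h w 0 j)) => // l.
    by under eq_fun do rewrite mxE; apply: polyf_coord.
  by under eq_fun do rewrite mxE; apply: polyf_coord.
Qed.

Lemma dfn_or k (P Q : 'rV[R]_k -> Prop) : dfn P -> dfn Q -> dfn (fun x => P x \/ Q x).
Proof.
move=> dP dQ; apply: (@dfn_iff _ (fun x => ~ (~ P x /\ ~ Q x))) => [x|].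
  by rewrite -not_orE; split=> [/contrapT//|pq]; apply.
by apply: dfn_not; apply: dfn_and; apply: dfn_not.
Qed.

Lemma dfn_imp k (P Q : 'rV[R]_k -> Prop) : dfn P -> dfn Q -> dfn (fun x => P x -> Q x).
Proof.
move=> dP dQ; apply: (@dfn_iff _ (fun x => ~ P x \/ Q x)) => [x|].
  by rewrite implyE.
by apply: dfn_or => //; apply: dfn_not.
Qed.

Lemma dfn_all k n (P : 'rV[R]_(k + n) -> Prop) :
  dfn P -> dfn (fun x => forall y : 'rV[R]_n, P (row_mx x y)).
Proof.
move=> dP; apply: (@dfn_iff _ (fun x => ~ exists y : 'rV[R]_n, ~ P (row_mx x y))) => [x|].
  split=> [nP y|Px [y nPy]]; last exact: nPy.
  by have [//|nPy] := pselect (P (row_mx x y)); case: nP; exists y.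
exact: (dfn_not (dfn_ex (dfn_not dP))).
Qed.

Lemma dfn_lt k (g h : 'rV[R]_k -> R) : polyf g -> polyf h -> dfn (fun x => g x < h x).
Proof.
move=> gp hp; apply: (@dfn_iff _ (fun x => 0 < h x - g x)) => [x|]; first by rewrite subr_gt0.
by apply: dfn_gt0; apply: polyfB.
Qed.

Lemma dfn_le k (g h : 'rV[R]_k -> R) : polyf g -> polyf h -> dfn (fun x => g x <= h x).
Proof.
move=> gp hp; apply: (@dfn_iff _ (fun x => ~ (h x < g x))) => [x|].
  by rewrite leNgt; split=> /negP.
by apply: dfn_not; apply: dfn_lt.
Qed.

Lemma dfn_eq k (g h : 'rV[R]_k -> R) : polyf g -> polyf h -> dfn (fun x => g x = h x).
Proof.
move=> gp hp; apply: (@dfn_iff _ (fun x => g x <= h x /\ h x <= g x)) => [x|].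
  by split=> [[a b]|->//]; apply/eqP; rewrite eq_le a b.
by apply: dfn_and; apply: dfn_le.
Qed.

Lemma dfn_true k : dfn (fun _ : 'rV[R]_k => True).
Proof.
apply: (@dfn_iff _ (fun x => 0 < 1 :> R)) => [x|]; first by rewrite ltr01.
by apply: dfn_gt0; apply: polyf_cst.
Qed.

Lemma dfn_all_seq k (I : eqType) (s : seq I) (P : I -> 'rV[R]_k -> Prop) :
  (forall i, dfn (P i)) -> dfn (fun x => forall i, i \in s -> P i x).
Proof.
move=> dP; elim: s => [|i s IH]; first by apply: (dfn_iff _ (dfn_true k)).
apply: (dfn_iff _ (dfn_and (dP i) IH)) => x; split=> [[Pi Ps] j|Ps].
  by rewrite inE => /predU1P[->//|/Ps].
by split=> [|j js]; apply: Ps; rewrite inE ?eqxx ?js ?orbT.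
Qed.

Lemma dfn_allT k (I : finType) (P : I -> 'rV[R]_k -> Prop) :
  (forall i, dfn (P i)) -> dfn (fun x => forall i, P i x).
Proof.
move=> dP; apply: (@dfn_iff _ (fun x => forall i, i \in enum I -> P i x)) => [x|].
  by split=> [Px i|Px i _]; [apply: Px; rewrite mem_enum|exact: Px].
exact: dfn_all_seq.
Qed.

(* The variables of the formula beyond the first [k] are ignored. *)
Lemma dfn_holds k (P : 'rV[R]_k -> Prop) : dfn P ->
  exists f : ordered_qelim.ord.formula R, forall (e : seq R) (x : 'rV[R]_k), (forall i : 'I_k, e`_i = x 0 i) ->
    P x <-> ordered_qelim.ord.holds e f.
Proof.
elim=> {k P} [k g [p gp]|k P Q _ [f fP] _ [f' fQ]|k P _ [f fP]|k n P _ [f fP]].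
- pose t := \big[GRing.Add/GRing.NatConst _ 0]_(m <- msupp p)
      GRing.Mul (GRing.Const (mcoeff m p))
       (\big[GRing.Mul/GRing.NatConst _ 1]_(i < k) GRing.Exp (GRing.Var R i) (m i)).
  exists (ordered_qelim.ord.Lt (GRing.NatConst R 0) t) => e x ex; rewrite gp /peval mevalE /=.
  suff -> : GRing.eval e t = \sum_(m <- msupp p) mcoeff m p * \prod_(i < k) x 0 i ^+ m i by [].
  rewrite /t; elim/big_ind2: _ => //= [a b c d -> -> //|m _]; congr (_ * _).
  elim/big_ind2: _ => //= [a b c d -> -> //|i _]; by rewrite ex.
- by exists (ordered_qelim.ord.And f f') => e x ex /=; rewrite (fP e) // (fQ e).
- by exists (ordered_qelim.ord.Not f) => e x ex /=; rewrite (fP e).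
- have exP e : ordered_qelim.ord.holds e (foldr (@ordered_qelim.ord.Exists _) f (iota k n)) <->
      exists e', (forall i, ~~ (k <= i < k + n)%N -> e'`_i = e`_i) /\ ordered_qelim.ord.holds e' f.
    elim: n k e {P fP} => [|n IH] k e /=.
      split=> [fe|[e' [ee' fe']]]; first by exists e.
      by apply: ordered_qelim.ord.eq_holds fe' => i; rewrite ee' // addn0 ltnNge andbN.
    split=> [[x /IH[e' [ee' fe']]]|[e' [ee' fe']]].
      exists e'; split=> // i ki; rewrite ee' ?nth_set_nth /=; last by lia.
      by case: eqP => // ik; move: ki; rewrite ik leqnn addnS ltnS leq_addr.
    exists e'`_k; apply/IH; exists e'; split=> // i ki; rewrite nth_set_nth /=.
    by case: eqP => [->//|ik]; apply: ee'; lia.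
  exists (foldr (@ordered_qelim.ord.Exists _) f (iota k n)) => e x ex; rewrite exP; split.
    (* Positions [k] to [k + n - 1] receive [y]; padding to at least [size e] makes both lists
       return the default value beyond the end. *)
    move=> [y Pxy]; exists (mkseq (fun i => if (i < k)%N then e`_i else
        if insub (i - k)%N is Some j then y 0 (j : 'I_n) else e`_i) (maxn (size e) (k + n))).
    split.
      move=> i ki; have [iM|iM] := ltnP i (maxn (size e) (k + n)).
        rewrite nth_mkseq //; case: ltnP => // ik; case: insubP => //= j jn _; move: ki jn ik; lia.
      by move: (iM); rewrite geq_max => /andP[ie _]; rewrite !nth_default ?size_mkseq.
    apply/fP; last exact: Pxy.
    move=> i; rewrite nth_mkseq; last by rewrite leq_max ltn_ord orbT.
    rewrite mxE; case: splitP => j ->; first exact: ex.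
    rewrite addKn; case: insubP => [j' _ jj'|]; last by rewrite ltn_ord.
    by congr (y _ _); apply: val_inj.
  move=> [e' [ee' fe']]; exists (\row_j e'`_(k + j)).
  apply/(fP e') => // i; rewrite mxE; case: splitP => j ->; last by rewrite mxE.
  by rewrite ee' ?ex // negb_and -ltnNge ltn_ord.
Qed.

End dfn.

(** * Constant signs on thin regions near the origin *)

Section region.
Context {R : realType}.

Lemma poly_bounded1 (u : {poly R}) : exists2 M, 0 < M & forall s, `|s| <= 1 -> `|u.[s]| <= M.
Proof.
elim/poly_ind: u => [|u c [M M0 uM]].
  by exists 1 => // s _; rewrite horner0 normr0.
exists (M + `|c|) => [|s s1]; first by rewrite ltr_wpDr.
rewrite hornerMXaddC; apply: le_trans (ler_normD _ _) _; rewrite lerD2r normrM.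
by rewrite -[leRHS]mulr1 ler_pM // uM.
Qed.

(** [v] is the multiplicity of the root 0, hence below [size u]; this is how degrees become
    exponents. *)
Lemma poly_lower_near0 (u : {poly R}) : u != 0 ->
  exists v c s0, [/\ (v < size u)%N, 0 < c, 0 < s0 &
    forall s, `|s| < s0 -> c * `|s| ^+ v <= `|u.[s]|].
Proof.
elim/poly_ind: u => [|u c IH]; first by rewrite eqxx.
have [->|c0 uc0] := eqVneq c 0.
  rewrite addr0 => uX0; have u0 : u != 0 by apply: contraNneq uX0 => ->; rewrite mul0r.
  have [v [c' [s0 [vu c'0 s00 H]]]] := IH u0.
  exists v.+1, c', s0; split=> // [|s ss]; first by rewrite size_mulX.
  by rewrite hornerMX exprSr mulrA normrM ler_wpM2r // H.
have [M M0 uM] := poly_bounded1 u; have c0' : 0 < `|c| by rewrite normr_gt0.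
exists 0%N, (`|c| / 2), (Num.min 1 (`|c| / 2 / M)); split.
- by rewrite size_poly_gt0.
- by rewrite divr_gt0.
- by rewrite lt_min ltr01 !divr_gt0.
- move=> s; rewrite lt_min => /andP[s1]; rewrite ltr_pdivlMr // => sM.
  have us : `|u.[s] * s| <= `|c| / 2.
    rewrite normrM; apply: le_trans (ltW sM).
    by rewrite mulrC ler_wpM2l // uM // ltW.
  rewrite expr0 mulr1 hornerMXaddC.
  have := ler_normB (u.[s] * s + c) (u.[s] * s); rewrite addrAC subrr add0r; lra.
Qed.

Lemma poly_sg_near0 (u : {poly R}) : u != 0 ->
  exists v c s0 (b : bool), [/\ 0 < c, 0 < s0 &
    forall s, 0 < s < s0 -> c * s ^+ v <= (-1) ^+ b * u.[s]].
Proof.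
elim/poly_ind: u => [|u c IH]; first by rewrite eqxx.
have [->|c0 _] := eqVneq c 0.
  rewrite addr0 => uX0; have /IH[v [c' [s0 [b [c'0 s00 H]]]]] : u != 0.
    by apply: contraNneq uX0 => ->; rewrite mul0r.
  exists v.+1, c', s0, b; split=> // s s0s; rewrite hornerMX mulrA exprSr mulrA.
  by rewrite ler_pM2r ?H //; case/andP: s0s.
have [M M0 uM] := poly_bounded1 u; have c0' : 0 < `|c| by rewrite normr_gt0.
exists 0%N, (`|c| / 2), (Num.min 1 (`|c| / 2 / M)), (c < 0); split.
- by rewrite divr_gt0.
- by rewrite lt_min ltr01 !divr_gt0.
- move=> s /andP[s0]; rewrite lt_min => /andP[s1 sM].
  have us : `|(-1) ^+ (c < 0)%R * (u.[s] * s)| <= `|c| / 2.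
    rewrite normrMsign normrM (gtr0_norm s0); move: sM; rewrite ltr_pdivlMr // => sM.
    by apply: le_trans (ltW sM); rewrite mulrC ler_pM2l // uM // gtr0_norm // ltW.
  rewrite expr0 mulr1 hornerMXaddC mulrDr -normrEsign.
  by move: us; rewrite ler_norml => /andP[us _]; lra.
Qed.

Lemma poly2_bounded (p : {poly {poly R}}) :
  exists2 M, 0 < M & forall s r : R, 0 < s < 1 -> 0 < r < 1 -> `|p.[r%:P].[s]| <= M.
Proof.
elim/poly_ind: p => [|p c [M M0 pM]].
  by exists 1 => // s r _ _; rewrite horner0 horner0 normr0.
have [M' M'0 cM] := poly_bounded1 c.
exists (M + M') => [|s r s01 r01]; first by rewrite addr_gt0.
rewrite hornerMXaddC hornerD hornerM hornerC; apply: le_trans (ler_normD _ _) _.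
rewrite lerD ?cM //; first last.
  by case/andP: s01 => s0 s1; rewrite gtr0_norm // ltW.
rewrite normrM; case/andP: (r01) => r0 r1; rewrite -[leRHS]mulr1 ler_pM // ?pM //.
by rewrite gtr0_norm // ltW.
Qed.

Lemma poly2_sg_near0 (p : {poly {poly R}}) : exists (N : nat) (s0 z : R), 0 < s0 /\
  forall s r : R, 0 < s < s0 -> 0 < r < s ^+ N -> Num.sg p.[r%:P].[s] = z.
Proof.
elim/poly_ind: p => [|p c [N [s0 [z [s00 H]]]]].
  by exists 0%N, 1, 0; split=> // s r _ _; rewrite horner0 horner0 sgr0.
have [->|c0] := eqVneq c 0.
  exists N, s0, z; split=> // s r s0s rN; rewrite addr0 hornerMX hornerM hornerC sgrM.
  by rewrite H // gtr0_sg ?mulr1 //; case/andP: rN.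
have [v [k [s1 [b [k0 s10 cv]]]]] := poly_sg_near0 c0.
have [M M0 pM] := poly2_bounded p.
exists v.+1, (Num.min 1 (Num.min s1 (k / M))), ((-1) ^+ b); split.
  by rewrite !lt_min ltr01 s10 divr_gt0.
move=> s r /andP[sp]; rewrite !lt_min => /and3P[ss1 s1s skM] /andP[rp rs].
have r1 : r < 1 by apply: lt_le_trans rs _; rewrite exprn_ile1 // ltW.
have {}cv := cv s; rewrite sp s1s in cv; have {}cv := cv isT.
have pr : `|p.[r%:P].[s] * r| < k * s ^+ v.
  rewrite normrM (gtr0_norm rp).
  apply: (@le_lt_trans _ _ (M * r)); first by rewrite ler_pM2r // pM ?sp ?rp.
  apply: (@lt_le_trans _ _ (M * s ^+ v.+1)); first by rewrite ltr_pM2l.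
  rewrite exprS mulrA ler_pM2r ?exprn_gt0 // mulrC -ler_pdivlMr //.
  exact: ltW.
rewrite hornerMXaddC hornerD hornerM hornerC.
suff : 0 < (-1) ^+ b * (p.[r%:P].[s] * r + c.[s]).
  case: (b); rewrite ?expr1 ?expr0 ?mul1r ?mulN1r ?oppr_gt0 => h; first exact: ltr0_sg.
  exact: gtr0_sg.
rewrite mulrDr; have : `|(-1) ^+ b * (p.[r%:P].[s] * r)| < k * s ^+ v by rewrite normrMsign.
by rewrite ltr_norml => /andP[h _]; lra.
Qed.

Lemma eval_poly2 (t : GRing.term R) : GRing.rterm t ->
  exists p : {poly {poly R}}, forall s r : R, GRing.eval [:: s; r] t = p.[r%:P].[s].
Proof.
elim: t => //=.
- move=> [|[|i]] _ /=.
  + by exists 'X%:P => s r; rewrite hornerC hornerX.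
  + by exists 'X => s r; rewrite hornerX hornerC.
  + by exists 0 => s r; rewrite !horner0 nth_nil.
- by move=> x _; exists x%:P%:P => s r; rewrite !hornerC.
- by move=> n _; exists n%:R%:P%:P => s r; rewrite !hornerC.
- move=> t IH u IH' /andP[/IH[p pP] /IH'[q qP]]; exists (p + q) => s r.
  by rewrite pP qP !hornerD.
- by move=> t IH /IH[p pP]; exists (- p) => s r; rewrite pP !hornerN.
- by move=> t IH n /IH[p pP]; exists (p *+ n) => s r; rewrite pP !hornerMn.
- move=> t IH u IH' /andP[/IH[p pP] /IH'[q qP]]; exists (p * q) => s r.
  by rewrite pP qP !hornerM.
- by move=> t IH n /IH[p pP]; exists (p ^+ n) => s r; rewrite pP !horner_exp.
Qed.

Lemma qf_region (f : ordered_qelim.ord.formula R) :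
  ordered_qelim.ord.qf_form f -> ordered_qelim.ord.rformula f ->
  exists (N : nat) (s0 : R) (b : bool), 0 < s0 /\ forall s r : R, 0 < s < s0 -> 0 < r < s ^+ N ->
    ordered_qelim.ord.qf_eval [:: s; r] f = b.
Proof.
(* Two regions contain a common one: the larger exponent, the smaller bound on [s], and [s < 1] to
   compare the powers. *)
have comb N s0 N' s0' (s r : R) : 0 < s < Num.min 1 (Num.min s0 s0') -> 0 < r < s ^+ maxn N N' ->
    [/\ 0 < s < s0, 0 < s < s0', 0 < r < s ^+ N & 0 < r < s ^+ N'].
  rewrite !lt_min => /and4P[sp s1 ss0 ss0'] /andP[rp rs]; rewrite sp ss0 ss0' rp /=.
  split=> //; apply: lt_le_trans rs _; apply: ler_wiXn2l; rewrite ?ltW //.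
    exact: leq_maxl.
  exact: leq_maxr.
have bin (op : bool -> bool -> bool) f1 f2 :
  (exists (N : nat) (s0 : R) (b : bool), 0 < s0 /\ forall s r : R, 0 < s < s0 -> 0 < r < s ^+ N ->
    ordered_qelim.ord.qf_eval [:: s; r] f1 = b) ->
  (exists (N : nat) (s0 : R) (b : bool), 0 < s0 /\ forall s r : R, 0 < s < s0 -> 0 < r < s ^+ N ->
    ordered_qelim.ord.qf_eval [:: s; r] f2 = b) ->
  (exists (N : nat) (s0 : R) (b : bool), 0 < s0 /\ forall s r : R, 0 < s < s0 -> 0 < r < s ^+ N ->
    op (ordered_qelim.ord.qf_eval [:: s; r] f1) (ordered_qelim.ord.qf_eval [:: s; r] f2) = b).
  move=> [N [s0 [b [s00 H]]]] [N' [s0' [b' [s00' H']]]].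
  exists (maxn N N'), (Num.min 1 (Num.min s0 s0')), (op b b'); split.
    by rewrite !lt_min ltr01 s00.
  by move=> s r /comb/[apply]-[? ? ? ?]; rewrite H // H'.
have at_ t u : GRing.rterm t -> GRing.rterm u ->
    exists (N : nat) (s0 z : R), 0 < s0 /\ forall s r : R, 0 < s < s0 -> 0 < r < s ^+ N ->
      Num.sg (GRing.eval [:: s; r] t - GRing.eval [:: s; r] u) = z.
  move=> /eval_poly2[p pP] /eval_poly2[q qP].
  have [N [s0 [z [s00 H]]]] := poly2_sg_near0 (p - q).
  by exists N, s0, z; split=> // s r ss rr; rewrite pP qP -!hornerN -!hornerD H.
elim: f => //=.
- by move=> b _ _; exists 0%N, 1, b.
- move=> t u _ /andP[/at_/[apply]]-[N [s0 [z [s00 H]]]]; exists N, s0, (z == 0); split=> // s r ss rr.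
  by rewrite -subr_eq0 -sgr_eq0 H.
- move=> t u _ /andP[/at_/[apply]]-[N [s0 [z [s00 H]]]]; exists N, s0, (z < 0); split=> // s r ss rr.
  by rewrite -subr_lt0 -sgr_lt0 H.
- move=> t u _ /andP[/at_/[apply]]-[N [s0 [z [s00 H]]]]; exists N, s0, (z <= 0); split=> // s r ss rr.
  by rewrite -subr_le0 -sgr_le0 H.
- by move=> f1 IH1 f2 IH2 /andP[q1 q2] /andP[r1 r2]; apply: bin; [apply: IH1|apply: IH2].
- by move=> f1 IH1 f2 IH2 /andP[q1 q2] /andP[r1 r2]; apply: bin; [apply: IH1|apply: IH2].
- by move=> f1 IH1 f2 IH2 /andP[q1 q2] /andP[r1 r2]; apply: (bin implb); [apply: IH1|apply: IH2].
- move=> f1 IH1 q1 r1; have [N [s0 [b [s00 H]]]] := IH1 q1 r1.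
  by exists N, s0, (~~ b); split=> // s r ss rr; rewrite H.
Qed.

Definition vec2 (s r : R) : 'rV[R]_2 := \row_i [:: s; r]`_i.

(** Quantifier elimination leaves finitely many sign conditions on polynomials in [(s, r)], each
    constant on such a region. The dichotomy stands in for curve selection: a definable property met
    in every region holds throughout one. *)
Lemma dfn_region (P : 'rV[R]_2 -> Prop) : dfn P -> exists (N : nat) (s0 : R), 0 < s0 /\
  ((forall s r : R, 0 < s < s0 -> 0 < r < s ^+ N -> P (vec2 s r)) \/
   (forall s r : R, 0 < s < s0 -> 0 < r < s ^+ N -> ~ P (vec2 s r))).
Proof.
move=> /dfn_holds[f fP].
have rf := ordered_qelim.ord.to_rform_rformula f.
have wf := @qe_rcf.wf_QE_wproj R.
have /andP[qf rf'] := ordered_qelim.ord.quantifier_elim_wf wf rf.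
have [N [s0 [b [s00 H]]]] := qf_region qf rf'.
exists N, s0; split=> //.
have PE s r : 0 < s < s0 -> 0 < r < s ^+ N -> P (vec2 s r) <-> b.
  move=> ss rr; rewrite -(H s r ss rr) (fP [:: s; r]); last by move=> i; rewrite mxE.
  rewrite -ordered_qelim.ord.to_rformP.
  by apply: rwP; apply: ordered_qelim.ord.quantifier_elim_rformP rf; [exact: wf|exact: (@qe_rcf.valid_QE_wproj R)].
by case: b PE {H} => PE; [left|right] => s r ss rr; rewrite PE.
Qed.
End region.

(** * Polynomial functions and the max norm *)

Section rvnorm.
Context {R : realType} {n : nat}.
Implicit Types x y : 'rV[R]_n.

Lemma rvnorm_coord x i : `|x 0 i| <= `|x|.
Proof.
rewrite [leRHS]/Num.norm /= mx_normrE; apply/bigmax_geP; right => /=.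
by exists (ord0, i); rewrite ?ord1.
Qed.

Lemma rvnorm_le x r : 0 <= r -> (forall i, `|x 0 i| <= r) -> `|x| <= r.
Proof.
move=> r0 xr; rewrite [leLHS]/Num.norm /= mx_normrE; apply/bigmax_leP; split=> //.
by move=> [i j] _ /=; rewrite ord1.
Qed.

Lemma rvnorm_lt x r : 0 < r -> (forall i, `|x 0 i| < r) -> `|x| < r.
Proof.
move=> r0 xr; rewrite [ltLHS]/Num.norm /= mx_normrE; apply/bigmax_ltP; split=> //.
by move=> [i j] _ /=; rewrite ord1.
Qed.

Lemma closed_box_compact (c : 'rV[R]_n) (r : R) : compact [set x : 'rV[R]_n | `|x - c| <= r].
Proof.
apply: bounded_closed_compact.
  exists (r + `|c|); split; first exact: num_real.
  move=> M rM x /= xr; apply: le_trans (ltW rM).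
  by rewrite -[x](subrK c); apply: le_trans (ler_normD _ _) _; rewrite lerD2r.
apply: (@closed_comp _ _ (fun x : 'rV[R]_n => `|x - c|) [set t | t <= r]); last exact: closed_le.
move=> x _; apply: continuous_comp; last exact: norm_continuous.
by apply: (@continuousB _ _ _ id (fun=> c)) => //; exact: cst_continuous.
Qed.

Lemma mpoly_ring_ind (P : mpoly n R -> Prop) :
  (forall c, P (mpolyC n c)) -> (forall i, P (mpolyX R (mnm1 i))) ->
  (forall p q, P p -> P q -> P (p + q)) -> (forall p q, P p -> P q -> P (p * q)) ->
  forall p, P p.
Proof.
move=> PC PX PD PM p.
have PXn q k : P q -> P (q ^+ k).
  by move=> Pq; elim: k => [|k IH]; rewrite ?expr0 ?exprS; [exact: PC|exact: PM].
rewrite [p]mpolyE; elim/big_rec: _ => [|m q' _ Pq]; first by rewrite -mpolyC0; exact: PC.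
apply: PD Pq; rewrite -mul_mpolyC; apply: (PM); first exact: PC.
rewrite mpolyXE_id; elim/big_rec: _ => [|i q'' _ Pq']; first exact: PC.
by apply: (PM) Pq'; apply: PXn; exact: PX.
Qed.

Lemma peval_continuous (p : mpoly n R) : continuous (peval p).
Proof.
elim/mpoly_ring_ind: p => [c|i|p q pc qc|p q pc qc].
- have -> : peval (mpolyC n c) = fun=> c by apply/funext => x; rewrite /peval mevalC.
  exact: cst_continuous.
- have -> : peval (mpolyX R (mnm1 i)) = fun x => x 0 i by apply/funext => x; rewrite /peval mevalXU.
  exact: coord_continuous.
- have -> : peval (p + q) = fun x => peval p x + peval q x by apply/funext => x; rewrite /peval mevalD.
  by move=> x; exact: (continuousD (pc x) (qc x)).
- have -> : peval (p * q) = fun x => peval p x * peval q x by apply/funext => x; rewrite /peval mevalM.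
  by move=> x; exact: (continuousM (pc x) (qc x)).
Qed.

Lemma polyf_continuous (g : 'rV[R]_n -> R) : polyf g -> continuous g.
Proof.
by move=> [p gp]; have -> : g = peval p; [apply/funext|exact: peval_continuous].
Qed.

Lemma peval_bounded (p : mpoly n R) (M : R) :
  exists2 B, 0 < B & forall x, `|x| <= M -> `|peval p x| <= B.
Proof.
elim/mpoly_ring_ind: p => [c|i|p q [B B0 pB] [B' B'0 qB]|p q [B B0 pB] [B' B'0 qB]].
- by exists (1 + `|c|) => [|x _]; rewrite ?ltr_wpDr // /peval mevalC lerDr.
- exists (1 + `|M|) => [|x xM]; rewrite ?ltr_wpDr // /peval mevalXU.
  have := rvnorm_coord x i; have := ler_norm M; lra.
- exists (B + B') => [|x xM]; first exact: addr_gt0.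
  by rewrite /peval mevalD (le_trans (ler_normD _ _)) // lerD ?pB ?qB.
- exists (B * B') => [|x xM]; first exact: mulr_gt0.
  by rewrite /peval mevalM normrM ler_pM ?pB ?qB.
Qed.

(** Induction on ring operations: the remainder of a product is [p x] times the remainder of [q],
    plus the linear part of [p] times the increment of [q], plus the remainder of [p] times
    [q y]. *)
Lemma peval_taylor (p : mpoly n R) (M : R) : exists2 C, 0 < C & forall x y, `|x| <= M -> `|y| <= M ->
  `|peval p y - peval p x - \sum_i peval (mderiv i p) x * (y 0 i - x 0 i)| <= C * `|y - x| ^+ 2.
Proof.
have lin q : exists2 L, 0 < L & forall x y, `|x| <= M ->
    `|\sum_i peval (mderiv i q) x * (y 0 i - x 0 i)| <= L * `|y - x|.
  have /choice[B HB] : forall i, exists b : R, 0 < b /\ forall x, `|x| <= M -> `|peval (mderiv i q) x| <= b.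
    by move=> i; have [b b0 qb] := peval_bounded (mderiv i q) M; exists b.
  exists (1 + \sum_i B i) => [|x y xM].
    by rewrite ltr_wpDr // sumr_ge0 // => i _; rewrite ltW //; case: (HB i).
  rewrite mulrDl mul1r mulr_suml (le_trans (ler_norm_sum _ _ _)) // ler_wpDl // ler_sum // => i _.
  rewrite normrM ler_pM //; first by case: (HB i) => _; apply.
  by have := rvnorm_coord (y - x) i; rewrite !mxE.
elim/mpoly_ring_ind: p => [c|i|p q [C C0 pC] [C' C'0 qC]|p q [C C0 pC] [C' C'0 qC]].
- exists 1 => // x y _ _; rewrite /peval !mevalC subrr sub0r normrN big1 ?normr0 ?mul1r ?exprn_ge0 //.
  by move=> i _; rewrite mderivC meval0 mul0r.
- exists 1 => // x y _ _; rewrite (bigD1 i) //= big1 ?addr0 => [|j ji].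
    rewrite mderivX mnm1E eqxx scale1r /peval !mevalXU.
    have -> : (mnm_sub (mnm1 i) (mnm1 i)) = mnm0 by apply/mnmP => j; rewrite mnmBE mnm0E subnn.
    by rewrite mpolyX0 meval1 !mul1r subrr normr0 exprn_ge0.
  by rewrite mderivX mnm1E eq_sym (negPf ji) scale0r /peval meval0 mul0r.
- exists (C + C') => [|x y xM yM]; first exact: addr_gt0.
  rewrite mulrDl; apply: le_trans (lerD (pC x y xM yM) (qC x y xM yM)).
  apply: le_trans (ler_normD _ _); rewrite le_eqVlt; apply/orP; left; apply/eqP; congr `|_|.
  under eq_bigr do rewrite mderivD /peval mevalD mulrDl.
  by rewrite big_split /= /peval !mevalD; ring.
- have [B B0 pB] := peval_bounded p M; have [B' B'0 qB] := peval_bounded q M.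
  have [L L0 pL] := lin p; have [L' L'0 qL] := lin q.
  exists (B * C' + L * (L' + C' * (2 * `|M|)) + C * B') => [|x y xM yM].
    apply: addr_gt0; last exact: mulr_gt0.
    apply: addr_gt0; first exact: mulr_gt0.
    by apply: mulr_gt0 => //; rewrite ltr_wpDr // !mulr_ge0 // ltW.
  set dp := \sum_i peval (mderiv i p) x * (y 0 i - x 0 i).
  set dq := \sum_i peval (mderiv i q) x * (y 0 i - x 0 i).
  have -> : \sum_i peval (mderiv i (p * q)) x * (y 0 i - x 0 i) = dp * peval q x + peval p x * dq.
    rewrite /dp /dq mulr_suml mulr_sumr -big_split /=; apply: eq_bigr => i _.
    by rewrite mderivM /peval mevalD !mevalM; ring.
  have -> : peval (p * q) y - peval (p * q) x - (dp * peval q x + peval p x * dq) =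
     peval p x * (peval q y - peval q x - dq) + dp * (peval q y - peval q x) +
     (peval p y - peval p x - dp) * peval q y by rewrite /peval !mevalM; ring.
  have qy : `|peval q y - peval q x| <= (L' + C' * (2 * `|M|)) * `|y - x|.
    rewrite -[X in `|X|](subrK dq); apply: le_trans (ler_normD _ _) _.
    rewrite mulrDl addrC lerD ?qL // (le_trans (qC _ _ xM yM)) // expr2 mulrA ler_wpM2r // ler_wpM2l ?(ltW C'0) //.
    by rewrite (le_trans (ler_normB _ _)) //; have := ler_norm M; lra.
  rewrite [leRHS]mulrDl [X in _ <= X + _]mulrDl.
  apply: le_trans (ler_normD _ _) _; apply: lerD.
    apply: le_trans (ler_normD _ _) _; apply: lerD; rewrite normrM.
      by rewrite -mulrA ler_pM ?pB ?qC.
    rewrite expr2 mulrACA -mulrA; rewrite mulrA [X in _ <= X]mulrA.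
    apply: (@le_trans _ _ ((L * `|y - x|) * ((L' + C' * (2 * `|M|)) * `|y - x|)));
      last by rewrite le_eqVlt; apply/orP; left; apply/eqP; ring.
    by rewrite ler_pM // pL.
  by rewrite normrM mulrAC ler_pM ?pC ?qB.
Qed.

End rvnorm.

(** * Definable choice of one point on each level set *)

Section selection.
Context {R : realType} {n : nat}.
Implicit Types (f : 'rV[R]_n -> R) (B : 'rV[R]_n -> Prop).

Lemma polyf_rsubmx k f : polyf f -> polyf (fun z : 'rV[R]_(k + n) => f (rsubmx z)).
Proof.
by move=> fp; apply: polyf_comp => // i; under eq_fun do rewrite mxE; exact: polyf_coord.
Qed.

Lemma polyf_lsubmx k f : polyf f -> polyf (fun z : 'rV[R]_(n + k) => f (lsubmx z)).
Proof.
by move=> fp; apply: polyf_comp => // i; under eq_fun do rewrite mxE; exact: polyf_coord.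
Qed.

Lemma dfn_rsubmx k B : dfn B -> dfn (fun z : 'rV[R]_(k + n) => B (rsubmx z)).
Proof.
by move=> fp; apply: dfn_comp => // i; under eq_fun do rewrite mxE; exact: polyf_coord.
Qed.

Lemma dfn_lsubmx k B : dfn B -> dfn (fun z : 'rV[R]_(n + k) => B (lsubmx z)).
Proof.
by move=> fp; apply: dfn_comp => // i; under eq_fun do rewrite mxE; exact: polyf_coord.
Qed.

(** One step of the lexicographic minimization carried out in [dfn_selection]. *)
Definition selstep f B (i : 'I_n) (x : 'rV[R]_n) : Prop :=
  B x /\ forall y, B y -> f y = f x -> x 0 i <= y 0 i.

Lemma dfn_selstep f B i : polyf f -> dfn B -> dfn (selstep f B i).
Proof.
move=> fp dB; apply: dfn_and => //.
pose P (z : 'rV[R]_(n + n)) := B (rsubmx z) -> f (rsubmx z) = f (lsubmx z) ->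
  lsubmx z 0 i <= rsubmx z 0 i.
apply: (@dfn_iff _ _ (fun x => forall y, P (row_mx x y))) => [x|].
  by split=> H y; move: (H y); rewrite /P row_mxKl row_mxKr.
apply: dfn_all; apply: dfn_imp; first exact: dfn_rsubmx.
apply: dfn_imp; first by apply: dfn_eq; [exact: polyf_rsubmx|exact: polyf_lsubmx].
apply: dfn_le; [apply: (@polyf_lsubmx _ (fun x => x 0 i))|apply: (@polyf_rsubmx _ (fun x => x 0 i))];
  exact: polyf_coord.
Qed.

Lemma selstep_fiber f B i (s : R) : compact [set x | B x /\ f x = s] ->
  compact [set x | selstep f B i x /\ f x = s] /\
  ((exists x, B x /\ f x = s) -> exists x, selstep f B i x /\ f x = s).
Proof.
move=> cB; have [|B0] := pselect (exists x, B x /\ f x = s); last first.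
  split=> [|/B0//]; rewrite (_ : [set x | _] = set0); first exact: compact0.
  by apply/seteqP; split=> // x /= [[Bx _] fx]; apply: B0; exists x.
move=> [x0 [Bx0 fx0]].
have [||c] := @compact_EVT_min _ R (fun x : 'rV[R]_n => x 0 i) _ _ cB; first by exists x0.
  by apply: continuous_subspaceT => x; exact: coord_continuous.
rewrite inE => -[Bc fc] cmin.
have cS : selstep f B i c.
  by split=> // y By fyc; apply: cmin; rewrite inE; split=> //; rewrite fyc.
split=> [|_]; last by exists c.
rewrite (_ : [set x | _] = [set x | B x /\ f x = s] `&` [set x : 'rV[R]_n | x 0 i <= c 0 i]).
  apply: compact_closedI => //.
  apply: (@closed_comp _ _ (fun x : 'rV[R]_n => x 0 i) [set t | t <= c 0 i]); last exact: closed_le.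
  by move=> x _; exact: coord_continuous.
apply/seteqP; split=> x /=.
  by move=> [[Bx xm] fx]; split=> //; apply: xm => //; rewrite fx.
move=> [[Bx fx] xc]; split=> //; split=> // y By fy; apply: le_trans xc _.
by apply: cmin; rewrite inE; split=> //; rewrite fy.
Qed.

(** Selects the lexicographically least point of each level set: minimizing one coordinate after
    another keeps the fibres compact, nonempty and definable, and in the end at most one point
    remains on each. *)
Lemma dfn_selection f B : polyf f -> dfn B -> compact [set x | B x] ->
  exists B', [/\ dfn B', forall x, B' x -> B x,
    forall x, B x -> exists x', B' x' /\ f x' = f x &
    forall x y, B' x -> B' y -> f x = f y -> x = y].
Proof.
move=> fp dB cB; have cf s : compact [set x | B x /\ f x = s].
  rewrite (_ : [set x | _] = [set x | B x] `&` (f @^-1` [set s])); last by [].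
  apply: compact_closedI => //; apply: closed_comp; last exact: closed_eq.
  by move=> x _; exact: polyf_continuous.
have : exists B', [/\ dfn B', forall x, B' x -> B x,
    forall x, B x -> exists x', B' x' /\ f x' = f x &
    forall x y, B' x -> B' y -> f x = f y -> forall i, i \in enum 'I_n -> x 0 i = y 0 i].
  elim: (enum 'I_n) B dB cf {cB} => [|i l IH] B dB cf.
    by exists B; split=> // x Bx; exists x.
  have [||B' [dB' B'B BB' B'u]] := IH (selstep f B i).
  - exact: dfn_selstep.
  - by move=> s; case: (selstep_fiber i (cf s)).
  exists B'; split=> //.
  - by move=> x /B'B[].
  - move=> x Bx; have [y [By fy]] : exists y, selstep f B i y /\ f y = f x.
      by have [_ ] := selstep_fiber i (cf (f x)); apply; exists x.
    by have [z [Bz fz]] := BB' _ By; exists z; rewrite fz.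
  - move=> x y B'x B'y fxy j; rewrite inE => /predU1P[->|]; last exact: B'u.
    have [Bx xm] := B'B _ B'x; have [By ym] := B'B _ B'y.
    by apply/eqP; rewrite eq_le xm // ym.
move=> [B' [dB' B'B BB' B'u]]; exists B'; split=> // x y B'x B'y fxy.
by apply/rowP => i; apply: B'u; rewrite ?mem_enum.
Qed.

End selection.

(** * From small increments to unbounded growth *)

Section region2.
Context {R : realType}.

(** The predicates are treated one at a time: each is true on some region, which ends the search, or
    false on one, and is then discarded. *)
Lemma dfn_region_fin (I : eqType) (l : seq I) (P : I -> 'rV[R]_2 -> Prop) (N : nat) (s0 : R) :
  (forall i, dfn (P i)) -> 0 < s0 ->
  (forall s r, 0 < s < s0 -> 0 < r < s ^+ N -> exists2 i, i \in l & P i (vec2 s r)) ->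
  exists i (N' : nat) (s1 : R), 0 < s1 /\
    forall s r, 0 < s < s1 -> 0 < r < s ^+ N' -> P i (vec2 s r).
Proof.
move=> dP; elim: l N s0 => [|i l IH] N s0 s00 H.
  pose s := Num.min 1 (s0 / 2).
  have sp : 0 < s by rewrite lt_min ltr01 divr_gt0.
  have [||i] := H s (s ^+ N / 2); rewrite ?sp ?divr_gt0 ?exprn_gt0 //=.
  - by rewrite gt_min; apply/orP; right; lra.
  - by rewrite ltr_pdivrMr // ltr_pMr ?exprn_gt0 // ltr1n.
have [N' [s1 [s10 [HT|HF]]]] := dfn_region (dP i); first by exists i, N', s1.
apply: (IH (maxn N N') (Num.min 1 (Num.min s0 s1))); first by rewrite !lt_min ltr01 s00.
move=> s r; rewrite !lt_min => /and4P[sp s1' ss0 ss1] /andP[rp rs].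
have le_ M : (M <= maxn N N')%N -> r < s ^+ M.
  by move=> MN; apply: lt_le_trans rs _; apply: ler_wiXn2l; rewrite ?ltW.
have [||j] := H s r; rewrite ?sp ?ss0 ?rp ?le_ ?leq_maxl //.
rewrite inE => /predU1P[->|jl] Pj; last by exists j.
by exfalso; apply: HF Pj; rewrite ?sp ?ss1 ?rp ?le_ ?leq_maxr.
Qed.

(* Subdividing [[a, b]] into steps admitted by the hypothesis. *)
Lemma small_steps_grow (u : R -> R) (L s0 : R) (N : nat) : 0 < L ->
  (forall s r, 0 < s < s0 -> 0 < r < s ^+ N -> 0 < s - r -> r <= L * s * (u s - u (s - r))) ->
  forall a b, 0 < a -> a < b -> b < s0 -> b - a <= L * b * (u b - u a).
Proof.
move=> L0 H a b a0 ab bs0.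
have aN : 0 < a ^+ N by rewrite exprn_gt0.
have [m mP] : exists m : nat, (b - a) / a ^+ N < m%:R.
  by exists (Num.bound ((b - a) / a ^+ N)); rewrite archi_boundP // divr_ge0 // ?ltW // subr_gt0.
have m0 : 0 < m%:R :> R by apply: le_lt_trans mP; rewrite divr_ge0 // ?ltW // subr_gt0.
pose r := (b - a) / m%:R.
have r0 : 0 < r by rewrite divr_gt0 // subr_gt0.
have rN : r < a ^+ N by rewrite ltr_pdivrMr // mulrC -ltr_pdivrMr.
have step j : (j <= m)%N -> j%:R * r <= L * b * (u (a + j%:R * r) - u a).
  elim: j => [_|j IH jm]; first by rewrite mul0r addr0 subrr mulr0.
  have aj : a + j.+1%:R * r <= b.
    rewrite -lerBrDl /r mulrA ler_pdivrMr // mulrC ler_pM2l ?subr_gt0 // ler_nat //.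
  have ajr : a + j.+1%:R * r - r = a + j%:R * r by rewrite -natr1; ring.
  have aj0 : 0 < a + j%:R * r by rewrite ltr_pwDl // mulr_ge0 // ltW.
  have aj0' : a <= a + j.+1%:R * r by rewrite lerDl mulr_ge0 // ltW.
  have := H (a + j.+1%:R * r) r.
  rewrite ajr (lt_le_trans a0 aj0') (le_lt_trans aj bs0) r0 aj0 (lt_le_trans rN) => [h|]; last first.
    by apply: lerXn2r => //; rewrite nnegrE ltW // (lt_le_trans a0 aj0').
  have {}h := h isT isT isT; have := IH (ltnW jm).
  have : 0 <= u (a + j.+1%:R * r) - u (a + j%:R * r).
    rewrite -(pmulr_rge0 _ (_ : 0 < L * (a + j.+1%:R * r))); first exact: le_trans (ltW r0) h.
    by rewrite mulr_gt0 // (lt_le_trans a0 aj0').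
  move=> up ih; rewrite -[X in X * r <= _]natr1 mulrDl mul1r.
  have -> : L * b * (u (a + j.+1%:R * r) - u a) = L * b * (u (a + j%:R * r) - u a) +
      L * b * (u (a + j.+1%:R * r) - u (a + j%:R * r)) by ring.
  apply: lerD => //; apply: le_trans h _.
  by rewrite ler_wpM2r // ler_pM2l.
have := step m (leqnn m); rewrite /r mulrCA divff ?gt_eqF // mulr1.
by rewrite [a + _]addrC subrK.
Qed.

(** The hypothesis is a discrete form of [u' >= 1 / (L * s)]. Like a logarithm, [u] drops by at
    least [1 / (2 * L)] at each halving of [s], which a bounded function cannot sustain. *)
Lemma small_steps_unbounded (u : R -> R) (L M s0 : R) (N : nat) : 0 < L -> 0 < s0 ->
  (forall s, 0 < s < s0 -> `|u s| <= M) ->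
  (forall s r, 0 < s < s0 -> 0 < r < s ^+ N -> 0 < s - r -> r <= L * s * (u s - u (s - r))) ->
  False.
Proof.
move=> L0 s00 uM /(small_steps_grow L0) H.
pose b := s0 / 2; have b0 : 0 < b by rewrite divr_gt0.
have bs : b < s0 by rewrite /b; lra.
have step k : k%:R <= 2 * L * (u b - u (b / 2 ^+ k)).
  elim: k => [|k IH]; first by rewrite expr0 divr1 subrr mulr0.
  have bk : 0 < b / 2 ^+ k by rewrite divr_gt0 // exprn_gt0.
  have bkb : b / 2 ^+ k <= b by rewrite ler_pdivrMr ?exprn_gt0 // ler_pMr // exprn_ege1 // ler1n.
  have e : b / 2 ^+ k.+1 = b / 2 ^+ k / 2 by rewrite exprSr invfM mulrA.
  have := H (b / 2 ^+ k.+1) (b / 2 ^+ k); rewrite e.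
  have -> : b / 2 ^+ k - b / 2 ^+ k / 2 = b / 2 ^+ k / 2 by lra.
  rewrite divr_gt0 // (le_lt_trans bkb bs) ltr_pdivrMr // ltr_pMr // ltr1n => /(_ isT isT isT) h.
  have : 1 <= 2 * L * (u (b / 2 ^+ k) - u (b / 2 ^+ k / 2)).
    by rewrite -(ler_pM2l bk) mulr1; move: h; lra.
  by rewrite -natr1; move: IH; lra.
have [k kP] : exists k : nat, 2 * L * (2 * M) < k%:R.
  have M0 : 0 <= M by apply: le_trans (uM b _); rewrite ?b0.
  by exists (Num.bound (2 * L * (2 * M))); rewrite archi_boundP // !mulr_ge0 // ltW.
have bk : 0 < b / 2 ^+ k < s0.
  rewrite divr_gt0 ?exprn_gt0 //=; apply: le_lt_trans bs.
  by rewrite ler_pdivrMr ?exprn_gt0 // ler_pMr // exprn_ege1 // ler1n.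
have := step k; have := uM _ bk; have := uM b; rewrite b0 bs => /(_ isT).
rewrite !ler_norml => /andP[_ h1] /andP[h2 _]; apply/negP; rewrite -ltNge.
apply: le_lt_trans kP; rewrite ler_pM2l ?mulr_gt0 //; lra.
Qed.

End region2.

(** * Domination by the gradient near a zero *)

Definition gradsq (R : realType) (n : nat) (p : mpoly n R) (x : 'rV[R]_n) : R :=
  \sum_i peval (mderiv i p) x ^+ 2.

Section gradient.
Context {R : realType} {n : nat}.
Implicit Types (f : mpoly n R) (x c : 'rV[R]_n).

Lemma gradsq_ge0 f x : 0 <= gradsq f x.
Proof. by apply: sumr_ge0 => i _; exact: sqr_ge0. Qed.

Lemma deriv_sq_le_gradsq f x i : peval (mderiv i f) x ^+ 2 <= gradsq f x.
Proof.
rewrite /gradsq (bigD1 i) //= lerDl; apply: sumr_ge0 => j _; exact: sqr_ge0.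
Qed.

Lemma polyf_gradsq f : polyf (gradsq f).
Proof. by apply: polyf_sum => i; apply: polyfX; exact: polyf_peval. Qed.

Lemma dfn_box c (r : R) : dfn (fun x => `|x - c| <= r).
Proof.
have [r0|r0] := leP 0 r; last first.
  apply: (dfn_iff _ (dfn_not (dfn_true n))) => x.
  by split=> [//|xr]; have := le_trans (normr_ge0 _) xr; rewrite leNgt r0.
apply: (@dfn_iff _ _ (fun x => forall i, x 0 i - c 0 i <= r /\ - r <= x 0 i - c 0 i)) => [x|].
  split=> [H|H i].
    apply: rvnorm_le => // i; have [h1 h2] := H i; by rewrite !mxE ler_norml h1 h2.
  by have := le_trans (rvnorm_coord (x - c) i) H; rewrite !mxE ler_norml => /andP[].
apply: dfn_allT => i; apply: dfn_and; apply: dfn_le; try exact: polyf_cst;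
  by apply: polyfB; [exact: polyf_coord|exact: polyf_cst].
Qed.

Lemma closed_le_polyf (g h : 'rV[R]_n -> R) : polyf g -> polyf h -> closed [set x | g x <= h x].
Proof.
move=> gp hp; rewrite (_ : mkset _ = (fun x => g x - h x) @^-1` [set t | t <= 0]); last first.
  by apply/seteqP; split=> x /=; rewrite subr_le0.
apply: closed_comp; last exact: closed_le.
by move=> x _; apply: polyf_continuous; apply: polyfB.
Qed.

(** If [|y - x| > f x], the bound follows from the assumed [|f y - f x| <= f x ^ 2]. Otherwise
    Taylor's formula applies: the gradient is at most a multiple of [f x], and the quadratic
    remainder is absorbed by [|y - x| <= f x]. *)
Lemma fiber_expansion f c (eta : R) : 0 < eta -> exists2 L, 1 <= L &
  forall x y, `|x - c| <= 1 -> `|y - c| <= 1 -> 0 < peval f x ->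
    eta * gradsq f x <= peval f x ^+ 2 ->
    `|peval f y - peval f x| <= peval f x ^+ 2 ->
    `|peval f y - peval f x| <= L * peval f x * `|y - x|.
Proof.
move=> eta0; have [C C0 fC] := peval_taylor f (`|c| + 1).
pose k := Num.sqrt eta^-1; have k0 : 0 < k by rewrite sqrtr_gt0 invr_gt0.
have k2 : k ^+ 2 = eta^-1 by rewrite sqr_sqrtr // invr_ge0 ltW.
exists (1 + n%:R * k + C) => [|x y xc yc s0 Hs].
  by rewrite -addrA lerDl addr_ge0 // ?mulr_ge0 // ltW.
have bd z : `|z - c| <= 1 -> `|z| <= `|c| + 1.
  by move=> zc; rewrite -[z](subrK c) addrC (le_trans (ler_normD _ _)) // lerD2l.
set s := peval f x in s0 Hs *; move=> ds.
have s0' := ltW s0.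
have [Ds|Ds] := leP `|y - x| s; last first.
  apply: le_trans ds _; rewrite expr2 [X in _ <= X * _]mulrC -mulrA ler_pM2l //.
  apply: le_trans (ltW Ds) _; rewrite ler_peMl //.
  by rewrite -addrA lerDl addr_ge0 // ?mulr_ge0 // ltW.
have dk i : `|peval (mderiv i f) x| <= k * s.
  rewrite -(@ler_pXn2r _ 2) ?nnegrE ?mulr_ge0 // ?(ltW k0) //.
  rewrite real_normK ?num_real // exprMn k2 mulrC ler_pdivlMr // mulrC.
  by apply: le_trans Hs; rewrite ler_pM2l // deriv_sq_le_gradsq.
have lin : `|\sum_i peval (mderiv i f) x * (y 0 i - x 0 i)| <= n%:R * k * s * `|y - x|.
  apply: le_trans (ler_norm_sum _ _ _) _.
  have -> : n%:R * k * s * `|y - x| = \sum_(i < n) (k * s * `|y - x|).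
    by rewrite sumr_const card_ord -!mulrA mulr_natl.
  apply: ler_sum => i _; rewrite normrM ler_pM //.
  by have := rvnorm_coord (y - x) i; rewrite !mxE.
have := fC _ _ (bd _ xc) (bd _ yc); rewrite -/s => T.
rewrite -[X in `|X|](subrK (\sum_i peval (mderiv i f) x * (y 0 i - x 0 i))).
apply: le_trans (ler_normD _ _) _.
apply: le_trans (lerD T lin) _.
have : C * `|y - x| ^+ 2 <= C * s * `|y - x|.
  by rewrite expr2 mulrA ler_wpM2r // ler_pM2l.
have : 0 <= s * `|y - x| by rewrite mulr_ge0.
by rewrite mulrDl mulrDl mulrDl mulrDl mul1r; lra.
Qed.

(** Suppose that violating points accumulate at [c]. They form a definable set, so a selection [X s]
    with [f (X s) = s] exists for all small [s]. By [fiber_expansion],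
    [r <= L * s * |X s - X (s - r)|], and one signed coordinate realizes this on a whole region.
    That coordinate would grow like a logarithm although it is bounded. *)
Theorem grad_dominates f c (eta : R) : 0 < eta -> (forall x, 0 <= peval f x) ->
  peval f c = 0 -> exists2 rho, 0 < rho &
    forall x, `|x - c| <= rho -> peval f x ^+ 2 <= eta * gradsq f x.
Proof.
move=> eta0 f_ge0 fc; apply: contrapT => nH.
have viol rho : 0 < rho -> exists x, `|x - c| <= rho /\ eta * gradsq f x < peval f x ^+ 2.
  move=> rho0; apply: contrapT => nx; apply: nH; exists rho => // x xc.
  by rewrite leNgt; apply/negP => h; apply: nx; exists x.
(* The violation is relaxed to a non-strict inequality to make [B] compact; the strict one in [viol]
   still gives [f x > 0]. *)
pose B x := `|x - c| <= 1 /\ eta * gradsq f x <= peval f x ^+ 2.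
have fp := polyf_peval f.
have Hp1 : polyf (fun x => eta * gradsq f x) by apply: polyfM; [exact: polyf_cst|exact: polyf_gradsq].
have Hp2 : polyf (fun x => peval f x ^+ 2) by apply: polyfX.
have dB : dfn B by apply: dfn_and; [exact: dfn_box|exact: dfn_le].
have cB : compact [set x | B x].
  rewrite (_ : mkset _ = [set x | `|x - c| <= 1] `&` [set x | eta * gradsq f x <= peval f x ^+ 2]); last by [].
  by apply: compact_closedI; [exact: closed_box_compact|exact: closed_le_polyf].
have [B' [dB' B'B BB' B'u]] := dfn_selection fp dB cB.
have vcoord (k : 'I_2) : polyf (fun v : 'rV[R]_2 => v 0 k) by exact: polyf_coord.
have dfn_sel2 (Q : 'rV[R]_(2 + (n + n)) -> Prop) : dfn Q -> dfn (fun v : 'rV[R]_2 =>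
    exists y : 'rV[R]_(n + n), Q (row_mx v y)) by exact: dfn_ex.
have [N [s0 [s00 Hs]]] : exists (N : nat) (s0 : R), 0 < s0 /\
    forall s r, 0 < s < s0 -> 0 < r < s ^+ N -> exists x, B' x /\ peval f x = s.
  pose P (v : 'rV[R]_2) := exists x : 'rV[R]_n, B' (rsubmx (row_mx v x)) /\
    peval f (rsubmx (row_mx v x)) = lsubmx (row_mx v x) 0 0.
  have dP : dfn P.
    apply: (@dfn_ex _ 2 n (fun z => B' (rsubmx z) /\ peval f (rsubmx z) = lsubmx z 0 0)).
    apply: dfn_and; first exact: dfn_rsubmx.
    by apply: dfn_eq; [exact: polyf_rsubmx|exact: (@polyf_lsubmx _ _ _ (fun v => v 0 0))].
  have PE s r : P (vec2 s r) <-> exists x, B' x /\ peval f x = s.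
    by split=> -[x H]; exists x; move: H; rewrite row_mxKr row_mxKl mxE.
  have [N [s0 [s00 [HT|HF]]]] := dfn_region dP; exists N, s0; split=> // s r ss rr.
    by apply/(PE s r); exact: HT.
  (* Violating points close to [c] have arbitrarily small positive values, so failure on a whole
     region is impossible. The predicate concerns [s] alone; [s ^+ N / 2] merely supplies an
     admissible [r]. *)
  exfalso; have fcont : peval f x @[x --> c] --> (0 : R).
    by rewrite -fc; exact: peval_continuous.
  have /nbhs_ballP[e /= e0 He] : \forall x \near c, peval f x < s0.
    by apply: (cvgr_lt _ fcont).
  have vmin : 0 < Num.min 1 (e / 2) by rewrite lt_min ltr01 divr_gt0.
  have [x [xe xv]] := viol (Num.min 1 (e / 2)) vmin.
  have fx0 : 0 < peval f x.
    rewrite lt_neqAle f_ge0 andbT eq_sym; apply: contraTneq xv => ->.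
    by rewrite expr0n /= -leNgt mulr_ge0 ?gradsq_ge0 // ltW.
  have fxs : peval f x < s0.
    apply: He; rewrite mx_norm_ball /ball_ /= distrC; apply: le_lt_trans xe _.
    by rewrite gt_min; apply/orP; right; lra.
  apply: (HF (peval f x) (peval f x ^+ N / 2)); rewrite ?fx0 ?fxs ?divr_gt0 ?exprn_gt0 //=.
    by rewrite ltr_pdivrMr // ltr_pMr ?exprn_gt0 // ltr1n.
  apply/PE; have [|x' [B'x' fx']] := BB' x; last by exists x'.
  by split; [apply: le_trans xe _; rewrite ge_min lexx|exact: ltW].
have [L L1 HL] := fiber_expansion f c eta0; have L0 : 0 < L by apply: lt_le_trans L1.
pose sg (b : bool) : R := (-1) ^+ b.
(* [ib] is a coordinate with a sign: its increment between the levels [s - r] and [s] is at least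
   [r / (L * s)]. *)
pose P (ib : 'I_n * bool) (v : 'rV[R]_2) := exists z : 'rV[R]_(n + n),
  [/\ B' (lsubmx z), B' (rsubmx z), peval f (lsubmx z) = v 0 0,
      peval f (rsubmx z) = v 0 0 - v 0 1 &
      v 0 1 <= L * v 0 0 * (sg ib.2 * (lsubmx z 0 ib.1 - rsubmx z 0 ib.1))].
have dP ib : dfn (P ib).
  pose vv (w : 'rV[R]_(2 + (n + n))) := lsubmx w; pose zz (w : 'rV[R]_(2 + (n + n))) := rsubmx w.
  pose Q w := B' (lsubmx (zz w)) /\ B' (rsubmx (zz w)) /\ peval f (lsubmx (zz w)) = vv w 0 0 /\
      peval f (rsubmx (zz w)) = vv w 0 0 - vv w 0 1 /\
      vv w 0 1 <= L * vv w 0 0 * (sg ib.2 * (lsubmx (zz w) 0 ib.1 - rsubmx (zz w) 0 ib.1)).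
  apply: (@dfn_iff _ _ (fun v => exists z : 'rV[R]_(n + n), Q (row_mx v z))) => [v|].
    split=> -[z H]; exists z; move: H; rewrite /Q /vv /zz row_mxKl row_mxKr.
      by move=> [? [? [? []]]].
    by move=> [].
  have pv j : polyf (fun w => vv w 0 j) by apply: (polyf_lsubmx _ (vcoord j)).
  have pl (g : 'rV[R]_n -> R) : polyf g -> polyf (fun w => g (lsubmx (zz w))).
    by move=> gp; apply: (polyf_rsubmx 2 (polyf_lsubmx n gp)).
  have pr (g : 'rV[R]_n -> R) : polyf g -> polyf (fun w => g (rsubmx (zz w))).
    by move=> gp; apply: (polyf_rsubmx 2 (polyf_rsubmx n gp)).
  apply: dfn_ex; do ! apply: dfn_and.
  - exact: (dfn_rsubmx 2 (dfn_lsubmx n dB')).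
  - exact: (dfn_rsubmx 2 (dfn_rsubmx n dB')).
  - by apply: dfn_eq; [exact: pl|exact: pv].
  - by apply: dfn_eq; [exact: pr|apply: polyfB; exact: pv].
  - apply: dfn_le; first exact: pv.
    apply: polyfM; first by apply: polyfM; [exact: polyf_cst|exact: pv].
    apply: polyfM; first exact: polyf_cst.
    apply: polyfB; first by apply: (pl (fun x => x 0 ib.1)); exact: polyf_coord.
    by apply: (pr (fun x => x 0 ib.1)); exact: polyf_coord.
(* The exponent [N.+2] gives both [r < s] and [r <= s ^ 2], the latter being the increment that
   [fiber_expansion] allows. *)
have sel s r : 0 < s < Num.min 1 s0 -> 0 < r < s ^+ N.+2 ->
    exists2 ib, ib \in enum {: 'I_n * bool} & P ib (vec2 s r).
  rewrite lt_min => /and3P[sp s1 ss0] /andP[rp rs].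
  have s1' : s <= 1 by rewrite ltW.
  have rle M : (M <= N.+2)%N -> r < s ^+ M.
    by move=> MN; apply: lt_le_trans rs _; apply: ler_wiXn2l; rewrite ?(ltW sp).
  have rs1 : r < s by rewrite -[s]expr1; apply: rle.
  have rs2 : r <= s ^+ 2 by apply/ltW/rle.
  have [||x [B'x fx]] := Hs s (s ^+ N / 2).
  - by rewrite sp.
  - by rewrite divr_gt0 ?exprn_gt0 //= ltr_pdivrMr // ltr_pMr ?exprn_gt0 // ltr1n.
  have sr : 0 < s - r < s0 by rewrite subr_gt0 rs1 /=; lra.
  have [||y [B'y fy]] := Hs (s - r) ((s - r) ^+ N / 2).
  - by [].
  - case/andP: sr => sr _.
    by rewrite divr_gt0 ?exprn_gt0 //= ltr_pdivrMr // ltr_pMr ?exprn_gt0 // ltr1n.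
  have [xc xH] := B'B _ B'x; have [yc _] := B'B _ B'y.
  have := HL x y xc yc; rewrite fx fy => /(_ sp); rewrite -fx => /(_ xH); rewrite fx.
  have -> : s - r - s = - r by ring.
  rewrite normrN gtr0_norm // => /(_ rs2) rL.
  have Ls : 0 < L * s by rewrite mulr_gt0.
  have [i iP] : exists i, r <= L * s * `|y 0 i - x 0 i|.
    apply: contrapT => ni; suff : `|y - x| < r / (L * s).
      by rewrite ltNge ler_pdivrMr // mulrC rL.
    apply: rvnorm_lt => [|i]; first by rewrite divr_gt0.
    rewrite !mxE ltr_pdivlMr // mulrC ltNge; apply/negP => h; apply: ni; by exists i.
  exists (i, x 0 i - y 0 i < 0); first by rewrite mem_enum.
  exists (row_mx x y); rewrite /= row_mxKl row_mxKr !mxE /=; split=> //.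
  by rewrite -normrEsign distrC.
have m0 : 0 < Num.min 1 s0 by rewrite lt_min ltr01.
have [[i b] [N' [s1 [s10 H]]]] := dfn_region_fin dP m0 sel.
have /choice[X HX] : forall s, exists x, 0 < s < s0 -> B' x /\ peval f x = s.
  move=> s; have [ss|ns] := pselect (0 < s < s0); last by exists c.
  have [//||x xP] := Hs s (s ^+ N / 2); last by exists x.
  by case/andP: ss => sp _; rewrite divr_gt0 ?exprn_gt0 //= ltr_pdivrMr // ltr_pMr ?exprn_gt0 // ltr1n.
apply: (@small_steps_unbounded _ (fun s => sg b * X s 0 i) L (`|c| + 1) (Num.min s0 s1) N' L0).
- by rewrite lt_min s00.
- move=> s; rewrite lt_min => /and3P[sp ss0 ss1].
  have [] := HX s; first by rewrite sp.
  move=> /B'B[xc _] _; rewrite /sg normrMsign; apply: le_trans (rvnorm_coord _ _) _.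
  by rewrite -[X s](subrK c) addrC (le_trans (ler_normD _ _)) // lerD2l.
move=> s r; rewrite lt_min => /and3P[sp ss0 ss1] rr sr0.
have sp' : 0 < s < s1 by rewrite sp.
have [z [B'l B'r fl fr]] := H s r sp' rr.
rewrite !mxE /= in fl fr * => h.
have [|B'X fX] := HX s; first by rewrite sp.
have [|B'X' fX'] := HX (s - r).
  by rewrite sr0; case/andP: rr => r0 _; lra.
rewrite (B'u _ _ B'X B'l) ?fX ?fl // (B'u _ _ B'X' B'r) ?fX' ?fr //.
by rewrite -mulrBr !mxE.
Qed.
End gradient.

Section small.
Context {R : realType}.

Lemma le_perturb (A D C t0 : R) : 0 < t0 ->
  (forall t, 0 < t < t0 -> A <= D + C * t) -> A <= D.
Proof.
move=> t00 H; apply/ler_addgt0Pl => e e0.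
pose t := Num.min (t0 / 2) (e / (1 + `|C|)).
have C1 : 0 < 1 + `|C| by rewrite ltr_wpDr.
have t0' : 0 < t by rewrite lt_min !divr_gt0.
have := H t; rewrite t0' /= => /(_ _)/le_trans; apply.
  by rewrite gt_min; apply/orP; left; lra.
rewrite addrC lerD2r; apply: le_trans (ler_norm _) _; rewrite normrM (gtr0_norm t0').
apply: (@le_trans _ _ ((1 + `|C|) * t)); first by rewrite ler_pM2r // lerDr.
by rewrite mulrC -ler_pdivlMr // ge_min lexx orbT.
Qed.

(** Bernoulli's inequality in homogeneous form. *)
Lemma expr_sub_ge (a b : R) m : 0 <= b -> b <= a -> a ^+ m - m%:R * b * a ^+ m.-1 <= (a - b) ^+ m.
Proof.
move=> b0 ba; have a0 : 0 <= a by apply: le_trans ba.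
case: m => [|m]; first by rewrite !expr0 !mul0r subr0.
elim: m => [|m IH]; first by rewrite !expr1 /= expr0 mul1r mulr1.
rewrite [leRHS]exprS; apply: (@le_trans _ _ ((a - b) * (a ^+ m.+1 - m.+1%:R * b * a ^+ m))).
  have : 0 <= m.+1%:R * b ^+ 2 * a ^+ m by rewrite !mulr_ge0 ?exprn_ge0 ?sqr_ge0.
  by rewrite /= -[m.+2%:R]natr1 !exprS; nra.
by rewrite ler_wpM2l // subr_ge0.
Qed.

End small.

Section coordstep.
Context {R : realType} {n : nat}.
Implicit Types (f : mpoly n R) (x : 'rV[R]_n).

Definition cstep x (i : 'I_n) (t : R) : 'rV[R]_n := x + t *: delta_mx 0 i.

Lemma cstepE x i t j : cstep x i t 0 j = x 0 j + t * (j == i)%:R.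
Proof. by rewrite !mxE eqxx. Qed.

Lemma cstep_norm x i t : `|cstep x i t - x| <= `|t|.
Proof.
apply: rvnorm_le => // j; rewrite mxE cstepE mxE addrAC subrr add0r normrM.
by case: eqP => _; rewrite ?normr1 ?mulr1 // normr0 mulr0.
Qed.

Lemma taylor_cstep f (M : R) : exists2 C, 0 < C & forall x i t, `|x| <= M -> `|cstep x i t| <= M ->
  `|peval f (cstep x i t) - peval f x - t * peval (mderiv i f) x| <= C * t ^+ 2.
Proof.
have [C C0 fC] := peval_taylor f M; exists C => // x i t xM yM.
have := fC _ _ xM yM; rewrite (bigD1 i) //= big1 => [|j ji]; last first.
  by rewrite cstepE (negPf ji) mulr0 addr0 subrr mulr0.
have -> : cstep x i t 0 i - x 0 i = t by rewrite cstepE eqxx mulr1 addrAC subrr add0r.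
rewrite addr0 [_ * t]mulrC => /le_trans; apply.
rewrite ler_pM2l // -[t ^+ 2]real_normK ?num_real //.
by apply: lerXn2r; rewrite ?nnegrE ?cstep_norm.
Qed.

Lemma box_max_deriv0 f c (k : R) y i : `|y - c| <= k ->
  (forall x, `|x - c| <= k -> peval f x <= peval f y) -> `|y 0 i - c 0 i| < k ->
  peval (mderiv i f) y = 0.
Proof.
move=> yc ymax yi.
have [C C0 fC] := taylor_cstep f (`|c| + k).
have k0 : 0 <= k by apply: le_trans yc.
have cK x : `|x - c| <= k -> `|x| <= `|c| + k.
  by move=> xc; rewrite -[x](subrK c) addrC (le_trans (ler_normD _ _)) // lerD2l.
pose d := k - `|y 0 i - c 0 i|; have d0 : 0 < d by rewrite subr_gt0.
have inK t : `|t| < d -> `|cstep y i t - c| <= k.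
  move=> td; apply: rvnorm_le => // j; rewrite mxE cstepE mxE; case: eqP => [->|_].
    rewrite mulr1 addrAC (le_trans (ler_normD _ _)) //; rewrite /d in td; lra.
  by rewrite mulr0 addr0; have := le_trans (rvnorm_coord (y - c) j) yc; rewrite !mxE.
have key (sg : R) : `|sg| = 1 -> sg * peval (mderiv i f) y <= 0.
  move=> sg1; apply: (le_perturb (C := C) d0) => t /andP[t0 td].
  have st : `|sg * t| = t by rewrite normrM sg1 mul1r gtr0_norm.
  have K : `|cstep y i (sg * t) - c| <= k by apply: inK; rewrite st.
  have := fC y i (sg * t) (cK _ yc) (cK _ K); have := ymax _ K.
  have sg2 : sg ^+ 2 = 1 by rewrite -[sg ^+ 2]real_normK ?num_real // sg1 expr1n.
  rewrite exprMn sg2 mul1r ler_norml => h /andP[+ _] => h2.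
  have {h h2} : t * (sg * peval (mderiv i f) y) <= t * (C * t) by move: h h2; rewrite expr2; lra.
  by rewrite ler_pM2l // add0r.
apply/eqP; rewrite eq_le; have := key 1; rewrite normr1 mul1r => -> //.
by have := key (-1); rewrite normrN1 mulN1r oppr_le0 => ->.
Qed.

End coordstep.

(** * From Legendre transforms to the distance to the zero set *)

Section descent.
Context {R : realType} {n : nat}.
Implicit Types (f : mpoly n R) (x c : 'rV[R]_n).

(** Compactness of the box, with [t] tending to 0. Around a point of nonzero gradient, [gradsq f]
    stays above some [t]; around a point of zero gradient, the hypothesis forces [f = 0] and
    [grad_dominates] applies. *)
Lemma grad_dominates_unif f c (k eta : R) : 0 < eta -> (forall x, 0 <= peval f x) ->
  (forall x, `|x - c| <= k -> peval f x ^+ 2 <= gradsq f x) ->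
  exists2 t, 0 < t & forall x, `|x - c| <= k -> gradsq f x < t -> peval f x ^+ 2 <= eta * gradsq f x.
Proof.
move=> eta0 f0 fH.
have := (@closed_box_compact R n c k); rewrite compact_near_coveringP => /(_ R (0^'+)
  (fun t x => `|x - c| <= k -> gradsq f x < t -> peval f x ^+ 2 <= eta * gradsq f x) _).
case.
  move=> q /= qk; have [Hq|Hq] := ltP 0 (gradsq f q).
    have : \forall x \near q, gradsq f q / 2 < gradsq f x.
      have Hc : gradsq f x @[x --> q] --> gradsq f q by apply: polyf_continuous; exact: polyf_gradsq.
      by apply: (cvgr_gt _ Hc); rewrite ltr_pdivrMr // ltr_pMr // ltr1n.
    move=> /nbhs_ballP[e /= e0 He].
    exists (ball q e, [set t | 0 < t < gradsq f q / 2]).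
      split=> /=; first exact: nbhsx_ballx.
      exists (gradsq f q / 2) => /=; first by rewrite divr_gt0.
      by move=> t /=; rewrite sub0r normrN => /ltr_normlW ? ->.
    move=> [x t] /= [/He xq /andP[_ tq]] _ xt; exfalso.
    by have := lt_trans xt tq; rewrite ltNge (ltW xq).
  have fq : peval f q = 0.
    apply/eqP; rewrite -sqrf_eq0 eq_le sqr_ge0 andbT; exact: le_trans (fH _ qk) Hq.
  have [rho rho0 Hr] := grad_dominates eta0 f0 fq.
  exists (ball q rho, setT); first by split; [exact: nbhsx_ballx|exact: filterT].
  by move=> [x t] /= [qx _] _ _; apply: Hr; move: qx; rewrite mx_norm_ball /ball_ /= distrC => /ltW.
move=> e /= e0 He; exists (e / 2); first by rewrite divr_gt0.
move=> x xk; apply: He => //=; last by rewrite divr_gt0.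
by rewrite sub0r normrN gtr0_norm ?divr_gt0 //; lra.
Qed.

(* The substitution [tau = rho * a] turns the bound on the Legendre transform into a
   gradient inequality; [a] plays the role of [f ^ (1 / (q + 2))]. *)
Lemma valley_gradient f (E : 'rV[R]_n -> R) c (k C C2 t0 : R) (q : nat) :
  0 < C -> 0 < C2 -> 0 < t0 -> (forall x, `|x - c| <= k -> E x <= C2 * gradsq f x) ->
  (forall t x, 0 < t < t0 -> `|x - c| <= k -> t ^+ q * peval f x - E x <= C * t ^+ (q + q + 2)) ->
  exists2 c', 0 < c' & forall x a, `|x - c| <= k -> 0 <= a -> a ^+ (q + 2) = peval f x ->
    c' * a ^+ (q + 1) ^+ 2 <= gradsq f x.
Proof.
move=> C0 C20 t00 EH V.
have qe : (q + (q + 2) = (q + 1) * 2)%N by clear; lia.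
have [F F0 fF] := peval_bounded f (`|c| + `|k|).
(* [rho * a] must stay below [t0], where [a <= 1 + F], and [C * rho <= 1 / 2] preserves half of the
   main term [rho ^ q * a ^ (2 * q + 2)]. *)
pose rho := Num.min 1 (Num.min (t0 / (2 * (1 + F))) (1 / (2 * C))).
have F1 : 0 < 1 + F by rewrite addr_gt0.
have r0 : 0 < rho by rewrite !lt_min ltr01 !divr_gt0 ?mulr_gt0.
have r1 : rho <= 1 by rewrite ge_min lexx.
have rt : rho <= t0 / (2 * (1 + F)) by rewrite !ge_min lexx !orbT.
have rC : rho <= 1 / (2 * C) by rewrite !ge_min lexx !orbT.
exists (rho ^+ q / 2 / C2); first by rewrite !divr_gt0 ?exprn_gt0.
move=> x a xk; rewrite le_eqVlt => /predU1P[<-|a0] ax.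
  by rewrite addn1 expr0n /= expr0n /= mulr0 gradsq_ge0.
have aF : a <= 1 + F.
  have [a1|a1] := leP a 1; first by apply: le_trans a1 _; rewrite lerDl ltW.
  apply: (@le_trans _ _ (a ^+ (q + 2))); first by rewrite -[leLHS]expr1 ler_eXn2l // addn2.
  rewrite ax; apply: le_trans (ler_norm _) _; apply: le_trans (fF _ _) _; last by rewrite lerDr.
  by rewrite -[x](subrK c) addrC (le_trans (ler_normD _ _)) // lerD2l (le_trans xk) ?ler_norm.
have ra : 0 < rho * a < t0.
  rewrite mulr_gt0 //=; apply: (@le_lt_trans _ _ (t0 / (2 * (1 + F)) * (1 + F))).
    by rewrite ler_pM // ltW.
  by rewrite invfM mulrA divfK ?gt_eqF //; lra.
have := V _ x ra xk; rewrite -ax => h.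
have E2 := EH x xk.
have P0 : 0 < rho ^+ q by rewrite exprn_gt0.
have A0 : 0 < a ^+ (q + 1) ^+ 2 by rewrite !exprn_gt0.
set A := a ^+ (q + 1) ^+ 2 in A0 *; rewrite -(ler_pM2l C20).
have -> : C2 * (rho ^+ q / 2 / C2 * A) = rho ^+ q / 2 * A by rewrite mulrA [C2 * _]mulrC divfK ?gt_eqF.
apply: le_trans E2.
have AE : A = a ^+ (q + (q + 2)) by rewrite /A -exprM -qe.
have e1 : (rho * a) ^+ q * a ^+ (q + 2) = rho ^+ q * A by rewrite AE exprMn -mulrA -exprD.
have e2 : (rho * a) ^+ (q + q + 2) = rho ^+ q * (rho ^+ q * rho * rho * A).
  by rewrite AE exprMn -addnA !(exprD rho) expr2 !mulrA.
rewrite e1 e2 in h.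
have : C * (rho ^+ q * rho * rho) <= 1 / 2.
  apply: (@le_trans _ _ (C * rho)); last by rewrite mulrC -ler_pdivlMr // (le_trans rC) // invfM mulrA.
  rewrite ler_pM2l // -[leRHS]mul1r ler_wpM2r ?(ltW r0) //.
  by rewrite mulr_ile1 ?exprn_ile1 ?(ltW r0) // exprn_ge0 // ltW.
move=> h2; have : rho ^+ q * A * (C * (rho ^+ q * rho * rho)) <= rho ^+ q * A * (1 / 2).
  by rewrite ler_pM2l // mulr_gt0.
by move: h; lra.
Qed.

(* Ekeland's principle for [f ^ (1 / m)] on a ball free of zeros of [f]. *)
Lemma ekeland_bound f c (k c' : R) (m : nat) : (0 < m)%N -> 0 < c' -> (forall x, 0 <= peval f x) ->
  (forall x a, `|x - c| <= k -> 0 <= a -> a ^+ m = peval f x ->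
    c' * a ^+ m.-1 ^+ 2 <= gradsq f x) ->
  exists2 C, 0 < C & forall x rho, 0 < rho ->
    (forall y, `|y - x| <= rho -> `|y - c| <= k /\ peval f y != 0) -> rho ^+ m <= C * peval f x.
Proof.
move=> m0 c'0 f0 H.
have [C C0 fC] := taylor_cstep f (`|c| + k).
have cK x : `|x - c| <= k -> `|x| <= `|c| + k.
  by move=> xc; rewrite -[x](subrK c) addrC (le_trans (ler_normD _ _)) // lerD2l.
pose D := 1 + n%:R * m%:R ^+ 2 / c'.
have D1 : 1 <= D by rewrite lerDl divr_ge0 ?mulr_ge0 ?exprn_ge0 // ltW.
have D0 : 0 < D by apply: lt_le_trans D1.
exists (D ^+ m) => [|x0 rho rho0 BK]; first by rewrite exprn_gt0.
have x0x0 : `|x0 - x0| <= rho by rewrite subrr normr0 ltW.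
pose a x := peval f x `^ m%:R^-1.
have am x : a x ^+ m = peval f x.
  by rewrite -powR_mulrn ?powR_ge0 // -powRrM mulVf ?pnatr_eq0 -?lt0n // powRr1.
have a_ge0 x : 0 <= a x by exact: powR_ge0.
have a_gt0 x : `|x - x0| <= rho -> 0 < a x.
  move=> /BK[_ fx]; rewrite powR_gt0 // lt_neqAle f0 eq_sym fx //.
(* With this slope, comparing the minimizer [x1] with [x0] and using [a x1 > 0] puts [x1] in the
   open ball. *)
pose kk := a x0 / rho; have kk0 : 0 < kk by rewrite divr_gt0 // a_gt0.
have [||x1] := @compact_EVT_min _ R (fun x => a x + kk * `|x - x0|) _ _ (@closed_box_compact R n x0 rho).
- by exists x0.
- apply: continuous_in_subspaceT => x; rewrite inE /= => xr.
  apply: (@continuousD _ _ _ a (fun x => kk * `|x - x0|)).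
    apply: (@continuous_comp _ _ _ (peval f) (fun t : R => t `^ m%:R^-1)); first exact: peval_continuous.
    apply: differentiable_continuous; apply/derivable1_diffP; apply: derivable_powR.
    by rewrite in_itv /= andbT lt_neqAle f0 eq_sym; have [_ ->] := BK _ xr.
  apply: (@continuousM _ _ (fun=> kk) (fun x => `|x - x0|)); first exact: cst_continuous.
  apply: continuous_comp; last exact: norm_continuous.
  by apply: (@continuousB _ _ _ id (fun=> x0)) => //; exact: cst_continuous.
rewrite inE /= => x1r min.
have {}min x : `|x - x0| <= rho -> a x1 + kk * `|x1 - x0| <= a x + kk * `|x - x0|.
  by move=> xr; apply: min; rewrite inE.
have a1 := a_gt0 _ x1r.
have x1in : `|x1 - x0| < rho.
  have := min x0 x0x0; rewrite subrr normr0 mulr0 addr0 => h.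
  rewrite -(ltr_pM2l kk0) /kk divfK ?gt_eqF // -/kk; lra.
have [x1k _] := BK _ x1r.
(* Minimality keeps [a] above the cone [a x1 - kk * t]. Raising this to the power [m] bounds the
   slope of [f], so the root itself is never differentiated. *)
have dle i (sg : R) : `|sg| = 1 -> - (m%:R * kk * a x1 ^+ m.-1) <= sg * peval (mderiv i f) x1.
  move=> sg1; pose t0 := Num.min (rho - `|x1 - x0|) (a x1 / kk).
  have t00 : 0 < t0 by rewrite lt_min subr_gt0 x1in divr_gt0.
  apply: (le_perturb (C := C) t00) => t; rewrite lt_min => /and3P[tp tr ta].
  have st : `|sg * t| = t by rewrite normrM sg1 mul1r gtr0_norm.
  pose x2 := cstep x1 i (sg * t).
  have x21 : `|x2 - x1| <= t by rewrite -[leRHS]st cstep_norm.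
  have x20 : `|x2 - x0| <= `|x1 - x0| + t.
    by rewrite -[x2](subrK x1) -addrA addrC (le_trans (ler_normD _ _)) // lerD2l.
  have x2r : `|x2 - x0| <= rho by apply: le_trans x20 _; lra.
  have [x2k _] := BK _ x2r.
  have a2 : a x1 - kk * t <= a x2.
    have := min x2 x2r; have : kk * `|x2 - x0| <= kk * (`|x1 - x0| + t) by rewrite ler_pM2l.
    lra.
  have kt : kk * t <= a x1 by rewrite mulrC -ler_pdivlMr // ltW.
  have fge : a x1 ^+ m - m%:R * (kk * t) * a x1 ^+ m.-1 <= peval f x2.
    rewrite -am; apply: le_trans (expr_sub_ge _ _ kt) _; first by rewrite mulr_ge0 // ltW.
    by apply: lerXn2r; rewrite ?nnegrE // subr_ge0.
  have := fC x1 i (sg * t) (cK _ x1k) (cK _ x2k); rewrite -/x2.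
  have sg2 : sg ^+ 2 = 1 by rewrite -[sg ^+ 2]real_normK ?num_real // sg1 expr1n.
  rewrite exprMn sg2 mul1r ler_norml => /andP[_ h].
  rewrite -(ler_pM2l tp); move: h fge; rewrite am expr2; lra.
have Hle : gradsq f x1 <= n%:R * (m%:R * kk * a x1 ^+ m.-1) ^+ 2.
  have -> : n%:R * (m%:R * kk * a x1 ^+ m.-1) ^+ 2 = \sum_(i < n) (m%:R * kk * a x1 ^+ m.-1) ^+ 2.
    by rewrite sumr_const card_ord mulr_natl.
  apply: ler_sum => i _.
  have p0 : 0 <= m%:R * kk * a x1 ^+ m.-1 
    by apply: mulr_ge0; [apply: mulr_ge0; [exact: ler0n|exact: ltW]|apply: exprn_ge0; exact: a_ge0].
  rewrite -[leLHS]real_normK ?num_real //; apply: lerXn2r; rewrite ?nnegrE //.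
  have h1 := dle i 1 (normr1 _); have h2 := dle i (-1) (normrN1 _).
  by rewrite ler_norml; move: h1 h2; rewrite mul1r mulN1r lerN2 => -> ->.
have := le_trans (H x1 (a x1) x1k (ltW a1) (am _)) Hle.
have A0 : 0 < a x1 ^+ m.-1 ^+ 2 by rewrite !exprn_gt0.
have -> : n%:R * (m%:R * kk * a x1 ^+ m.-1) ^+ 2 = (n%:R * m%:R ^+ 2 * kk ^+ 2) * a x1 ^+ m.-1 ^+ 2 by ring.
(* What remains is [c' <= n * m ^ 2 * kk ^ 2], a lower bound for [a x0 / rho]. *)
rewrite ler_pM2r // => ck.
rewrite -[peval f x0]am -exprMn; apply: lerXn2r; rewrite ?nnegrE ?mulr_ge0 ?(ltW D0) ?(ltW rho0) //.
rewrite -(@ler_pXn2r _ 2) // ?nnegrE ?mulr_ge0 ?(ltW D0) ?(ltW rho0) //.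
apply: (@le_trans _ _ (D * a x0 ^+ 2)).
  move: ck; rewrite /kk exprMn exprVn => ck.
  rewrite /D mulrDl mul1r; apply: ler_wpDl; first by rewrite exprn_ge0.
  rewrite mulrAC ler_pdivlMr // mulrC.
  have r2 : 0 < rho ^+ 2 by rewrite exprn_gt0.
  by rewrite -ler_pdivlMr // -mulrA.
by rewrite exprMn ler_wpM2r ?exprn_ge0 // expr2 ler_peMl // ltW.
Qed.
End descent.

(** * Elimination by counting dimensions *)

Section small_root.
Context {R : realType}.

(* If the values at [0] do not all vanish, compare with the polynomial they form;
   otherwise a power of the variable can be factored out. *)
Lemma small_root_bound (c : nat -> {poly R}) (Q : nat) : (exists2 j, (j <= Q)%N & c j != 0) ->
  exists C s0, [/\ 0 < C, 0 < s0 & forall s w, 0 < s < s0 -> `|w| < s0 ->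
    \sum_(j < Q.+1) (c j).[s] * w ^+ j = 0 -> `|w| ^+ Q <= C * s].
Proof.
(* The total size of the coefficients decreases whenever the variable is factored out of all of
   them. *)
move=> cn0; have [m mP] : exists m, (\sum_(j < Q.+1) size (c j) <= m)%N by eexists.
elim: m c cn0 mP => [|m IH] c [j0 j0Q cj0] mP.
  by exfalso; move: mP; rewrite (bigD1 (Ordinal (j0Q : (j0 < Q.+1)%N))) //= leqn0 addn_eq0 size_poly_eq0 (negPf cj0).
have [all0|/existsNP[j1 /not_implyP[j1Q cj1]]] := pselect (forall j, (j <= Q)%N -> (c j).[0] = 0).
  have cX j : (j <= Q)%N -> c j = (c j %/ 'X)%R * 'X.
    by move=> jQ; rewrite divpK // -['X]subr0 -polyC0 dvdp_XsubCl /root all0.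
  have [||C [s0 [C0 s00 H]]] := IH (fun j => (c j %/ 'X)%R).
  - by exists j0 => //; apply: contraNneq cj0 => h; rewrite cX // h mul0r.
  - rewrite -ltnS; apply: leq_trans mP.
    rewrite (bigD1 (Ordinal (j0Q : (j0 < Q.+1)%N))) //= [X in (_ < X)%N](bigD1 (Ordinal (j0Q : (j0 < Q.+1)%N))) //= -addSn.
    apply: leq_add; last by apply: leq_sum => j _; rewrite size_divp ?polyX_eq0 // leq_subr.
    by rewrite size_divp ?polyX_eq0 // size_polyX subn1 prednK // size_poly_gt0.
  exists C, s0; split=> // s w ss ww; under eq_bigr => j _ do rewrite (cX _ (ltn_ord j)) hornerMX mulrAC.
  rewrite -mulr_suml => /eqP; rewrite mulf_eq0 => /orP[/eqP|/eqP s_0]; first exact: H.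
  by move: ss; rewrite s_0 ltxx.
pose u := \poly_(j < Q.+1) (c j).[0].
have u0 : u != 0.
  by apply/eqP => /(congr1 (fun p : {poly R} => p`_j1)); rewrite coef_poly coef0 ltnS j1Q; exact: cj1.
have [v [k [s0 [vu k0 s00 uL]]]] := poly_lower_near0 u0.
have vQ : (v <= Q)%N by rewrite -ltnS; apply: leq_trans vu (size_poly _ _).
have /choice[M HM] : forall j, exists M, 0 < M /\ forall s, `|s| <= 1 -> `|(c j %/ 'X)%R.[s]| <= M.
  by move=> j; have [M M0 HM] := poly_bounded1 (c j %/ 'X)%R; exists M.
pose S := 1 + \sum_(j < Q.+1) M j.
have S0 : 0 < S by rewrite ltr_wpDr // sumr_ge0 // => j _; rewrite ltW //; case: (HM j).
exists (S / k), (Num.min 1 s0); split; rewrite ?divr_gt0 ?lt_min ?ltr01 //.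
move=> s w /andP[sp]; rewrite !lt_min => /andP[s1 ss] /andP[w1 ws] sum0.
apply: (@le_trans _ _ (`|w| ^+ v)); first by apply: ler_wiXn2l; rewrite // ltW.
rewrite mulrAC ler_pdivlMr // mulrC; apply: le_trans (uL _ ws) _.
have -> : u.[w] = - \sum_(j < Q.+1) ((c j).[s] - (c j).[0]) * w ^+ j.
  rewrite horner_poly; under [X in - X]eq_bigr do rewrite mulrBl.
  by rewrite big_split /= sum0 add0r sumrN opprK.
rewrite normrN; apply: le_trans (ler_norm_sum _ _ _) _.
apply: (@le_trans _ _ (\sum_(j < Q.+1) M j * s)); last first.
  by rewrite -mulr_suml ler_pM2r // /S lerDr.
apply: ler_sum => j _; rewrite normrM normrX.
have [Mj0 HMj] := HM j.
have -> : (c j).[s] - (c j).[0] = (c j %/ 'X)%R.[s] * s.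
  rewrite {1 2}(divp_eq (c j) 'X) !hornerD !hornerM !hornerX mulr0 add0r.
  have : (size (c j %% 'X)%R <= 1)%N by rewrite -ltnS -[X in (_ < X)%N](size_polyX R) ltn_modp polyX_eq0.
  by move=> /size1_polyC ->; rewrite !hornerC addrK.
rewrite normrM (gtr0_norm sp) -[leRHS]mulr1 ler_pM ?exprn_ge0 ?mulr_ge0 ?(ltW sp) //.
  by rewrite ler_pM2r // HMj // gtr0_norm // ltW.
by rewrite exprn_ile1 // ltW.
Qed.

End small_root.

Section kernel.
Context {F : fieldType}.

Lemma exists_kernel (I J : finType) (A : I -> J -> F) : (#|J| < #|I|)%N ->
  exists v : I -> F, (exists i, v i != 0) /\ forall j, \sum_i v i * A i j = 0.
Proof.
move=> JI; pose M := \matrix_(i < #|I|, j < #|J|) A (enum_val i) (enum_val j).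
have : kermx M != 0.
  rewrite -mxrank_eq0 mxrank_ker -lt0n subn_gt0; apply: leq_ltn_trans JI; exact: rank_leq_col.
move=> /matrix0Pn[r [i0 ri]]; exists (fun i => kermx M r (enum_rank i)); split.
  by exists (enum_val i0); rewrite enum_valK.
move=> j; have : (kermx M *m M) r (enum_rank j) = 0 by rewrite mulmx_ker mxE.
rewrite mxE (reindex (@enum_rank I)) /=; last first.
  by exists enum_val => x _; [exact: enum_rankK|exact: enum_valK].
by move=> E; rewrite -[RHS]E; apply: eq_bigr => i _; rewrite [M _ _]mxE !enum_rankK.
Qed.

(* More vectors than coordinates over the polynomial ring: bound degrees and count. *)
Lemma exists_poly_kernel (Q : nat) (J : finType) (c : nat -> J -> {poly F}) : (#|J| <= Q)%N ->
  exists b : nat -> {poly F}, (exists2 j, (j <= Q)%N & b j != 0) /\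
    forall a, \sum_(j < Q.+1) b j * c j a = 0.
Proof.
move=> JQ; pose d := \max_(j < Q.+1) \max_(a : J) size (c j a).
have cd (j : 'I_Q.+1) a : (size (c j a) <= d)%N.
  by apply: leq_trans (leq_bigmax_cond _ _); [apply: (@leq_bigmax_cond _ _ (fun a => size (c j a)))|].
(* There are [(Q + 1) * (T + 1)] unknowns and at most [Q * (T + d)] equations; this [T] leaves a
   margin of [Q + 1]. *)
pose T := (Q * d)%N.
pose A (i : 'I_Q.+1 * 'I_T.+1) (j : J * 'I_(T + d)) : F := ('X^(i.2) * c i.1 j.1)`_j.2.
have [|v [[[j0 t0] v0] vA]] := @exists_kernel _ _ A.
  rewrite !card_prod !card_ord; apply: (@leq_ltn_trans (Q * (T + d))); first by rewrite leq_mul2r JQ orbT.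
  by rewrite /T; nia.
pose b (j : nat) := \sum_(t < T.+1) v (inord j, t) *: 'X^t.
have bE (j : 'I_Q.+1) : b j = \sum_(t < T.+1) v (j, t) *: 'X^t by rewrite /b inord_val.
exists b; split.
  exists j0; first by rewrite -ltnS.
  apply: contraNneq v0 => bj; have := congr1 (fun p : {poly F} => p`_t0) bj.
  rewrite bE coef0 coef_sum (bigD1 t0) //= big1 => [|t tt]; last first.
    by rewrite coefZ coefXn eq_sym (inj_eq val_inj) (negPf tt) mulr0.
  by rewrite addr0 coefZ coefXn eqxx mulr1 => ->.
move=> a; apply/polyP => l; rewrite coef0.
have E : \sum_(j < Q.+1) b j * c j a = \sum_(i : 'I_Q.+1 * 'I_T.+1) v i *: ('X^(i.2) * c i.1 a).
  rewrite [RHS](eq_bigr (fun p => v (p.1, p.2) *: ('X^(p.2) * c p.1 a))); last by case.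
  rewrite -(pair_bigA _ (fun (j : 'I_Q.+1) (t : 'I_T.+1) => v (j, t) *: ('X^t * c j a)) ) /=; apply: eq_bigr => j _.
  by rewrite bE mulr_suml; apply: eq_bigr => t _; rewrite scalerAl.
rewrite E coef_sum; have [lT|lT] := ltnP l (T + d).
  by rewrite -[RHS](vA (a, Ordinal lT)); apply: eq_bigr => i _; rewrite coefZ.
apply: big1 => -[j t] _; rewrite coefZ nth_default ?mulr0 //=.
apply: leq_trans lT; apply: leq_trans (size_polyMleq _ _) _.
by rewrite size_polyXn; have := cd j a; have := ltn_ord t; lia.
Qed.

End kernel.

(** Bounding the support lets 0 satisfy every bound, so that sums and products need no case
    distinction. *)
Definition mdle (R : realType) (n d : nat) (p : mpoly n R) : Prop :=
  forall m, m \in msupp p -> (mdeg m <= d)%N.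

Section degree.
Context {R : realType} {n : nat}.
Implicit Types p q : mpoly n R.

Lemma mdleD d p q : mdle d p -> mdle d q -> mdle d (p + q).
Proof. by move=> pd qd m /msuppD_le; rewrite mem_cat => /orP[/pd|/qd]. Qed.

Lemma mdle0 d : mdle d (0 : mpoly n R).
Proof. by move=> m; rewrite msupp0. Qed.

Lemma mdleZ d c p : mdle d p -> mdle d (c *: p).
Proof. by move=> pd m /msuppZ_le /pd. Qed.

Lemma mdleN d p : mdle d p -> mdle d (- p).
Proof. by rewrite -scaleN1r; exact: mdleZ. Qed.

Lemma mdleB d p q : mdle d p -> mdle d q -> mdle d (p - q).
Proof. by move=> pd qd; apply: mdleD => //; exact: mdleN. Qed.

Lemma mdleM d e p q : mdle d p -> mdle e q -> mdle (d + e) (p * q).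
Proof.
by move=> pd qe m /msuppM_le /allpairsP[[m1 m2] /= [/pd h1 /qe h2 ->]]; rewrite mdegD leq_add.
Qed.

Lemma mdle_sum d (I : Type) (r : seq I) (P : pred I) (F : I -> mpoly n R) :
  (forall i, P i -> mdle d (F i)) -> mdle d (\sum_(i <- r | P i) F i).
Proof. by move=> Fd; elim/big_rec: _ => [|i p Pi pd]; [exact: mdle0|apply: mdleD => //; exact: Fd]. Qed.

Lemma mdleC d c : mdle d (mpolyC n c : mpoly n R).
Proof. by move=> m; rewrite msuppC; case: eqP => //= _; rewrite inE => /eqP ->; rewrite mdeg0. Qed.

Lemma mdle1 d : mdle d (1 : mpoly n R).
Proof. by rewrite -mpolyC1; exact: mdleC. Qed.

Lemma mdleX d p k : mdle d p -> mdle (d * k) (p ^+ k).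
Proof.
by move=> pd; elim: k => [|k IH]; [exact: mdle1|rewrite exprS mulnS; exact: mdleM].
Qed.

Lemma mdle_le d e p : (d <= e)%N -> mdle d p -> mdle e p.
Proof. by move=> de pd m /pd h; apply: leq_trans de. Qed.

Lemma mdle_mon d m : (mdeg m <= d)%N -> mdle d (mpolyX R m : mpoly n R).
Proof. by move=> md m'; rewrite msuppX inE => /eqP ->. Qed.

Lemma mdle_deriv d p i : mdle d p -> mdle d.-1 (mderiv i p).
Proof.
move=> pd m; rewrite mcoeff_msupp mcoeff_deriv => h.
have /pd : mnm_add m (mnm1 i) \in msupp p.
  by rewrite mcoeff_msupp; apply: contraNneq h => ->; rewrite mul0rn.
by rewrite mdegD mdeg1 addn1; case: d {pd}.
Qed.

Lemma mdle_deriv_gt0 d p i : (0 < d)%N -> mdle d p -> forall m, m \in msupp (mderiv i p) -> (mdeg m < d)%N.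
Proof. by move=> d0 pd m /(mdle_deriv pd); rewrite -ltnS prednK. Qed.

End degree.

(** * Elimination when pure powers are leading terms *)

Section normal_form.
Context {R : realType} {n : nat}.
Implicit Types (S : R -> 'rV[R]_n -> Prop) (u : R -> 'rV[R]_n -> R).

Definition monv (x : 'rV[R]_n) (m : multinom n) : R := \prod_(i < n) x 0 i ^+ m i.

(** Only the degree in [x] counts; coefficients are arbitrary polynomials in the parameter [l]. *)
Definition lowdeg (k : nat) u : Prop := exists s : seq ({poly R} * multinom n),
  (forall t, t \in s -> (mdeg t.2 < k)%N) /\
  forall l x, u l x = \sum_(t <- s) t.1.[l] * monv x t.2.

Lemma lowdegD k u v : lowdeg k u -> lowdeg k v -> lowdeg k (fun l x => u l x + v l x).
Proof.
move=> [s [sk us]] [t [tk vt]]; exists (s ++ t); split.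
  by move=> a; rewrite mem_cat => /orP[/sk|/tk].
by move=> l x; rewrite big_cat us vt.
Qed.

Lemma lowdeg_peval k (c : {poly R}) (p : mpoly n R) :
  (forall m, m \in msupp p -> (mdeg m < k)%N) -> lowdeg k (fun l x => c.[l] * peval p x).
Proof.
move=> pk; exists [seq ((mcoeff m p)%:P * c, m) | m <- msupp p]; split.
  by move=> t /mapP[m mp ->]; exact: pk.
move=> l x; rewrite big_map /peval mevalE mulr_sumr; apply: eq_bigr => m _ /=.
by rewrite hornerM hornerC mulrCA mulrA.
Qed.

Lemma lowdeg_cst k (c : {poly R}) : (0 < k)%N -> lowdeg k (fun l _ => c.[l]).
Proof.
move=> k0; exists [:: (c, mnm0)]; split=> [t|l x]; first by rewrite inE => /eqP ->; rewrite mdeg0.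
by rewrite big_seq1 /monv big1 ?mulr1 // => i _; rewrite mnm0E expr0.
Qed.

(** Membership, on [S], in the module spanned over the polynomials in [l] by the [k ^ n] monomials
    with all exponents below [k]. The power [l ^+ e] clears the denominators that come from dividing
    by leading coefficients such as [l ^ 3]. *)
Definition red S k u : Prop := exists (e : nat) (c : {ffun 'I_n -> 'I_k} -> {poly R}),
  forall l x, S l x -> l ^+ e * u l x = \sum_a (c a).[l] * \prod_i x 0 i ^+ a i.

Lemma red0 S k : red S k (fun _ _ => 0).
Proof.
exists 0%N, (fun=> 0) => l x _; rewrite mulr0 big1 // => a _; by rewrite horner0 mul0r.
Qed.

Lemma redD S k u v : red S k u -> red S k v -> red S k (fun l x => u l x + v l x).
Proof.
move=> [e [c uc]] [e' [c' vc]]; exists (e + e')%N, (fun a => c a * 'X^e' + c' a * 'X^e) => l x Sx.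
rewrite mulrDr exprD mulrAC uc // -mulrA vc // mulr_suml mulr_sumr -big_split /=.
by apply: eq_bigr => a _; rewrite hornerD !hornerM !hornerXn; ring.
Qed.

Lemma redZ S k u (p : {poly R}) : red S k u -> red S k (fun l x => p.[l] * u l x).
Proof.
move=> [e [c uc]]; exists e, (fun a => p * c a) => l x Sx.
by rewrite mulrCA uc // mulr_sumr; apply: eq_bigr => a _; rewrite hornerM mulrA.
Qed.

Lemma red_sum S k (I : Type) (r : seq I) (F : I -> R -> 'rV[R]_n -> R) :
  (forall i, red S k (F i)) -> red S k (fun l x => \sum_(i <- r) F i l x).
Proof.
move=> Fr; elim: r => [|i r IH].
  by have -> : (fun l x => \sum_(i <- [::]) F i l x) = fun _ _ => 0;
    [apply/funext => l; apply/funext => x; rewrite big_nil|exact: red0].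
have -> : (fun l x => \sum_(i <- i :: r) F i l x) = fun l x => F i l x + \sum_(i <- r) F i l x.
  by apply/funext => l; apply/funext => x; rewrite big_cons.
exact: redD.
Qed.

Lemma red_div S k u v e : (forall l x, S l x -> l ^+ e * u l x = v l x) -> red S k v -> red S k u.
Proof.
move=> uv [e' [c vc]]; exists (e' + e)%N, c => l x Sx.
by rewrite exprD -mulrA uv // vc.
Qed.

(** Rewriting rules whose leading terms are the pure powers of the variables, up to a power of [l];
    as with a Groebner basis, the monomials below them span all remainders. *)
Definition normal_form S k : Prop := forall i : 'I_n, exists e g, lowdeg k g /\
  forall l x, S l x -> l ^+ e * x 0 i ^+ k = g l x.

(** Strong induction on the total degree: a rule replaces a factor [x_i ^ k] by terms of smaller
    degree, so the rewriting terminates. *)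
Lemma red_mon S k m : (0 < k)%N -> normal_form S k -> red S k (fun _ x => monv x m).
Proof.
move=> k0 SN; have [d] := ubnP (mdeg m); elim: d m => // d IH m /ltnSE md.
have [mk|/existsNP[i /negP]] := pselect (forall i, (m i < k)%N).
  exists 0%N, (fun a : {ffun 'I_n -> 'I_k} => (([forall i, a i == m i :> nat])%:R)%:P) => l x _.
  rewrite mul1r (bigD1 [ffun i => Ordinal (mk i)]) //= [X in _ + X]big1 => [|a am].
    rewrite addr0 (_ : [forall i, _]) ?hornerC ?mul1r; last by apply/forallP => i; rewrite ffunE.
    by apply: eq_bigr => i _; rewrite ffunE.
  rewrite (_ : [forall i, _] = false) ?hornerC ?mul0r //; apply: contraNF am => /forallP am.
  by apply/eqP/ffunP => i; apply: val_inj; rewrite ffunE; apply/eqP; exact: am.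
rewrite -leqNgt => km; have [e [g [[s [sk gs]] Sg]]] := SN i.
pose m' := mnm_sub m (mnm_muln (mnm1 i) k).
have mE : m = mnm_add (mnm_muln (mnm1 i) k) m'.
  apply/mnmP => j; rewrite mnmDE mnmBE mulmnE mnm1E; case: eqP => [<-|_]; rewrite ?mul1n ?mul0n ?subn0 //.
  by rewrite subnKC.
have monvD x a b : monv x (mnm_add a b) = monv x a * monv x b.
  by rewrite /monv -big_split; apply: eq_bigr => j _; rewrite mnmDE exprD.
have monvU x : monv x (mnm_muln (mnm1 i) k) = x 0 i ^+ k.
  rewrite /monv (bigD1 i) //= big1 => [|j ji]; rewrite mulmnE mnm1E.
    by rewrite eqxx mul1n mulr1.
  by rewrite eq_sym (negPf ji) mul0n expr0.
apply: (@red_div _ _ _ (fun l x => \sum_(t <- s) t.1.[l] * monv x (mnm_add t.2 m')) e) => [l x Sx|].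
  rewrite {1}mE monvD monvU mulrA Sg // gs mulr_suml; apply: eq_bigr => t _.
  by rewrite monvD mulrA.
have dm : (mdeg m = k + mdeg m')%N by rewrite {1}mE mdegD mdegMn mdeg1 mul1n.
have {}sk t : t \in s -> (mdeg (mnm_add t.2 m') < d)%N.
  by move=> /sk h; rewrite mdegD; apply: leq_trans md; rewrite dm ltn_add2r.
elim: s sk {gs} => [|t s IHs] sk.
  by have -> : (fun l x => \sum_(t <- [::]) t.1.[l] * monv x (mnm_add t.2 m')) = fun _ _ => 0;
    [apply/funext => l; apply/funext => x; rewrite big_nil|exact: red0].
have -> : (fun l x => \sum_(t <- t :: s) t.1.[l] * monv x (mnm_add t.2 m')) =
   fun l x => t.1.[l] * monv x (mnm_add t.2 m') + \sum_(t <- s) t.1.[l] * monv x (mnm_add t.2 m').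
  by apply/funext => l; apply/funext => x; rewrite big_cons.
apply: redD; last by apply: IHs => t' t's; apply: sk; rewrite inE t's orbT.
by apply: redZ; apply: IH; apply: sk; rewrite inE eqxx.
Qed.

Lemma red_peval S k (p : mpoly n R) : (0 < k)%N -> normal_form S k -> red S k (fun _ x => peval p x).
Proof.
move=> k0 SN; have -> : (fun (_ : R) x => peval p x) =
    fun l x => \sum_(m <- msupp p) (mcoeff m p)%:P.[l] * monv x m.
  by apply/funext => l; apply/funext => x; rewrite /peval mevalE; under [RHS]eq_bigr do rewrite hornerC.
by apply: red_sum => m; apply: redZ; exact: red_mon.
Qed.

(* On the solutions of the system, polynomials form a module of rank [k ^ n] over the
   polynomials in [l]. *)
Lemma normal_form_elim S k (w : mpoly n R) : (0 < k)%N -> normal_form S k ->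
  exists b : nat -> {poly R}, (exists2 j, (j <= k ^ n)%N & b j != 0) /\
    forall l x, l != 0 -> S l x -> \sum_(j < (k ^ n).+1) (b j).[l] * peval w x ^+ j = 0.
Proof.
move=> k0 SN; have /choice[e /choice[c H]] : forall j : nat, exists e c, forall l x, S l x ->
    l ^+ e * peval w x ^+ j = \sum_(a : {ffun 'I_n -> 'I_k}) (c a).[l] * \prod_i x 0 i ^+ a i.
  move=> j; have [e [c ec]] := red_peval (w ^+ j) k0 SN.
  by exists e, c => l x Sx; rewrite -ec // /peval rmorphXn.
(* [E] dominates all exponents [e j]; the factor [l ^ (E - e j)] gives the relations a common
   denominator. *)
pose E := \sum_(j < (k ^ n).+1) e j.
have [|b [b0 bc]] := @exists_poly_kernel _ (k ^ n) _ (fun j a => 'X^(E - e j) * c j a).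
  by rewrite card_ffun !card_ord.
exists b; split=> // l x l0 Sx; apply/eqP.
have lE : l ^+ E != 0 by rewrite expf_neq0.
rewrite -(mulrI_eq0 _ (mulfI lE)) mulr_sumr; apply/eqP.
transitivity (\sum_a (\sum_(j < (k ^ n).+1) b j * ('X^(E - e j) * c j a)).[l] * \prod_i x 0 i ^+ a i).
  under [RHS]eq_bigr do rewrite horner_sum mulr_suml.
  rewrite exchange_big /=; apply: eq_bigr => j _.
  have -> : l ^+ E = l ^+ (E - e j) * l ^+ e j.
    by rewrite -exprD subnK // /E (bigD1 j) //= leq_addr.
  rewrite mulrCA -mulrA H // !mulr_sumr; apply: eq_bigr => a _.
  by rewrite !hornerM hornerXn !mulrA.
by apply: big1 => a _; rewrite bc horner0 mul0r.
Qed.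

End normal_form.

(** * Elimination on a plane curve *)

Section plane.
Context {R : realType}.

(** The monomials of degree at most [M] in two variables, as a finite index type for
    [exists_kernel]. *)
Definition bmon (M : nat) : finType := {i : 'I_M.+1 & 'I_(M.+1 - i)}.

Definition mnm2 (i j : nat) : multinom 2 := Multinom [tuple i; j].

Lemma mnm2_0 i j : mnm2 i j ord0 = i. Proof. by rewrite multinomE (tnth_nth 0%N). Qed.

Lemma mnm2_1 i j : mnm2 i j ord_max = j. Proof. by rewrite multinomE (tnth_nth 0%N). Qed.

Lemma mnm2E (m : multinom 2) : m = mnm2 (m ord0) (m ord_max).
Proof.
apply/mnmP => i; case: i => -[|[|//]] h.
  by rewrite (_ : Ordinal h = ord0) ?mnm2_0 //; apply: val_inj.
by rewrite (_ : Ordinal h = ord_max) ?mnm2_1 //; apply: val_inj.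
Qed.

Lemma mdeg_mnm2 i j : mdeg (mnm2 i j) = (i + j)%N.
Proof.
by rewrite mdegE big_ord_recl big_ord1 mnm2_0; congr (_ + _)%N.
Qed.

Definition bmon_val M (t : bmon M) : multinom 2 := mnm2 (tag t) (tagged t).

Lemma bmon_val_inj M : injective (@bmon_val M).
Proof.
move=> [i j] [i' j'] /= h; have ii : i = i'.
  by apply: val_inj; have := congr1 (fun m : multinom 2 => m ord0) h; rewrite /bmon_val !mnm2_0.
case: _ / ii in j' h *; congr (Tagged _ _); apply: val_inj.
by have := congr1 (fun m : multinom 2 => m ord_max) h; rewrite /bmon_val !mnm2_1.
Qed.

Lemma mdeg_bmon M (t : bmon M) : (mdeg (bmon_val t) <= M)%N.
Proof.
case: t => i j; rewrite /bmon_val mdeg_mnm2 /=; have := ltn_ord j; have := ltn_ord i; lia.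
Qed.

Lemma bmon_surj M (m : multinom 2) : (mdeg m <= M)%N -> exists t : bmon M, bmon_val t = m.
Proof.
rewrite [m in mdeg m]mnm2E mdeg_mnm2 => mM.
have h0 : (m ord0 < M.+1)%N by lia.
have h1 : (m ord_max < M.+1 - m ord0)%N by lia.
by exists (existT (fun i : 'I_M.+1 => 'I_(M.+1 - i)) (Ordinal h0) (Ordinal h1)); rewrite /bmon_val /= -mnm2E.
Qed.

(** Bounds how many dimensions are left in degree [M + e] modulo the multiples of a polynomial of
    degree [e]. *)
Lemma card_bmonD M e : (#|bmon (M + e)| <= #|bmon M| + e * (M + e).+1)%N.
Proof.
have cE N : #|bmon N| = (\sum_(i < N.+1) i.+1)%N.
  rewrite card_tagged sumnE big_map big_enum /= (reindex_inj rev_ord_inj) /=.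
  by apply: eq_bigr => i _; rewrite card_ord; have := ltn_ord i; lia.
rewrite !cE; elim: e => [|e IH]; first by rewrite addn0 mul0n addn0.
rewrite addnS big_ord_recr /=; move: IH; set a := (\sum_(i < (M + e).+1) _)%N.
by set c := (\sum_(i < M.+1) _)%N; move: a c => a c; nia.
Qed.

(* Modulo [q] the monomials [f ^ a * w ^ b] with [b <= d * e] and [a] large outnumber the
   residues of their degree. *)
Lemma plane_elim (q f w : mpoly 2 R) (e d : nat) : q != 0 -> mdle e q -> mdle d f -> mdle d.-1 w ->
  (0 < d)%N -> exists b : nat -> {poly R}, (exists2 j, (j <= d * e)%N & b j != 0) /\
    forall x, peval q x = 0 -> \sum_(j < (d * e).+1) (b j).[peval f x] * peval w x ^+ j = 0.
Proof.
(* The [(A + 1) * (B + 1)] products must outnumber the at most [e * (M + e + 1)] residues. With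
   [B = d * e] the former grow like [(d * e + 1) * A], the latter like [d * e * A], so a large [A]
   suffices. *)
move=> q0 qe fd wd d0; pose A := (d * d * e * e + e)%N; pose B := (d * e)%N.
pose M := (d * A + d.-1 * B)%N; pose I : finType := (('I_A.+1 * 'I_B.+1) + bmon M)%type.
pose poly_of (i : I) : mpoly 2 R := match i with
  | inl ab => f ^+ ab.1 * w ^+ ab.2 | inr t => - (q * mpolyX R (bmon_val t)) end.
have poly_deg i : mdle (M + e) (poly_of i).
  case: i => [[a b]|t] /=.
    apply: (@mdle_le _ _ (d * a + d.-1 * b)%N).
      by apply: leq_trans (leq_addr _ _); apply: leq_add; rewrite leq_mul2l -ltnS ltn_ord orbT.
    by apply: mdleM; apply: mdleX.
  by apply: mdleN; rewrite addnC; apply: mdleM => //; apply: mdle_mon; exact: mdeg_bmon.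
have [|v [[i0 vi0] vA]] := @exists_kernel R I (bmon (M + e)) (fun i t => mcoeff (bmon_val t) (poly_of i)).
  rewrite card_sum card_prod !card_ord; apply: leq_ltn_trans (card_bmonD M e) _.
  rewrite addnC ltn_add2r /M /A /B; case: d d0 {fd wd poly_deg A B M I poly_of} => // d _ /=.
  nia.
have sum0 : \sum_i v i *: poly_of i = 0.
  apply/mpolyP => m; rewrite mcoeff0; have [mM|mM] := leqP (mdeg m) (M + e).
    have [t <-] := bmon_surj mM; rewrite -[RHS](vA t) raddf_sum; apply: eq_bigr => i _.
    exact: mcoeffZ.
  apply/eqP; rewrite mcoeff_eq0; apply/negP => mS.
  have : mdle (M + e) (\sum_i v i *: poly_of i) by apply: mdle_sum => i _; apply: mdleZ.
  by move=> /(_ m mS); rewrite leqNgt mM.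
rewrite big_sumType /= in sum0.
pose u := \sum_(t : bmon M) v (inr t) *: mpolyX R (bmon_val t).
have qu : \sum_(ab : 'I_A.+1 * 'I_B.+1) v (inl ab) *: (f ^+ ab.1 * w ^+ ab.2) = q * u.
  apply/eqP; rewrite -subr_eq0 -[X in _ == X]sum0; apply/eqP; congr (_ + _).
  by rewrite /u mulr_sumr -sumrN; apply: eq_bigr => t _; rewrite scalerN scalerAr.
pose b (j : nat) : {poly R} := \sum_(a < A.+1) v (inl (a, inord j)) *: 'X^a.
have bE (j : 'I_B.+1) : b j = \sum_(a < A.+1) v (inl (a, j)) *: 'X^a by rewrite /b inord_val.
exists b; split; last first.
  move=> x qx; have : peval (q * u) x = 0 by rewrite /peval mevalM -/(peval q x) qx mul0r.
  rewrite -qu /peval raddf_sum /= => E; rewrite -[RHS]E.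
  rewrite [RHS](eq_bigr (fun p => v (inl (p.1, p.2)) * (peval f x ^+ p.1 * peval w x ^+ p.2))); last first.
    by move=> [a j] _; rewrite mevalZ mevalM !rmorphXn.
  rewrite -(pair_bigA _ (fun (a : 'I_A.+1) (j : 'I_B.+1) => v (inl (a, j)) * (peval f x ^+ a * peval w x ^+ j))) /=.
  rewrite exchange_big /=; apply: eq_bigr => j _.
  rewrite bE horner_sum mulr_suml; apply: eq_bigr => a _.
  by rewrite hornerZ hornerXn mulrA.
(* If all these coefficients vanish, then [q * u = 0], hence [u = 0] in a domain, and the whole
   kernel vector is 0. *)
apply: contrapT => nb.
have v0 a j : v (inl (a, j)) = 0.
  apply: contrapT => /eqP vaj; apply: nb; exists (j : nat); first by rewrite -ltnS.
  apply: contraNneq vaj => bj; have := congr1 (fun p : {poly R} => p`_a) bj.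
  rewrite bE coef0 coef_sum (bigD1 a) //= big1 => [|t tt]; last first.
    by rewrite coefZ coefXn eq_sym (inj_eq val_inj) (negPf tt) mulr0.
  by rewrite addr0 coefZ coefXn eqxx mulr1 => ->.
have u0 : u = 0.
  apply/eqP; move: qu; rewrite big1 => [/esym/eqP|[a j] _]; last by rewrite v0 scale0r.
  by rewrite mulf_eq0 (negPf q0).
case: i0 vi0 => [[a j]|t]; first by rewrite v0 eqxx.
have := congr1 (mcoeff (bmon_val t)) u0; rewrite mcoeff0 /u raddf_sum /= (bigD1 t) //= big1 => [|t' tt'].
  by rewrite addr0 mcoeffZ mcoeffX eqxx mulr1 => ->; rewrite eqxx.
by rewrite mcoeffZ mcoeffX (inj_eq (@bmon_val_inj M)) (negPf tt') mulr0.
Qed.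

End plane.

(** * Bounds on the Legendre transform *)

Section uniform.
Context {R : realType}.

Lemma finite_uniform (I : finType) (P : I -> R -> R -> Prop) :
  (forall i C C' s s', C <= C' -> s' <= s -> P i C s -> P i C' s') ->
  (forall i, exists C s, [/\ 0 < C, 0 < s & P i C s]) ->
  exists C s, [/\ 0 < C, 0 < s & forall i, P i C s].
Proof.
move=> mon H; suff [C [s [C0 s0 HP]]] : exists C s, [/\ 0 < C, 0 < s & forall i, i \in enum I -> P i C s].
  by exists C, s; split=> // i; apply: HP; rewrite mem_enum.
elim: (enum I) => [|i l [C [s [C0 s0 HP]]]]; first by exists 1, 1; split.
have [C' [s' [C'0 s'0 HP']]] := H i.
exists (C + C'), (Num.min s s'); split; rewrite ?addr_gt0 ?lt_min ?s0 // => j.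
rewrite inE => /predU1P[->|/HP Pj]; [apply: mon HP'|apply: mon Pj].
- by rewrite lerDr ltW.
- by rewrite ge_min lexx orbT.
- by rewrite lerDl ltW.
- by rewrite ge_min lexx.
Qed.

(** The errors of repeated halving form a geometric series of ratio at most [1 / 2], as [p > 0], and
    the last term [B (t / 2 ^ j)] falls below any [e > 0]. *)
Lemma dyadic_bound (B : R -> R) (C t0 : R) (p : nat) : 0 <= C -> (0 < p)%N ->
  (forall t, 0 < t < t0 -> B t <= B (t / 2) + C * t ^+ p) ->
  (forall e, 0 < e -> exists2 d, 0 < d & forall t, 0 < t < d -> B t <= e) ->
  forall t, 0 < t < t0 -> B t <= 2 * C * t ^+ p.
Proof.
move=> C0 p0 H L t /andP[tp tt].
have step j : B t <= B (t / 2 ^+ j) + 2 * C * t ^+ p * (1 - 2^-1 ^+ j).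
  elim: j => [|j IH]; first by rewrite !expr0 divr1 subrr mulr0 addr0.
  have tj : 0 < t / 2 ^+ j < t0.
    rewrite divr_gt0 ?exprn_gt0 //=; apply: le_lt_trans tt.
    by rewrite ler_pdivrMr ?exprn_gt0 // ler_peMr ?(ltW tp) // exprn_ege1 // ler1n.
  have := H _ tj; have -> : t / 2 ^+ j / 2 = t / 2 ^+ j.+1 by rewrite exprSr invfM mulrA.
  have : C * (t / 2 ^+ j) ^+ p <= C * (t ^+ p * 2^-1 ^+ j).
    rewrite ler_wpM2l // exprMn ler_pM2l ?exprn_gt0 // -exprVn -[leRHS]expr1.
    by apply: ler_wiXn2l => //; rewrite exprn_ile1 //; lra.
  have -> : 2^-1 ^+ j.+1 = 2^-1 ^+ j / 2 :> R by rewrite exprSr.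
  by move: IH; set a := t ^+ p; set b := 2^-1 ^+ j => IH h1 h2; lra.
apply/ler_addgt0Pl => e e0; have [d d0 Hd] := L e e0.
have [j jP] : exists j : nat, t / d < 2 ^+ j.
  exists (Num.bound (t / d)); apply: lt_le_trans (archi_boundP _) _; first by rewrite divr_ge0 // ltW.
  by rewrite -natrX ler_nat ltnW // ltn_expl.
have := Hd (t / 2 ^+ j); rewrite divr_gt0 ?exprn_gt0 //= => /(_ _) h.
have {}h : B (t / 2 ^+ j) <= e.
  by apply: h; rewrite ltr_pdivrMr ?exprn_gt0 // mulrC -ltr_pdivrMr.
apply: le_trans (step j) _; apply: lerD => //.
by rewrite ler_piMr // !mulr_ge0 // exprn_ge0 // ltW.
Qed.

End uniform.

Section legendre.
Context {R : realType} {n : nat}.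
Implicit Types (f : mpoly n R) (x y c : 'rV[R]_n).

Definition gradsq_poly f : mpoly n R := \sum_i mderiv i f ^+ 2.

Lemma peval_gradsq f x : peval (gradsq_poly f) x = gradsq f x.
Proof. by rewrite /peval raddf_sum /=; apply: eq_bigr => i _; rewrite rmorphXn. Qed.

Lemma mdle_gradsq d f : mdle d f -> mdle (d.-1 * 2) (gradsq_poly f).
Proof. by move=> fd; apply: mdle_sum => i _; apply: mdleX; exact: mdle_deriv. Qed.

Definition boxmax c (k : R) (p : mpoly n R) y : Prop :=
  `|y - c| <= k /\ forall x, `|x - c| <= k -> peval p x <= peval p y.

Lemma boxmax_exists c (k : R) p : 0 <= k -> exists y, boxmax c k p y.
Proof.
move=> k0; have [||y] := @compact_EVT_max _ R (peval p) _ _ (@closed_box_compact R n c k).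
- by exists c => /=; rewrite subrr normr0.
- by apply: continuous_subspaceT; exact: peval_continuous.
by rewrite inE => yk ymax; exists y; split=> // x xk; apply: ymax; rewrite inE.
Qed.

Lemma boxmax_face c (k : R) p y i : boxmax c k p y ->
  [\/ peval (mderiv i p) y = 0, y 0 i = c 0 i + k | y 0 i = c 0 i - k].
Proof.
move=> [yk ymax]; have := rvnorm_coord (y - c) i; rewrite !mxE => h.
have {h} := le_trans h yk; rewrite le_eqVlt => /orP[/eqP h|h].
  have [hp|hn] := leP 0 (y 0 i - c 0 i); [constructor 2|constructor 3]; rewrite -h.
    by rewrite ger0_norm //; ring.
  by rewrite ltr0_norm //; ring.
by constructor 1; exact: (box_max_deriv0 yk ymax).
Qed.

(* Maximizers of [l * f - E] with [E] comparable to [gradsq f] approach the zeros of [f],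
   where [f = o(|grad f|)]; hence [|grad f| = o(l)] there. *)
Lemma legendre_small f c (k a C3 eta : R) : 0 < k -> 0 < a -> 0 < C3 -> 0 < eta -> (forall x, 0 <= peval f x) ->
  (forall x, `|x - c| <= k -> peval f x ^+ 2 <= gradsq f x) ->
  exists2 l0, 0 < l0 & forall l y, 0 < l < l0 -> `|y - c| <= k ->
    a * gradsq f y <= l * peval f y + C3 * l ^+ 3 ->
    peval f y ^+ 2 <= eta * gradsq f y /\ gradsq f y <= eta * l ^+ 2.
Proof.
move=> k0 a0 C30 eta0 f0 fH.
pose eta' := Num.min eta (eta * a ^+ 2 / 2).
have eta'0 : 0 < eta' by rewrite lt_min eta0 divr_gt0 // mulr_gt0 // exprn_gt0.
have [t t0 Ht] := grad_dominates_unif eta'0 f0 fH.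
have [F F0 fF] := peval_bounded f (`|c| + k).
pose l0 := Num.min 1 (Num.min (a * t / (F + C3)) (eta * a / (4 * C3))).
have FC : 0 < F + C3 by rewrite addr_gt0.
have l00 : 0 < l0 by rewrite !lt_min ltr01 !divr_gt0 ?mulr_gt0.
exists l0 => // l y; rewrite !lt_min => /and4P[lp l1 lt le] yk HE.
have yM : `|y| <= `|c| + k.
  by rewrite -[y](subrK c) addrC (le_trans (ler_normD _ _)) // lerD2l.
have fyF : peval f y <= F by apply: le_trans (ler_norm _) (fF _ yM).
have l3 : l ^+ 3 <= l by rewrite -[leRHS]expr1; apply: ler_wiXn2l; rewrite // ltW.
have Hyt : gradsq f y < t.
  rewrite -(ltr_pM2l a0); apply: le_lt_trans HE _; rewrite ltr_pdivlMr // in lt.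
  apply: le_lt_trans lt; rewrite mulrDr [C3 * _]mulrC; apply: lerD.
    by rewrite ler_pM2l.
  by rewrite ler_pM2r.
have fe := Ht y yk Hyt.
have Hy0 := gradsq_ge0 f y.
split; first by apply: le_trans fe _; rewrite ler_wpM2r // ge_min lexx.
have e2 : eta' <= eta * a ^+ 2 / 2 by rewrite ge_min lexx orbT.
(* The arithmetic-geometric mean inequality absorbs half of [a * gradsq f y]; [eta'] and [l0] are
   chosen so that the other terms add up to at most [eta * a * l ^ 2 / 2]. *)
have amgm : l * peval f y <= (l ^+ 2 * eta' / a + a * gradsq f y) / 2.
  have p0 : 0 <= (l ^+ 2 * eta' / a + a * gradsq f y) / 2.
    by rewrite divr_ge0 // addr_ge0 // ?mulr_ge0 ?invr_ge0 ?exprn_ge0 // ltW.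
  rewrite -(@ler_pXn2r _ 2) // ?nnegrE //; last by rewrite mulr_ge0 // ltW.
  rewrite exprMn; apply: (@le_trans _ _ (l ^+ 2 * (eta' * gradsq f y))).
    by rewrite ler_pM2l // exprn_gt0.
  have -> : l ^+ 2 * (eta' * gradsq f y) = (l ^+ 2 * eta' / a) * (a * gradsq f y).
    by rewrite [RHS]mulrA divfK ?gt_eqF // mulrA.
  set u := _ / a; set v := a * _; have := sqr_ge0 (u - v); rewrite !expr2; lra.
have lC : C3 * l ^+ 3 <= l ^+ 2 * (eta * a / 4).
  rewrite exprSr mulrCA mulrA -mulrA ler_pM2l ?exprn_gt0 // mulrC -ler_pdivlMr //.
  by move: le; rewrite invfM mulrA => /ltW.
have : l ^+ 2 * eta' / a <= l ^+ 2 * (eta * a / 2).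
  rewrite -mulrA ler_pM2l ?exprn_gt0 // ler_pdivrMr //; apply: le_trans e2 _.
  by rewrite expr2 le_eqVlt; apply/orP; left; apply/eqP; ring.
move=> h; rewrite -(ler_pM2l a0); move: h lC amgm HE; set u := l ^+ 2 * eta' / a.
set v := C3 * _; set L := l ^+ 2; set w := l * _; set A := a * gradsq f y; move=> h1 h2 h3 h4.
have -> : a * (eta * L) = L * (eta * a) by ring.
lra.
Qed.

End legendre.

(** * The penalized transform in any number of variables *)

Section valley.
Context {R : realType} {n : nat}.
Implicit Types (f : mpoly n R) (x y c : 'rV[R]_n).

Lemma box_norm c (k : R) x : `|x - c| <= k -> `|x| <= `|c| + k.
Proof. by move=> xc; rewrite -[x](subrK c) addrC (le_trans (ler_normD _ _)) // lerD2l. Qed.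

Lemma gradsq_zero f c : (forall x, 0 <= peval f x) -> peval f c = 0 -> gradsq f c = 0.
Proof.
move=> f0 fc; apply: big1 => i _.
suff -> : peval (mderiv i f) c = 0 by rewrite expr0n.
have : peval (mderiv i (- f)) c = 0.
  apply: (@box_max_deriv0 _ _ _ c 1); rewrite ?subrr ?normr0 // => x _.
  by rewrite /peval !mevalN lerN2 -/(peval f c) fc; exact: f0.
by rewrite mderivN /peval mevalN => /eqP; rewrite oppr_eq0 => /eqP.
Qed.

Definition powersum (k : nat) : mpoly n R := \sum_(j < n) mpolyX R (mnm_muln (mnm1 j) k).

Lemma peval_deriv_powersum k i x :
  peval (mderiv i (powersum k.+1)) x = k.+1%:R * x 0 i ^+ k.
Proof.
rewrite /powersum /peval (raddf_sum (mderiv i)) /= raddf_sum /= (bigD1 i) //= big1 => [|j ji].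
  rewrite addr0 mderivX mevalZ mulmnE mnm1E eqxx mul1n; congr (_ * _).
  rewrite mevalX (bigD1 i) //= big1 => [|j ji]; rewrite mnmBE mulmnE !mnm1E.
    by rewrite eqxx mul1n subn1 mulr1.
  by rewrite eq_sym (negPf ji) mul0n expr0.
by rewrite mderivX mevalZ mulmnE mnm1E (negPf ji) mul0n mul0r.
Qed.

(** The penalty brings the critical equations into normal form: for [k = 2 * (d - 1)] its derivative
    contributes [l ^ 3 * (k + 1) * x_i ^ k], of larger degree in [x] than the derivatives of [f] and
    [|grad f| ^ 2]. The constant [C0] makes the penalty nonnegative on the box. *)
Definition penalized f (k : nat) (C0 l : R) : mpoly n R :=
  l *: f - gradsq_poly f - l ^+ 3 *: (powersum k.+1 + mpolyC n C0).

Lemma peval_penalized f k C0 l x : peval (penalized f k C0 l) x =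
  l * peval f x - gradsq f x - l ^+ 3 * (peval (powersum k.+1) x + C0).
Proof. by rewrite -peval_gradsq /penalized /peval !mevalB !mevalZ mevalD mevalC. Qed.

Lemma deriv_penalized f k C0 l i x : peval (mderiv i (penalized f k C0 l)) x =
  l * peval (mderiv i f) x - peval (mderiv i (gradsq_poly f)) x - l ^+ 3 * (k.+1%:R * x 0 i ^+ k).
Proof.
rewrite -peval_deriv_powersum /penalized /peval !mderivB !mderivZ mderivD mderivC addr0.
by rewrite !mevalB !mevalZ.
Qed.

Definition face_eq (p : mpoly n R) c (k : R) (s : 'I_3) (i : 'I_n) y : Prop :=
  match val s with
  | O => peval (mderiv i p) y = 0
  | S O => y 0 i = c 0 i + k
  | _ => y 0 i = c 0 i - k
  end.

Lemma boxmax_faces c (k : R) p y : boxmax c k p y ->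
  exists s : {ffun 'I_n -> 'I_3}, forall i, face_eq p c k (s i) i y.
Proof.
move=> py; have /choice[s sP] : forall i, exists t : 'I_3, face_eq p c k t i y.
  move=> i; have [h|h|h] := boxmax_face i py.
  - by exists (@Ordinal 3 0 isT).
  - by exists (@Ordinal 3 1 isT).
  - by exists (@Ordinal 3 2 isT).
by exists [ffun i => s i] => i; rewrite ffunE.
Qed.

(** Where the partial derivative vanishes, its equation is solved for [l ^ 3 * x_i ^ k]; on a face,
    [x_i] is constant and [x_i ^ k] has degree 0. *)
Lemma penalized_normal_form f d c (k C0 : R) (s : {ffun 'I_n -> 'I_3}) : (1 < d)%N -> mdle d f ->
  normal_form (fun l y => forall i, face_eq (penalized f (d.-1 * 2) C0 l) c k (s i) i y) (d.-1 * 2).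
Proof.
move=> d1 fd i; set K := (d.-1 * 2)%N.
have K0 : (0 < K)%N by rewrite muln_gt0 andbT -ltnS prednK // ltnW.
have cst (a : R) : (forall (l : R) y, (forall i, face_eq (penalized f K C0 l) c k (s i) i y) -> y 0 i = a) ->
    exists e g, lowdeg K g /\ forall (l : R) y, (forall i, face_eq (penalized f K C0 l) c k (s i) i y) ->
    l ^+ e * y 0 i ^+ K = g l y.
  move=> H; exists 0%N, (fun _ _ => (a ^+ K)%:P.[0]); split.
    have := @lowdeg_cst R n K (a ^+ K)%:P K0; congr (lowdeg _ _).
    by apply/funext => l; apply/funext => y; rewrite !hornerC.
  by move=> l y /H ->; rewrite expr0 mul1r hornerC.
case sE : (s i) => [[|[|m]] h].
- have K1 : K.+1%:R != 0 :> R by rewrite pnatr_eq0.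
  exists 3%N, (fun l y => (K.+1%:R^-1 *: 'X).[l] * peval (mderiv i f) y +
     (- K.+1%:R^-1)%:P.[l] * peval (mderiv i (gradsq_poly f)) y); split.
    apply: lowdegD; apply: lowdeg_peval.
      move=> m /(mdle_deriv fd) mm; apply: leq_ltn_trans mm _.
      by rewrite /K muln2 -addnn -[X in (X < _)%N]addn0 ltn_add2l -ltnS prednK // ltnW.
    by apply: mdle_deriv_gt0 => //; exact: mdle_gradsq.
  move=> l y /(_ i); rewrite sE /face_eq /= deriv_penalized => /eqP; rewrite subr_eq0 => /eqP E.
  rewrite hornerZ hornerX hornerC; apply: (mulfI K1); rewrite mulrCA -E mulrDr !mulrA mulfV // mul1r.
  by rewrite mulrN mulfV // mulN1r.
- by apply: (cst (c 0 i + k)) => l y /(_ i); rewrite sE.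
- by apply: (cst (c 0 i - k)) => l y /(_ i); rewrite sE.
Qed.

(** For [w] the partial derivative, [|w| < s * l] makes [w / l] a small root of the eliminating
    relation, and small roots are of order at most [l ^ (1 / Q)]. *)
Lemma penalized_deriv_bound f d c (k C0 : R) : (1 < d)%N -> mdle d f ->
  let Q := ((d.-1 * 2) ^ n)%N in
  exists C s, [/\ 0 < C, 0 < s & forall l y i, 0 < l < s ->
    boxmax c k (penalized f (d.-1 * 2) C0 l) y -> `|peval (mderiv i f) y| < s * l ->
    `|peval (mderiv i f) y| ^+ Q <= C * l ^+ Q.+1].
Proof.
move=> d1 fd Q; set K := (d.-1 * 2)%N in Q *.
have K0 : (0 < K)%N by rewrite muln_gt0 andbT -ltnS prednK // ltnW.
pose P (t : {ffun 'I_n -> 'I_3} * 'I_n) (C s : R) := forall l y, 0 < l < s ->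
  (forall i, face_eq (penalized f K C0 l) c k (t.1 i) i y) ->
  `|peval (mderiv t.2 f) y| < s * l -> `|peval (mderiv t.2 f) y| ^+ Q <= C * l ^+ Q.+1.
have [||C [s [C_gt0 s_gt0 H]]] := @finite_uniform R _ P.
- move=> t C C' s s' CC' ss' H l y /andP[lp ls] Sy wl.
  apply: le_trans (H l y _ Sy _) _; first by rewrite lp (lt_le_trans ls).
    by apply: lt_le_trans wl _; rewrite ler_pM2r.
  by rewrite ler_pM2r // exprn_gt0.
- move=> [t i]; have [b [[j jQ bj] bP]] := normal_form_elim (mderiv i f) K0 (penalized_normal_form c k C0 t d1 fd).
  (* Writing [w = l * om] turns the coefficient [b j] of [w ^ j] into [b j * 'X^j]. *)
  have [|C [s [C_gt0 s_gt0 H]]] := @small_root_bound R (fun j => b j * 'X^j) Q.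
    by exists j => //; rewrite mulf_neq0 // -size_poly_eq0 size_polyXn.
  exists C, s; split=> // l y ls Sy wl; have lp : 0 < l by case/andP: ls.
  rewrite /= in wl *; set w := peval _ y in wl *.
  have := H l (w / l) ls; rewrite normrM normfV (gtr0_norm lp) ltr_pdivrMr // => /(_ wl).
  rewrite expr_div_n ler_pdivrMr ?exprn_gt0 // -mulrA -exprS; apply.
  rewrite -[RHS](bP l y _ Sy) ?gt_eqF //; apply: eq_bigr => m _.
  by rewrite hornerM hornerXn -mulrA -exprMn mulrCA mulfV ?gt_eqF // mulr1.
exists C, s; split=> // l y i ls ymax wl; have [t tP] := boxmax_faces ymax.
exact: (H (t, i)).
Qed.

(** With [l = t ^ Q], elimination bounds only the gradient at a maximizer, by a multiple of
    [t ^ (Q + 1)]. The maximum [M t] is recovered by a discrete envelope argument: testing the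
    maximizer for [t] in the problem for [t / 2] bounds the change of [M t / t ^ Q], which is
    eventually below every positive number. *)
Lemma valley_general f d c (k : R) : (0 < n)%N -> (1 < d)%N -> mdle d f -> 0 < k ->
  (forall x, 0 <= peval f x) -> peval f c = 0 ->
  (forall x, `|x - c| <= k -> peval f x ^+ 2 <= gradsq f x) ->
  let Q := ((d.-1 * 2) ^ n)%N in
  exists C t0, [/\ 0 < C, 0 < t0 & forall t x, 0 < t < t0 -> `|x - c| <= k ->
    t ^+ Q * peval f x - gradsq f x <= C * t ^+ (Q + Q + 2)].
Proof.
move=> n0 d1 fd k0 f0 fc fH Q; set K := (d.-1 * 2)%N in Q *.
have Q2 : (2 <= Q)%N.
  have K2 : (2 <= K)%N by rewrite /K; move: d1; clear; lia.
  by rewrite /Q; case: (n) n0 => // m _; rewrite expnS; apply: leq_trans (leq_pmulr _ _) => //; rewrite expn_gt0 (leq_trans _ K2).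
have [B B0 GB] := peval_bounded (powersum K.+1) (`|c| + k).
pose G x := peval (powersum K.+1) x + B.
have Gb x : `|x - c| <= k -> 0 <= G x <= 2 * B.
  by move=> /box_norm /GB; rewrite ler_norml /G => /andP[h1 h2]; apply/andP; split; lra.
pose Psi l := penalized f K B l.
have PsiE l x : peval (Psi l) x = l * peval f x - gradsq f x - l ^+ 3 * G x by exact: peval_penalized.
have /choice[Y YP] : forall l, exists y, boxmax c k (Psi l) y by move=> l; apply: boxmax_exists; exact: ltW.
have cc : `|c - c| <= k by rewrite subrr normr0 ltW.
have Hc := gradsq_zero f0 fc.
have [C [s [C0 s0 HC]]] := penalized_deriv_bound c k B d1 fd.
have B20 : 0 < 2 * B by rewrite mulr_gt0.
have s20 : 0 < s ^+ 2 / 2 by rewrite divr_gt0 // exprn_gt0.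
have [l0 l00 Hl0] := legendre_small k0 ltr01 B20 s20 f0 fH.
have small l : 0 < l < l0 -> peval f (Y l) <= s ^+ 2 / 2 * l /\ gradsq f (Y l) <= s ^+ 2 / 2 * l ^+ 2.
  move=> ll; have [yk ymax] := YP l; have lp : 0 < l by case/andP: ll.
  have [|h1 h2] := Hl0 l (Y l) ll yk.
    have := ymax c cc; rewrite !PsiE fc Hc mulr0 sub0r mul1r.
    have /andP[G1 _] := Gb _ yk; have /andP[_ G2] := Gb _ cc.
    have l3 : 0 < l ^+ 3 by rewrite exprn_gt0.
    have : l ^+ 3 * G c <= l ^+ 3 * (2 * B) by rewrite ler_pM2l.
    have : 0 <= l ^+ 3 * G (Y l) by rewrite mulr_ge0 // ltW.
    lra.
  split=> //; have sl : 0 <= s ^+ 2 / 2 * l by rewrite mulr_ge0 // ltW.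
  rewrite -(@ler_pXn2r _ 2) ?nnegrE //; apply: le_trans h1 _.
  by rewrite exprMn [X in _ <= X * _]expr2 -[leRHS]mulrA ler_pM2l.
have /andP[C1 C1Q] : (1 <= 1 + C) && (C <= (1 + C) ^+ Q).
  have h : 1 <= 1 + C by rewrite lerDl ltW.
  rewrite h /=; apply: (@le_trans _ _ (1 + C)); first by rewrite lerDr.
  by rewrite -[leLHS]expr1 ler_weXn2l // ltnW.
pose t0 := Num.min 1 (Num.min (s / 2) l0).
have t00 : 0 < t0 by rewrite !lt_min ltr01 divr_gt0.
have tQ t : 0 < t < t0 -> [/\ 0 < t, t <= 1, 0 < t ^+ Q < l0, t ^+ Q < s & t ^+ Q <= t].
  rewrite !lt_min => /and4P[tp t1 ts tl].
  have tt : t ^+ Q <= t.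
    by rewrite -[leRHS]expr1; apply: ler_wiXn2l; [exact: ltW|exact: ltW|exact: ltnW].
  split=> //; first exact: ltW.
    by rewrite exprn_gt0 //= (le_lt_trans tt).
  by apply: le_lt_trans tt _; lra.
pose C4 := n%:R * (1 + C) ^+ 2.
have C40 : 0 <= C4 by rewrite mulr_ge0 // exprn_ge0 // (le_trans ler01).
have HY t : 0 < t < t0 -> gradsq f (Y (t ^+ Q)) <= C4 * t ^+ (Q + Q + 2).
  move=> /tQ[tp t1 tl ts _]; set l := t ^+ Q in tl ts *; have lp : 0 < l by case/andP: tl.
  have [_ Hs] := small l tl.
  have e : t ^+ (Q + Q + 2) = (t ^+ Q.+1) ^+ 2 by rewrite -exprM; congr (_ ^+ _); clear; lia.
  have -> : C4 * t ^+ (Q + Q + 2) = \sum_(i < n) ((1 + C) * t ^+ Q.+1) ^+ 2.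
    by rewrite sumr_const card_ord e /C4 exprMn mulr_natl mulrnAl.
  apply: ler_sum => i _; rewrite -[leLHS]real_normK ?num_real //.
  apply: lerXn2r; rewrite ?nnegrE ?mulr_ge0 ?exprn_ge0 ?(ltW tp) ?(le_trans ler01 C1) //.
  have ws : `|peval (mderiv i f) (Y l)| < s * l.
    rewrite -(@ltr_pXn2r _ 2) ?nnegrE ?mulr_ge0 ?(ltW s0) ?(ltW lp) // real_normK ?num_real //.
    apply: le_lt_trans (deriv_sq_le_gradsq f (Y l) i) _; apply: le_lt_trans Hs _.
    by rewrite exprMn ltr_pM2r ?exprn_gt0 // ltr_pdivrMr // ltr_pMr ?exprn_gt0 // ltr1n.
  have := HC l (Y l) i; rewrite lp ts => /(_ isT (YP l) ws) h.
  have Q0 : (0 < Q)%N by rewrite ltnW.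
  rewrite -(@ler_pXn2r _ Q) ?nnegrE ?mulr_ge0 ?exprn_ge0 ?(ltW tp) ?(le_trans ler01 C1) //.
  apply: le_trans h _; rewrite exprMn /l -!exprM mulnC ler_pM2r ?exprn_gt0 //.
pose M t := peval (Psi (t ^+ Q)) (Y (t ^+ Q)).
have Mhalf t : 0 < t < t0 -> M t / t ^+ Q <= M (t / 2) / (t / 2) ^+ Q + 2 ^+ Q * C4 * t ^+ (Q + 2).
  move=> tt; have [tp t1 _ _ _] := tQ t tt.
  have lp : 0 < t ^+ Q by rewrite exprn_gt0.
  have P2 : 0 < 2 ^+ Q :> R by rewrite exprn_gt0.
  have [yk _] := YP (t ^+ Q); have [_ /(_ _ yk)] := YP ((t / 2) ^+ Q).
  rewrite -/(M (t / 2)) PsiE => h.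
  have {}h : 2 ^+ Q * M (t / 2) >= M t - 2 ^+ Q * gradsq f (Y (t ^+ Q)).
    rewrite -(ler_pM2l P2) in h; apply: le_trans h; rewrite /M PsiE.
    have e1 : (t / 2) ^+ Q = t ^+ Q / 2 ^+ Q by rewrite expr_div_n.
    rewrite e1; set l := t ^+ Q; set P := 2 ^+ Q in P2 *; set y := Y l.
    have /andP[G0 _] := Gb _ yk; rewrite -/l -/y in G0.
    have H0 := gradsq_ge0 f y.
    have -> : P * (l / P * peval f y - gradsq f y - (l / P) ^+ 3 * G y) =
        l * peval f y - P * gradsq f y - l ^+ 3 * G y * (P ^-1) ^+ 2.
      by field; rewrite gt_eqF.
    have : l ^+ 3 * G y * P^-1 ^+ 2 <= l ^+ 3 * G y.
      have P1 : P^-1 <= 1 by rewrite invf_le1 // exprn_ege1 // ler1n.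
      have P'0 : 0 <= P^-1 by rewrite invr_ge0 ltW.
      rewrite ler_piMr //; first by rewrite mulr_ge0 // exprn_ge0 // ltW.
      by rewrite exprn_ile1.
    lra.
  have e1 : M (t / 2) / (t / 2) ^+ Q = 2 ^+ Q * M (t / 2) / t ^+ Q.
    by rewrite expr_div_n invf_div mulrCA mulrA.
  rewrite e1 ler_pdivrMr // mulrDl divfK ?gt_eqF //.
  have := HY t tt; have -> : t ^+ (Q + Q + 2) = t ^+ (Q + 2) * t ^+ Q.
    by rewrite -exprD; congr (_ ^+ _); clear; lia.
  rewrite -(ler_pM2l P2) => h2.
  have : M t <= 2 ^+ Q * M (t / 2) + 2 ^+ Q * gradsq f (Y (t ^+ Q)) by move: h; lra.
  move=> /le_trans; apply; rewrite lerD2l; apply: le_trans h2 _.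
  by rewrite !mulrA.
have C5 : 0 <= 2 ^+ Q * C4 by rewrite mulr_ge0 // exprn_ge0.
have Mlim e : 0 < e -> exists2 a, 0 < a & forall t, 0 < t < a -> M t / t ^+ Q <= e.
  move=> e0; exists (Num.min t0 (e / (s ^+ 2 / 2))); first by rewrite lt_min t00 divr_gt0.
  move=> t /andP[tp]; rewrite lt_min => /andP[tt te].
  have [|_ t1 tl _ tt'] := tQ t; first by rewrite tp.
  have [h _] := small _ tl; have lp : 0 < t ^+ Q by case/andP: tl.
  have [yk _] := YP (t ^+ Q); have /andP[G0 _] := Gb _ yk.
  rewrite ler_pdivrMr // /M PsiE.
  have : t ^+ Q * peval f (Y (t ^+ Q)) <= e * t ^+ Q.
    rewrite mulrC ler_pM2r //; apply: le_trans h _; rewrite ltr_pdivlMr // in te.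
    by apply: le_trans (ltW te); rewrite mulrC ler_pM2r.
  have := gradsq_ge0 f (Y (t ^+ Q)).
  have : 0 <= (t ^+ Q) ^+ 3 * G (Y (t ^+ Q)) by rewrite mulr_ge0 // exprn_ge0 // ltW.
  lra.
have Mb := dyadic_bound C5 (ltn_addl Q (isT : (0 < 2)%N)) Mhalf Mlim.
exists (2 * (2 ^+ Q * C4) + 2 * B), t0; split=> //.
  by rewrite ltr_wpDl // mulr_ge0.
move=> t x tt xk; have [tp t1 _ _ _] := tQ t tt; have lp : 0 < t ^+ Q by rewrite exprn_gt0.
have [_ /(_ x xk)] := YP (t ^+ Q); rewrite -/(M t) PsiE => h.
have := Mb t tt; rewrite ler_pdivrMr // => h2.
have /andP[_ G2] := Gb _ xk.
(* The penalty costs [l ^ 3 = t ^ (3 * Q)], at most [t ^ (2 * Q + 2)] because [Q >= 2]. *)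
have h3 : (t ^+ Q) ^+ 3 * G x <= 2 * B * t ^+ (Q + Q + 2).
  rewrite mulrC; apply: ler_pM; [by case/andP: (Gb _ xk)|by rewrite exprn_ge0 // ltW|exact: G2|].
  rewrite -exprM; apply: ler_wiXn2l; rewrite ?(ltW tp) //; clear -Q2; lia.
have h4 : 2 * (2 ^+ Q * C4) * t ^+ (Q + 2) * t ^+ Q = 2 * (2 ^+ Q * C4) * t ^+ (Q + Q + 2).
  by rewrite -mulrA -exprD; congr (_ * _ ^+ _); clear; lia.
rewrite h4 in h2; rewrite mulrDl; move: h h2 h3; clear.
set a := (t ^+ Q) ^+ 3 * G x; set b := t ^+ (Q + Q + 2); lra.
Qed.

End valley.

Section peval_morph.
Context {R : realType} {n : nat}.
Implicit Types (p q : mpoly n R) (x : 'rV[R]_n).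

Lemma pevalD p q x : peval (p + q) x = peval p x + peval q x.
Proof. exact: mevalD. Qed.

Lemma pevalB p q x : peval (p - q) x = peval p x - peval q x.
Proof. exact: mevalB. Qed.

Lemma pevalN p x : peval (- p) x = - peval p x.
Proof. exact: mevalN. Qed.

Lemma pevalM p q x : peval (p * q) x = peval p x * peval q x.
Proof. exact: mevalM. Qed.

Lemma pevalZ a p x : peval (a *: p) x = a * peval p x.
Proof. exact: mevalZ. Qed.

Lemma peval0 x : peval (0 : mpoly n R) x = 0.
Proof. exact: meval0. Qed.

End peval_morph.

(** Here [h = |grad f| ^ 2], [(a, b)] is the gradient of [f] and [(a', b')] that of [h]. The last
    three equations say that [h] and its products with two affine functions, of values [u] and [v],
    have zero Jacobian with [f]; combining them leaves [h * a = h * b = 0]. *)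
Lemma jacobian_cancel (R : realFieldType) (h a b a' b' u v : R) : h = a ^+ 2 + b ^+ 2 ->
  a' * b - b' * a = 0 ->
  (true%:R * h + u * a') * b - (false%:R * h + u * b') * a = 0 ->
  (false%:R * h + v * a') * b - (true%:R * h + v * b') * a = 0 -> h = 0.
Proof.
rewrite !mul1r !mul0r !add0r => hE J1 J2 J3.
have hb : h * b = 0 by have := congr1 (fun z => u * z) J1; rewrite mulr0; lra.
have ha : h * a = 0 by have := congr1 (fun z => v * z) J1; rewrite mulr0; lra.
apply/eqP; rewrite -sqrf_eq0; apply/eqP.
have -> : h ^+ 2 = h * a * a + h * b * b by rewrite expr2 {2}hE; ring.
by rewrite ha hb !mul0r addr0.
Qed.

(** * The transform in two variables *)

Section plane_valley.
Context {R : realType}.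
Implicit Types (f l : mpoly 2 R) (x y c : 'rV[R]_2).

Definition jacobian f g : mpoly 2 R :=
  mderiv ord0 f * mderiv ord_max g - mderiv ord_max f * mderiv ord0 g.

Lemma mdle_jacobian d e f g : mdle d f -> mdle e g -> mdle (d.-1 + e.-1) (jacobian f g).
Proof. by move=> fd ge; apply: mdleB; apply: mdleM; exact: mdle_deriv. Qed.

(** The curve carrying a maximizer: a side of the square for [Some (b, i)], the critical curve [p]
    for [None]. One nonzero polynomial is all that [plane_elim] asks for. *)
Definition face_poly c (k : R) (s : option (bool * 'I_2)) (p : mpoly 2 R) : mpoly 2 R :=
  if s is Some (b, i) then mpolyX R (mnm1 i) - mpolyC 2 (c 0 i + (-1) ^+ b * k) else p.

Lemma face_poly_neq0 c (k : R) s p : p != 0 -> face_poly c k s p != 0.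
Proof.
case: s => [[b i] _|//] /=; apply/eqP => /(congr1 (fun q => peval q (\row_j (c 0 i + (-1) ^+ b * k + 1)))).
rewrite /peval meval0 mevalB mevalXU mevalC mxE addrAC subrr add0r => /eqP.
by rewrite oner_eq0.
Qed.

Lemma mdle_face_poly c (k : R) s p e : (0 < e)%N -> mdle e p -> mdle e (face_poly c k s p).
Proof.
case: s => [[b i] e0 _|//] /=; apply: mdleB; last exact: mdleC.
by apply: mdle_mon; rewrite mdeg1.
Qed.

(* The substitution [om = f / w] turns the relation of [plane_elim] into one whose small
   roots are controlled. *)
Lemma plane_relation_bound (q f w : mpoly 2 R) (e d : nat) : q != 0 -> mdle e q -> mdle d f -> mdle d.-1 w ->
  (0 < d)%N -> exists C s, [/\ 0 < C, 0 < s & forall y, peval q y = 0 -> 0 < peval f y < s ->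
    peval f y < s * `|peval w y| ->
    peval f y ^+ (d * e) <= C * peval f y * `|peval w y| ^+ (d * e)].
Proof.
move=> q0 qe fd wd d0; have [b [[j jQ bj] H]] := plane_elim q0 qe fd wd d0.
set Q := (d * e)%N in jQ H *.
(* Multiplying the relation by [(z / v) ^ Q] reverses it: its [j]-th term becomes
   [b j * z ^ j * (z / v) ^ (Q - j)]. *)
have [|C [s [C0 s0 HC]]] := @small_root_bound R (fun m => b (Q - m)%N * 'X^(Q - m)) Q.
  exists (Q - j)%N; first exact: leq_subr.
  by rewrite subKn // mulf_neq0 // -size_poly_eq0 size_polyXn.
exists C, s; split=> // y qy; set z := peval f y; set v := peval w y => /andP[zp zs] zv.
have v0 : 0 < `|v| by rewrite -(pmulr_rgt0 _ s0); exact: lt_trans zv.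
have vn0 : v != 0 by rewrite -normr_gt0.
have := HC z (z / v); rewrite zp zs normrM normfV (gtr0_norm zp) ltr_pdivrMr // => /(_ isT zv).
rewrite expr_div_n ler_pdivrMr ?exprn_gt0 //; apply.
transitivity (z ^+ Q / v ^+ Q * \sum_(j < Q.+1) (b j).[z] * v ^+ j); last by rewrite H ?mulr0.
rewrite [in RHS](reindex_inj rev_ord_inj) mulr_sumr; apply: eq_bigr => m _ /=.
have mQ : (m <= Q)%N by rewrite -ltnS.
rewrite subSS hornerM hornerXn expr_div_n.
rewrite -[in z ^+ Q](subnK mQ) -[in v ^+ Q](subnK mQ) !exprD.
have vm : v ^+ m != 0 by rewrite expf_neq0.
have vQm : v ^+ (Q - m) != 0 by rewrite expf_neq0.
move: (z ^+ (Q - m)) (z ^+ m) (v ^+ m) (v ^+ (Q - m)) vm vQm => a1 a2 a3 a4 vm vQm.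
by field; rewrite vm vQm.
Qed.

Lemma gradsq2 f x : gradsq f x = peval (mderiv ord0 f) x ^+ 2 + peval (mderiv ord_max f) x ^+ 2.
Proof.
rewrite /gradsq big_ord_recl big_ord1; congr (_ + peval (mderiv _ f) x ^+ 2).
by apply: val_inj.
Qed.

(** At a maximizer [y] of [a * f - E], let [z = f y] and let [w] be the larger partial derivative.
    Comparison with [c] gives [w ^ 2 <= 2 * a * z], elimination gives [z ^ Q <= C * z * |w| ^ Q];
    together [z ^ (Q - 2)] is at most a multiple of [a ^ Q]. Hence the choice [q = Q - 2],
    [a = t ^ q], for which [a * z] is of order [t ^ (2 * q + 2)]. *)
Lemma valley_plane f l d c (k : R) : (1 < d)%N -> mdle d f -> mdle 1 l -> 0 < k ->
  (forall x, 0 <= peval f x) -> peval f c = 0 ->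
  (forall x, `|x - c| <= k -> peval f x ^+ 2 <= gradsq f x) ->
  (forall x, `|x - c| <= k -> 1 / 2 <= peval l x) ->
  jacobian (l * gradsq_poly f) f != 0 ->
  let q := (d * (3 * d - 3) - 2)%N in
  exists C t0, [/\ 0 < C, 0 < t0 & forall t x, 0 < t < t0 -> `|x - c| <= k ->
    t ^+ q * peval f x - peval (l * gradsq_poly f) x <= C * t ^+ (q + q + 2)].
Proof.
move=> d1 fd ld k0 f0 fc fH lH J0 q; set E := l * gradsq_poly f in J0 *.
set e := (3 * d - 3)%N in q *; pose Q := (d * e)%N.
have d0 : (0 < d)%N by rewrite ltnW.
have e0 : (0 < e)%N by rewrite /e; move: d1; clear; lia.
have Q3 : (3 <= Q)%N by rewrite /Q /e; move: d1; clear; nia.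
have qQ : (q + 2 = Q)%N by rewrite /q -/Q subnK // ltnW.
have q0 : (0 < q)%N by move: qQ Q3; clear; lia.
have EE x : peval E x = peval l x * gradsq f x by rewrite /E pevalM peval_gradsq.
(* The origin of [3 * d - 3]: the weighted [E] has degree at most [2 * d - 1], so the Jacobian has
   degree at most [(2 * d - 2) + (d - 1)]. *)
have Jd : mdle e (jacobian E f).
  apply: (@mdle_le _ _ ((1 + d.-1 * 2).-1 + d.-1)).
    by rewrite /e; move: d1; clear; lia.
  by apply: mdle_jacobian => //; apply: mdleM => //; exact: mdle_gradsq.
pose P (t : option (bool * 'I_2) * 'I_2) (C s : R) := forall y,
  peval (face_poly c k t.1 (jacobian E f)) y = 0 -> 0 < peval f y < s ->
    peval f y < s * `|peval (mderiv t.2 f) y| ->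
    peval f y ^+ Q <= C * peval f y * `|peval (mderiv t.2 f) y| ^+ Q.
have [||C [s [C0 s0 H]]] := @finite_uniform R _ P.
- move=> t C C' s s' CC' ss' H y qy /andP[fp fs] wf.
  apply: le_trans (H y qy _ _) _; first by rewrite fp (lt_le_trans fs).
    by apply: lt_le_trans wf _; rewrite ler_wpM2r.
  by rewrite ler_wpM2r ?exprn_ge0 // ler_pM2r.
- move=> [t i]; apply: plane_relation_bound => //.
  + exact: face_poly_neq0.
  + exact: mdle_face_poly.
  + exact: mdle_deriv.
pose Phi a := a *: f - E.
have PhiE a x : peval (Phi a) x = a * peval f x - peval E x by rewrite /Phi pevalB pevalZ.
have faces a y : boxmax c k (Phi a) y -> exists t, peval (face_poly c k t (jacobian E f)) y = 0.
  move=> ymax.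
  have face i : peval (mderiv i (Phi a)) y = 0 \/
      exists t, peval (face_poly c k t (jacobian E f)) y = 0.
    have [h|h|h] := boxmax_face i ymax; [by left|right; exists (Some (false, i))|right; exists (Some (true, i))].
      by rewrite /face_poly /peval mevalB mevalXU mevalC h expr0 mul1r subrr.
    by rewrite /face_poly /peval mevalB mevalXU mevalC h expr1 mulN1r subrr.
  have [h1|//] := face ord0; have [h2|//] := face ord_max; exists None => /=.
  move: h1 h2; rewrite /jacobian /Phi !mderivB !mderivZ !pevalB !pevalM !pevalZ.
  by move=> /eqP; rewrite subr_eq0 => /eqP <- /eqP; rewrite subr_eq0 => /eqP <-; ring.
have cc : `|c - c| <= k by rewrite subrr normr0 ltW.
have Hc := gradsq_zero f0 fc.
have h2 : 0 < 1 / 2 :> R by rewrite divr_gt0.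
have eta0 : 0 < s ^+ 2 / 4 by rewrite divr_gt0 // exprn_gt0.
have [l0 l00 Hl0] := legendre_small k0 h2 (@ltr01 R) eta0 f0 fH.
pose C6 := 1 + C ^+ 2 * 2 ^+ Q.
have C61 : 1 <= C6 by rewrite lerDl mulr_ge0 // exprn_ge0 // ltW.
have C60 : 0 < C6 by apply: lt_le_trans C61.
pose t0 := Num.min 1 (Num.min l0 (1 / s)).
have t00 : 0 < t0 by rewrite !lt_min ltr01 l00 divr_gt0.
exists C6, t0; split=> // t x; rewrite !lt_min => /and4P[tp t1 tl ts] xk.
set a := t ^+ q; have ap : 0 < a by rewrite exprn_gt0.
have at_ : a <= t.
  by rewrite -[leRHS]expr1; apply: ler_wiXn2l => //; exact: ltW.
have [y ymax] := @boxmax_exists _ _ c k (Phi a) (ltW k0).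
have [yk ymx] := ymax.
rewrite -PhiE; apply: le_trans (ymx x xk) _; rewrite PhiE.
have Ey0 : gradsq f y / 2 <= peval E y.
  by rewrite EE mulrC ler_wpM2r ?gradsq_ge0 // -[_^-1]mul1r lH.
have Elf : peval E y <= a * peval f y.
  by have := ymx c cc; rewrite !PhiE EE Hc fc !mulr0 subrr subr_ge0.
have R0 : 0 <= C6 * t ^+ (q + q + 2) by rewrite mulr_ge0 ?exprn_ge0 // ltW.
have [|fpos] := leP (peval f y) 0.
  move=> fn; apply: le_trans R0; rewrite subr_le0; apply: (@le_trans _ _ 0).
    by rewrite mulr_ge0_le0 // ltW.
  by apply: le_trans Ey0; rewrite divr_ge0 // gradsq_ge0.
have [||fe He] := Hl0 a y _ yk.
- by rewrite ap (le_lt_trans at_).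
- have : 0 <= 1 * a ^+ 3 by rewrite mul1r exprn_ge0 // ltW.
  by rewrite mulrAC mul1r; move: Elf Ey0; lra.
have Hpos : 0 < gradsq f y.
  by rewrite -(pmulr_rgt0 _ eta0); apply: lt_le_trans fe; rewrite exprn_gt0.
have [i wi] : exists i, gradsq f y <= 2 * peval (mderiv i f) y ^+ 2.
  rewrite gradsq2; set u := peval _ y ^+ 2; set v := peval _ y ^+ 2.
  by have [uv|uv] := leP u v; [exists ord_max|exists ord0]; rewrite -/u -/v; lra.
set w := peval (mderiv i f) y in wi.
have fw : peval f y < s * `|w|.
  have w2 : 0 < w ^+ 2 by rewrite -(pmulr_rgt0 _ (ltr0n R 2)); exact: lt_le_trans wi.
  have sw : 0 <= s * `|w| by rewrite mulr_ge0 // ltW.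
  rewrite -(@ltr_pXn2r _ 2) ?nnegrE ?(ltW fpos) // exprMn real_normK ?num_real //.
  apply: le_lt_trans fe _; apply: (@le_lt_trans _ _ (s ^+ 2 / 4 * (2 * w ^+ 2))).
    by rewrite ler_pM2l.
  have := mulr_gt0 (exprn_gt0 2 s0) w2; lra.
have fs : peval f y < s.
  have fa : peval f y <= s ^+ 2 / 4 * a.
    have sa : 0 <= s ^+ 2 / 4 * a by rewrite mulr_ge0 // ltW.
    rewrite -(@ler_pXn2r _ 2) ?nnegrE ?(ltW fpos) //; apply: le_trans fe _.
    by rewrite exprMn [X in _ <= X * _]expr2 -[leRHS]mulrA ler_pM2l.
  apply: le_lt_trans fa _; apply: (@le_lt_trans _ _ (s ^+ 2 / 4 * (1 / s))).
    by rewrite ler_pM2l // ltW // (le_lt_trans at_).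
  by rewrite mul1r expr2 mulrAC mulfK ?gt_eqF //; lra.
have [u uP] := faces a y ymax.
have := H (u, i) y uP; rewrite fpos fs /= -/w => /(_ isT fw) hQ.
set z := peval f y in fpos Elf hQ *.
have hH : w ^+ 2 <= 2 * a * z.
  by apply: le_trans (deriv_sq_le_gradsq f y i) _; move: Ey0 Elf; lra.
have hz : z ^+ q <= C ^+ 2 * 2 ^+ Q * a ^+ Q.
  have zQ : 0 < z ^+ (Q + 2) by rewrite exprn_gt0.
  rewrite -(ler_pM2r zQ) -exprD addnCA qQ addnn -mul2n mulnC exprM.
  apply: (@le_trans _ _ ((C * z * `|w| ^+ Q) ^+ 2)).
    by apply: lerXn2r; rewrite ?nnegrE ?exprn_ge0 ?(ltW fpos) // !mulr_ge0 ?exprn_ge0 ?(ltW fpos) ?(ltW C0).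
  rewrite exprMn -exprM mulnC exprM real_normK ?num_real //.
  apply: (@le_trans _ _ ((C * z) ^+ 2 * (2 * a * z) ^+ Q)).
    have Cz : 0 < (C * z) ^+ 2 by rewrite exprn_gt0 // mulr_gt0.
    rewrite ler_pM2l //; apply: lerXn2r => //; rewrite nnegrE ?sqr_ge0 //.
    by rewrite !mulr_ge0 // ltW.
  by rewrite !exprMn exprD le_eqVlt; apply/orP; left; apply/eqP; ring.
have {}hz : z <= C6 * t ^+ Q.
  have p0 : 0 <= C6 * t ^+ Q by rewrite mulr_ge0 ?exprn_ge0 // ltW.
  rewrite -(@ler_pXn2r _ q) ?nnegrE ?(ltW fpos) //; apply: le_trans hz _.
  rewrite exprMn /a -!exprM mulnC ler_pM2r ?exprn_gt0 //.
  apply: (@le_trans _ _ C6); first by rewrite lerDr.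
  by rewrite -[leLHS]expr1 ler_weXn2l.
have Ey1 : 0 <= peval E y by apply: le_trans Ey0; rewrite divr_ge0 // gradsq_ge0.
apply: (@le_trans _ _ (a * z)); first by rewrite lerBlDr lerDl.
apply: (@le_trans _ _ (a * (C6 * t ^+ Q))); first by rewrite ler_pM2l.
by rewrite mulrCA /a -exprD -addnA qQ.
Qed.

(** The Jacobian of [|grad f| ^ 2] and [f] may be 0, for instance if [f] depends on one coordinate
    only; this is what the weight is for. If 1 and both [1 + (x_i - c_i)] fail as weights,
    [jacobian_cancel] makes the gradient vanish identically. The bound [k <= 1 / 2] keeps the
    weights between [1 / 2] and 2. *)
Lemma gradient_plane f d c (k : R) : (1 < d)%N -> mdle d f -> 0 < k -> k <= 1 / 2 ->
  (forall x, 0 <= peval f x) -> peval f c = 0 ->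
  (forall x, `|x - c| <= k -> peval f x ^+ 2 <= gradsq f x) ->
  let Q := (d * (3 * d - 3))%N in
  exists2 c', 0 < c' & forall x a, `|x - c| <= k -> 0 <= a -> a ^+ Q = peval f x ->
    c' * a ^+ Q.-1 ^+ 2 <= gradsq f x.
Proof.
move=> d1 fd k0 k12 f0 fc fH Q.
have Q3 : (3 <= Q)%N by rewrite /Q; move: d1; clear; nia.
have qQ : (Q - 2 + 2 = Q)%N by rewrite subnK // ltnW.
have q1Q : (Q - 2 + 1 = Q.-1)%N by move: Q3; clear; lia.
pose L (i : 'I_2) : mpoly 2 R := 1 + (mpolyX R (mnm1 i) - mpolyC 2 (c 0 i)).
have LE i x : peval (L i) x = 1 + (x 0 i - c 0 i).
  by rewrite /peval mevalD meval1 mevalB mevalXU mevalC.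
have use (l : mpoly 2 R) : mdle 1 l -> (forall x, `|x - c| <= k -> 1 / 2 <= peval l x <= 2) ->
    jacobian (l * gradsq_poly f) f != 0 -> exists2 c', 0 < c' & forall x a, `|x - c| <= k -> 0 <= a ->
    a ^+ Q = peval f x -> c' * a ^+ Q.-1 ^+ 2 <= gradsq f x.
  move=> l1 lb J0.
  have lb1 x : `|x - c| <= k -> 1 / 2 <= peval l x by move=> /lb/andP[].
  have [C [t0 [C0 t00 H]]] := valley_plane d1 fd l1 k0 f0 fc fH lb1 J0.
  have := @valley_gradient R 2 f (peval (l * gradsq_poly f)) c k C 2 t0 (Q - 2)%N C0 (ltr0n R 2) t00.
  rewrite qQ q1Q; apply; last exact: H.
  move=> x /lb/andP[_ l2]; rewrite pevalM peval_gradsq.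
  by rewrite ler_wpM2r // gradsq_ge0.
have Lb i x : `|x - c| <= k -> 1 / 2 <= peval (L i) x <= 2.
  move=> xk; rewrite LE; have := le_trans (rvnorm_coord (x - c) i) xk; rewrite !mxE ler_norml.
  by move=> /andP[h1 h2]; apply/andP; split; move: h1 h2 k12; lra.
have L1 i : mdle 1 (L i).
  apply: mdleD; first exact: mdle1.
  by apply: mdleB; [apply: mdle_mon; rewrite mdeg1|exact: mdleC].
have [J1|J1] := eqVneq (jacobian (1 * gradsq_poly f) f) 0; last first.
  apply: (use 1) => //; first exact: mdle1.
  by move=> x _; rewrite /peval meval1; lra.
have [J2|J2] := eqVneq (jacobian (L ord0 * gradsq_poly f) f) 0; last exact: (use _ (L1 _) (Lb _) J2).
have [J3|J3] := eqVneq (jacobian (L ord_max * gradsq_poly f) f) 0; last exact: (use _ (L1 _) (Lb _) J3).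
exists 1 => // x a xk a0 aQ.
have dL i j : peval (mderiv j (L i)) x = (i == j)%:R.
  rewrite /L mderivD mderivB -mpolyC1 !mderivC add0r subr0 mderivX mnm1E /peval mevalZ.
  case: eqP => [->|_]; last by rewrite mul0r.
  have -> : mnm_sub (mnm1 j) (mnm1 j) = mnm0 by apply/mnmP => m; rewrite mnmBE mnm0E subnn.
  by rewrite mpolyX0 meval1 mulr1.
have H0 : gradsq f x = 0.
  move: J1 J2 J3; rewrite mul1r => /(congr1 (fun q => peval q x)) J1 /(congr1 (fun q => peval q x)) J2 /(congr1 (fun q => peval q x)) J3.
  move: J1 J2 J3; rewrite /jacobian !pevalB !peval0 !pevalM !mderivM !pevalD !pevalM.
  rewrite !dL !peval_gradsq !LE !eqxx; have := gradsq2 f x.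
  have -> : (ord0 == ord_max :> 'I_2) = false by [].
  have -> : (ord_max == ord0 :> 'I_2) = false by [].
  exact: jacobian_cancel.
have fx : peval f x = 0.
  by apply/eqP; rewrite -sqrf_eq0 eq_le sqr_ge0 andbT; have := fH x xk; rewrite H0.
have -> : a = 0 by move: aQ; rewrite fx => /eqP; rewrite expf_eq0 => /andP[_ /eqP].
rewrite expr0n; have -> : (Q.-1 == 0%N) = false by move: Q3; clear; case: (Q) => [|[|]].
by rewrite expr0n mulr0 gradsq_ge0.
Qed.

End plane_valley.

(** * Bounds on boxes and on the whole space *)

(** From the base case of three variables on, each further variable costs a factor [2 * (d - 1)] on
    the left and gains [3 * (d - 1)] on the right. *)
Lemma exponent_arith (d n : nat) : (3 < d)%N ->
  ((d.-1 * 2) ^ n.+3 + 2 <= d * (3 * d - 3) ^ n.+2)%N.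
Proof.
case: d => // u u3; rewrite [u.+1.-1]/=; have -> : (3 * u.+1 - 3 = 3 * u)%N by lia.
elim: n => [|n IH]; first by rewrite !expnS expn0 !muln1; nia.
rewrite expnS [X in (_ <= _ * X)%N]expnS.
move: IH; set a := (_ ^ n.+3)%N; set b := (_ ^ n.+2)%N => IH.
apply: (@leq_trans ((u * 2) * (a + 2))); first by nia.
apply: (@leq_trans ((u * 2) * (u.+1 * b))); first by rewrite leq_mul2l IH orbT.
by nia.
Qed.

Section local.
Context {R : realType}.

Lemma gradient_general n (f : mpoly n R) d c (k : R) : (0 < n)%N -> (1 < d)%N -> mdle d f -> 0 < k ->
  (forall x, 0 <= peval f x) -> peval f c = 0 ->
  (forall x, `|x - c| <= k -> peval f x ^+ 2 <= gradsq f x) ->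
  let Q := ((d.-1 * 2) ^ n)%N in
  exists2 c', 0 < c' & forall x a, `|x - c| <= k -> 0 <= a -> a ^+ (Q + 2) = peval f x ->
    c' * a ^+ (Q + 1) ^+ 2 <= gradsq f x.
Proof.
move=> n0 d1 fd k0 f0 fc fH Q.
have [C [t0 [C0 t00 H]]] := valley_general n0 d1 fd k0 f0 fc fH.
apply: (valley_gradient C0 ltr01 t00 _ H) => x _; by rewrite mul1r.
Qed.

(** The order of vanishing at [p] is at most the degree, and [rho <= |x - p|] because the zero [p]
    lies outside the ball. *)
Lemma local_line (f : mpoly 1 R) d (p : 'rV[R]_1) : mdle d f -> peval f p = 0 ->
  (forall x, 0 <= peval f x) ->
  exists C k, [/\ 0 < C, 0 < k & forall x rho, `|x - p| < k -> 0 < rho -> rho <= 1 ->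
    (forall y, `|y - x| <= rho -> peval f y != 0) -> rho ^+ d <= C * peval f x].
Proof.
move=> fd fp f0; pose u0 : {poly R} := \sum_(m <- msupp f) mcoeff m f *: 'X^(m ord0).
have u0E x : peval f x = u0.[x 0 0].
  rewrite /peval mevalE /u0 horner_sum; apply: eq_bigr => m _.
  by rewrite hornerZ hornerXn big_ord1.
have u0s : (size u0 <= d.+1)%N.
  apply: leq_trans (size_sum _ _ _) _; apply/bigmax_leqP_seq => m mf _.
  apply: leq_trans (size_scale_leq _ _) _; rewrite size_polyXn ltnS.
  by apply: leq_trans (fd m mf); rewrite mdegE big_ord1.
pose u := u0 \Po ('X + (p 0 0)%:P).
have uE x : peval f x = u.[x 0 0 - p 0 0] by rewrite u0E horner_comp hornerD hornerX hornerC subrK.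
have us : (size u <= d.+1)%N by rewrite /u size_comp_poly2 // size_XaddC.
have [u_0|u_n0] := eqVneq u 0.
  exists 1, 1; split=> // x rho _ r0 _ /(_ x); rewrite subrr normr0 => /(_ (ltW r0)).
  by rewrite uE u_0 horner0 eqxx.
have [v [c [s0 [vu c0 s00 H]]]] := poly_lower_near0 u_n0.
exists c^-1, s0; split; rewrite ?invr_gt0 // => x rho xp r0 r1 nz.
have norm1 (y : 'rV[R]_1) : `|y| = `|y 0 0|.
  apply/eqP; rewrite eq_le rvnorm_coord andbT; apply: rvnorm_le => // i; by rewrite ord1.
have xpE : `|x - p| = `|x 0 0 - p 0 0| by rewrite norm1 !mxE.
have rx : rho <= `|x - p|.
  by rewrite leNgt; apply/negP => h; have := nz p; rewrite distrC (ltW h) fp eqxx => /(_ isT).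
have := H (x 0 0 - p 0 0); rewrite -xpE -uE => /(_ xp); rewrite (ger0_norm (f0 x)) => h.
rewrite mulrC ler_pdivlMr // mulrC; apply: le_trans h; rewrite ler_pM2l //.
apply: (@le_trans _ _ (rho ^+ v)).
  apply: ler_wiXn2l => //; [exact: ltW|by rewrite -ltnS; apply: leq_trans us].
by apply: lerXn2r; rewrite ?nnegrE // ltW.
Qed.

(** Scaling the radius by [k / 2] keeps the ball around [x] within distance [k] of [p], at the cost
    of the constant [(k / 2) ^ m]; the exponent may be raised to [al] since [rho <= 1]. *)
Lemma local_of_gradient n (f : mpoly n R) (p : 'rV[R]_n) (k c' : R) (m al : nat) :
  0 < k -> k <= 1 -> (0 < m)%N -> (m <= al)%N -> (forall x, 0 <= peval f x) -> 0 < c' ->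
  (forall x a, `|x - p| <= k -> 0 <= a -> a ^+ m = peval f x -> c' * a ^+ m.-1 ^+ 2 <= gradsq f x) ->
  exists C k, [/\ 0 < C, 0 < k & forall x rho, `|x - p| < k -> 0 < rho -> rho <= 1 ->
    (forall y, `|y - x| <= rho -> peval f y != 0) -> rho ^+ al <= C * peval f x].
Proof.
move=> k0 k1 m0 mal f0 c'0 H.
have [C C0 HC] := ekeland_bound m0 c'0 f0 H.
have k20 : 0 < k / 2 by rewrite divr_gt0.
have P0 : 0 < (k / 2) ^+ m by rewrite exprn_gt0.
exists (C / (k / 2) ^+ m), (k / 2); split; rewrite ?divr_gt0 // => x rho xp r0 r1 nz.
have r1' : 0 < rho * (k / 2) by rewrite mulr_gt0.
have rk : rho * (k / 2) <= k / 2 by rewrite ler_piMl // ltW.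
have rr : rho * (k / 2) <= rho by rewrite ler_piMr ?(ltW r0) //; lra.
apply: (@le_trans _ _ (rho ^+ m)); first by apply: ler_wiXn2l; rewrite // ltW.
rewrite mulrAC ler_pdivlMr // -exprMn; apply: HC => // y yx; split; last first.
  by apply: nz; apply: le_trans yx rr.
have -> : y - p = (y - x) + (x - p) by rewrite addrA subrK.
by apply: le_trans (ler_normD _ _) _; move: yx xp rk; lra.
Qed.

Lemma local_bound n (f : mpoly n R) d p : (0 < n)%N -> (3 < d)%N -> mdle d f ->
  (forall x, 0 <= peval f x) ->
  exists C k, [/\ 0 < C, 0 < k & forall x rho, `|x - p| < k -> 0 < rho -> rho <= 1 ->
    (forall y, `|y - x| <= rho -> peval f y != 0) ->
    rho ^+ (d * (3 * d - 3) ^ n.-1) <= C * peval f x].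
Proof.
move=> n0 d3 fd f0; have d1 : (1 < d)%N by apply: leq_trans d3.
have [fp|fp] := eqVneq (peval f p) 0; last first.
  have fp0 : 0 < peval f p by rewrite lt_neqAle eq_sym fp f0.
  have : \forall x \near p, peval f p / 2 < peval f x.
    have Hc : peval f x @[x --> p] --> peval f p by exact: peval_continuous.
    by apply: (cvgr_gt _ Hc); rewrite ltr_pdivrMr // ltr_pMr // ltr1n.
  move=> /nbhs_ballP[e /= e0 He]; exists (2 / peval f p), e; split; rewrite ?divr_gt0 //.
  move=> x rho xp r0 r1 _; apply: (@le_trans _ _ 1); first by rewrite exprn_ile1 // ltW.
  have := He x; rewrite mx_norm_ball /ball_ /= distrC => /(_ xp)/ltW h.
  by rewrite mulrAC ler_pdivlMr // mul1r mulrC -ler_pdivrMr.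
have [k0 k00 Hk0] := grad_dominates ltr01 f0 fp.
pose k := Num.min k0 (1 / 2).
have k_gt0 : 0 < k by rewrite lt_min k00 divr_gt0.
have k12 : k <= 1 / 2 by rewrite ge_min lexx orbT.
have k1 : k <= 1 by apply: le_trans k12 _; rewrite ler_pdivrMr // mul1r ler1n.
have fH x : `|x - p| <= k -> peval f x ^+ 2 <= gradsq f x.
  by rewrite le_min => /andP[/Hk0 + _]; rewrite mul1r.
case: n f p n0 fd f0 fp Hk0 fH => // -[|[|n]] f p _ fd f0 fp _ fH.
- rewrite expn0 muln1; exact: local_line.
- have [c' c'0 Hc'] := gradient_plane d1 fd k_gt0 k12 f0 fp fH.
  by rewrite expn1; apply: (local_of_gradient k_gt0 k1 _ (leqnn _) f0 c'0 Hc'); move: d1; clear; nia.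
- have [c' c'0 Hc'] := gradient_general (isT : (0 < n.+3)%N) d1 fd k_gt0 f0 fp fH.
  apply: (@local_of_gradient _ _ _ k c' ((d.-1 * 2) ^ n.+3 + 2) _ k_gt0 k1 _ _ f0 c'0).
  + by rewrite addn2.
  + exact: exponent_arith.
  + by move=> x a xk a0 ax; have := Hc' x a xk a0 ax; rewrite addn1 addn2.
Qed.

Lemma box_bound n (f : mpoly n R) d (r : R) : (0 < n)%N -> (3 < d)%N -> mdle d f ->
  (forall x, 0 <= peval f x) ->
  exists2 C, 0 < C & forall x rho, `|x| <= r -> 0 < rho -> rho <= 1 ->
    (forall y, `|y - x| <= rho -> peval f y != 0) ->
    rho ^+ (d * (3 * d - 3) ^ n.-1) <= C * peval f x.
Proof.
move=> n0 d3 fd f0; pose al := (d * (3 * d - 3) ^ n.-1)%N.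
pose P (C : R) (x : 'rV[R]_n) := 0 < C /\ forall rho, 0 < rho -> rho <= 1 ->
    (forall y, `|y - x| <= rho -> peval f y != 0) -> rho ^+ al <= C * peval f x.
(* Compactness makes the local constants uniform, the constant itself being the parameter that tends
   to infinity. *)
have := @closed_box_compact R n 0 r; rewrite compact_near_coveringP => /(_ R (pinfty_nbhs R) P _).
case.
  move=> p _; have [C [k [C0 k0 H]]] := local_bound p n0 d3 fd f0.
  exists (ball p k, [set t | C < t]); first by split; [exact: nbhsx_ballx|exists C; split; rewrite ?num_real].
  move=> [x t] /= [px Ct]; split; first exact: lt_trans Ct.
  move=> rho r0 r1 nz; apply: le_trans (H x rho _ r0 r1 nz) _.
    by move: px; rewrite mx_norm_ball /ball_ /= distrC.
  by rewrite ler_wpM2r // ltW.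
move=> C0 [_ HC]; exists (Num.max 1 (C0 + 1)); first by rewrite lt_max ltr01.
have /HC{HC} HC : C0 < Num.max 1 (C0 + 1) by rewrite lt_max ltrDl ltr01 orbT.
move=> x rho xr; have := HC x; rewrite /= subr0 => /(_ xr)[_]; exact.
Qed.

End local.

(** * Affine charts and the bound on the whole space *)

Section chart.
Context {R : realType} {n : nat}.
Implicit Types (h : mpoly n R) (x y : 'rV[R]_n) (j : 'I_n).

(* The affine chart [x_j <> 0] of projective space; [chart j] is an involution. *)
Definition chart j y : 'rV[R]_n := \row_i ((if i == j then 1 else y 0 i) / y 0 j).

(** Homogenize to degree [d] and set the [j]-th variable to 1; the homogenizing variable takes its
    place. *)
Definition chart_mon (d : nat) j (m : multinom n) : multinom n :=
  Multinom [tuple if i == j then (d - mdeg m)%N else m i | i < n].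

Definition chart_poly (d : nat) j h : mpoly n R :=
  \sum_(m <- msupp h) mcoeff m h *: mpolyX R (chart_mon d j m).

Lemma chart_monE d j m i : chart_mon d j m i = if i == j then (d - mdeg m)%N else m i.
Proof. by rewrite multinomE tnth_mktuple. Qed.

Lemma mdle_chart d j h : mdle d h -> mdle d (chart_poly d j h).
Proof.
move=> hd; rewrite /chart_poly big_seq_cond; apply: mdle_sum => m /andP[mh _]; apply: mdleZ; apply: mdle_mon.
have md := hd m mh; rewrite mdegE (bigD1 j) //= chart_monE eqxx.
have : (\sum_(i < n | i != j) chart_mon d j m i <= mdeg m)%N.
  rewrite mdegE [X in (_ <= X)%N](bigD1 j) //=; apply: leq_trans (leq_addl _ _).
  by apply: leq_sum => i ij; rewrite chart_monE (negPf ij).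
move: md; set S := (\sum_(i < n | i != j) _)%N; set e := mdeg m; clearbody S e; clear; lia.
Qed.

Lemma chartK j x : x 0 j != 0 -> chart j (chart j x) = x.
Proof.
move=> xj; apply/rowP => i; rewrite !mxE eqxx; case: eqP => [->|_].
  by rewrite !div1r invrK.
by rewrite div1r invrK divfK.
Qed.

Lemma peval_chart d j h y : mdle d h -> y 0 j != 0 ->
  peval (chart_poly d j h) y = y 0 j ^+ d * peval h (chart j y).
Proof.
move=> hd yj; rewrite /chart_poly /peval raddf_sum mevalE mulr_sumr big_seq [RHS]big_seq /=.
apply: eq_bigr => m mh; rewrite mevalZ mevalX mulrCA; congr (_ * _).
have md := hd m mh; rewrite (bigD1 j) //= chart_monE eqxx.
rewrite (eq_bigr (fun i => y 0 i ^+ m i)) => [|i ij]; last by rewrite chart_monE (negPf ij).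
have -> : \prod_i chart j y 0 i ^+ m i = (\prod_(i < n | i != j) y 0 i ^+ m i) / y 0 j ^+ mdeg m.
  apply: (mulIf (_ : y 0 j ^+ mdeg m != 0)); first by rewrite expf_neq0.
  rewrite divfK ?expf_neq0 // mdegE -prodrXr -big_split /= (bigD1 j) //=.
  rewrite mxE eqxx -exprMn divfK // expr1n mul1r; apply: eq_bigr => i ij.
  by rewrite mxE (negPf ij) -exprMn divfK.
rewrite mulrA; set A := \prod_(i < n | _) _; rewrite [y 0 j ^+ d * A]mulrC -mulrA mulrC; congr (_ * _).
by rewrite -[in RHS](subnK md) exprD mulfK // expf_neq0.
Qed.

Definition sumsq (hs : seq (mpoly n R)) x : R := \sum_(h <- hs) peval h x ^+ 2.

Lemma sumsq_ge0 hs x : 0 <= sumsq hs x.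
Proof. by apply: sumr_ge0 => h _; exact: sqr_ge0. Qed.

Definition sumsq_poly (hs : seq (mpoly n R)) : mpoly n R := \sum_(h <- hs) h ^+ 2.

Lemma peval_sumsq hs x : peval (sumsq_poly hs) x = sumsq hs x.
Proof. by rewrite /peval raddf_sum /=; apply: eq_bigr => i _; rewrite rmorphXn. Qed.

Lemma mdle_sumsq d hs : (forall h, h \in hs -> mdle d h) -> mdle (d * 2) (sumsq_poly hs).
Proof.
move=> hd; rewrite /sumsq_poly big_seq_cond; apply: mdle_sum => h /andP[hh _].
by apply: mdleX; exact: hd.
Qed.

Lemma sumsq_chart d j hs y : (forall h, h \in hs -> mdle d h) -> y 0 j != 0 ->
  sumsq [seq chart_poly d j h | h <- hs] y = y 0 j ^+ (d * 2) * sumsq hs (chart j y).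
Proof.
move=> hd yj; rewrite /sumsq big_map mulr_sumr big_seq [RHS]big_seq; apply: eq_bigr => h hh.
by rewrite peval_chart ?exprMn -?exprM //; exact: hd.
Qed.

(** The chart is taken at the largest coordinate, so [|y_j| = 1 / |x|] and [|y_i| <= 1]; inversion
    then expands distances near [y] by a factor of order [|x| ^ 2], whence the radius. The bound on
    [delta] keeps [y'_j] away from 0. *)
Lemma chart_near j (x y' : 'rV[R]_n) (delta : R) : 1 <= `|x| -> `|x 0 j| = `|x| ->
  0 < delta -> delta <= 1 + `|x| -> `|y' - chart j x| <= delta / (8 * `|x| ^+ 2) ->
  y' 0 j != 0 /\ `|chart j y' - x| < delta.
Proof.
move=> x1 xj d0 dx yy; set Nx := `|x| in x1 xj dx yy *; set rho := delta / _ in yy.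
have N0 : 0 < Nx by apply: lt_le_trans x1.
have xj0 : x 0 j != 0 by rewrite -normr_gt0 xj.
have rN2 : rho * Nx ^+ 2 = delta / 8 by rewrite /rho invfM [delta * _]mulrA divfK // expf_neq0 // gt_eqF.
have r0 : 0 < rho by rewrite divr_gt0 // mulr_gt0 // exprn_gt0.
have rN : rho * Nx <= 1 / 4.
  rewrite -(ler_pM2r N0) -mulrA -expr2 rN2; move: dx x1; lra.
have rN' : rho * Nx <= delta / 8 by rewrite -rN2 ler_pM2l // expr2 ler_peMr // ltW.
set y := chart j x in yy *.
have yE i : y 0 i = (if i == j then 1 else x 0 i) / x 0 j by rewrite /y mxE.
have yyi i : `|y' 0 i - y 0 i| <= rho.
  by have := le_trans (rvnorm_coord (y' - y) i) yy; rewrite !mxE.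
have yj : `|y 0 j| = Nx^-1 by rewrite yE eqxx div1r normfV xj.
have y'j : 3 / 4 / Nx <= `|y' 0 j|.
  have h := ler_normB (y' 0 j - y 0 j) (y' 0 j); rewrite addrAC subrr add0r normrN yj in h.
  have : rho <= 1 / 4 / Nx by rewrite ler_pdivlMr.
  have := yyi j; move: h; rewrite -![_ / 4 / Nx]mulrA; set u := Nx^-1; lra.
have y'0 : 0 < `|y' 0 j| by apply: lt_le_trans y'j; rewrite !divr_gt0.
have y'n0 : y' 0 j != 0 by rewrite -normr_gt0.
have yn0 : y 0 j != 0 by rewrite -normr_gt0 yj invr_gt0.
split=> //.
have inv_bound : `|y' 0 j|^-1 <= 4 / 3 * Nx.
  rewrite -[leRHS]invrK lef_pV2 ?posrE // ?invr_gt0 ?mulr_gt0 ?divr_gt0 //.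
  by rewrite invfM invf_div.
have invd : `|(y' 0 j)^-1 - (y 0 j)^-1| <= 4 / 3 * (delta / 8).
  have -> : (y' 0 j)^-1 - (y 0 j)^-1 = (y 0 j - y' 0 j) * (y' 0 j)^-1 * (y 0 j)^-1.
    by field; rewrite y'n0 yn0.
  rewrite !normrM !normfV yj invrK distrC -rN2.
  apply: (@le_trans _ _ (rho * (4 / 3 * Nx) * Nx)); last by rewrite le_eqVlt; apply/orP; left; apply/eqP; ring.
  by rewrite ler_pM2r // ler_pM ?invr_ge0.
have xE i : x 0 i = (if i == j then 1 else y 0 i) / y 0 j by rewrite -[in LHS](chartK xj0) mxE.
apply: (@le_lt_trans _ _ (delta / 3)); last by move: d0; lra.
apply: rvnorm_le => [|i]; first by rewrite divr_ge0 // ltW.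
rewrite mxE [(- x) 0 i]mxE xE mxE; case: eqP => [_|/eqP ij].
  by rewrite !div1r (le_trans invd) //; move: d0; lra.
have yi1 : `|y 0 i| <= 1.
  by rewrite yE (negPf ij) normrM normfV xj ler_pdivrMr // mul1r rvnorm_coord.
have -> : y' 0 i / y' 0 j - y 0 i / y 0 j =
    (y' 0 i - y 0 i) / y' 0 j + y 0 i * ((y' 0 j)^-1 - (y 0 j)^-1) by ring.
apply: le_trans (ler_normD _ _) _; rewrite !normrM normfV.
have h1 : `|y' 0 i - y 0 i| / `|y' 0 j| <= rho * (4 / 3 * Nx) by rewrite ler_pM ?invr_ge0.
have h2 : `|y 0 i| * `|(y' 0 j)^-1 - (y 0 j)^-1| <= 1 * (4 / 3 * (delta / 8)) by rewrite ler_pM.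
by move: h1 h2 rN' d0; lra.
Qed.

(** Points with [|x| <= 1] lie in the unit box already; the others enter it through the chart of
    their largest coordinate. This divides [f] by [|x| ^ (2 * d)], the source of the factor in
    front, and the radius by a multiple of [|x| ^ 2]. *)
Lemma global_bound d (hs : seq (mpoly n R)) : (1 < d)%N -> (forall h, h \in hs -> mdle d h) ->
  let al := (d * 2 * (3 * (d * 2) - 3) ^ n.-1)%N in
  exists2 c, 0 < c & forall x delta, 0 < delta -> delta <= 1 + `|x| ->
    (forall y, `|y - x| < delta -> sumsq hs y != 0) ->
    c * (1 + `|x|) ^+ (d * 2) * (delta / (1 + `|x| ^+ 2)) ^+ al <= sumsq hs x.
Proof.
move=> d1 hd al; have d4 : (3 < d * 2)%N by move: d1; clear; lia.
(* Without variables there is no chart; the only point is 0, and [delta <= 1]. *)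
have [n0|n0] := posnP n.
  have all0 (x : 'rV[R]_n) : x = 0 by apply/rowP => i; exfalso; move: (ltn_ord i); rewrite {2}n0.
  have [s0|s0] := eqVneq (sumsq hs 0) 0.
    by exists 1 => // x dl dl0 _ /(_ 0); rewrite [x]all0 subrr normr0 s0 eqxx => /(_ dl0).
  exists (sumsq hs 0) => [|x dl dl0 dx _]; first by rewrite lt_neqAle eq_sym s0 sumsq_ge0.
  rewrite [x]all0 normr0 expr0n addr0 expr1n mulr1 divr1 ler_piMr ?sumsq_ge0 // exprn_ile1 ?(ltW dl0) //.
  by move: dx; rewrite [x]all0 normr0 addr0.
have Fd j : mdle (d * 2) (sumsq_poly [seq chart_poly d j h | h <- hs]).
  by apply: mdle_sumsq => h' /mapP[h hh ->]; apply: mdle_chart; exact: hd.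
have F0 (gs : seq (mpoly n R)) x : 0 <= peval (sumsq_poly gs) x by rewrite peval_sumsq sumsq_ge0.
have [C1 C10 H1] := box_bound 1 n0 d4 (mdle_sumsq hd) (F0 hs).
have /choice[C2 HC2] : forall j, exists C, 0 < C /\ forall x rho, `|x| <= 1 -> 0 < rho -> rho <= 1 ->
    (forall y, `|y - x| <= rho -> sumsq [seq chart_poly d j h | h <- hs] y != 0) ->
    rho ^+ al <= C * sumsq [seq chart_poly d j h | h <- hs] x.
  move=> j; have [C C0 H] := box_bound 1 n0 d4 (Fd j) (F0 _); exists C; split=> // x rho x1 r0 r1 nz.
  by rewrite -peval_sumsq; apply: H => // y /nz; rewrite -peval_sumsq.
pose C := C1 + \sum_j C2 j.
have C_gt0 : 0 < C by rewrite ltr_pwDl // sumr_ge0 // => j _; rewrite ltW //; case: (HC2 j).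
have C1C : C1 <= C by rewrite lerDl sumr_ge0 // => j _; rewrite ltW //; case: (HC2 j).
have C2C j : C2 j <= C.
  rewrite /C (bigD1 j) //= addrCA lerDl addr_ge0 ?(ltW C10) // sumr_ge0 // => i _.
  by rewrite ltW //; case: (HC2 i).
pose c := (2 ^+ (d * 2) * 8 ^+ al * C)^-1.
have c0 : 0 < c by rewrite invr_gt0 !mulr_gt0 // exprn_gt0.
have P2 : 0 < 2 ^+ (d * 2) :> R by rewrite exprn_gt0.
have P8 : 0 < 8 ^+ al :> R by rewrite exprn_gt0.
exists c => // x dl dl0 dx nz.
have den : 0 < 1 + `|x| ^+ 2 by rewrite ltr_wpDr // exprn_ge0.
have base0 : 0 <= dl / (1 + `|x| ^+ 2) by rewrite divr_ge0 // ltW.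
rewrite /c -mulrA mulrC ler_pdivrMr ?mulr_gt0 //.
have [x1|x1] := leP `|x| 1.
  have r0 : 0 < dl / 8 by rewrite divr_gt0.
  have := H1 x (dl / 8) x1 r0; rewrite !peval_sumsq => /(_ _ _)h.
  have {}h : (dl / 8) ^+ al <= C1 * sumsq hs x.
    apply: h => [|y yx]; first by move: dx x1; lra.
    by rewrite peval_sumsq nz // (le_lt_trans yx) //; move: dl0; lra.
  have h2 : (1 + `|x|) ^+ (d * 2) <= 2 ^+ (d * 2).
    by apply: lerXn2r; rewrite ?nnegrE ?addr_ge0 //; move: x1; lra.
  have h3 : (dl / (1 + `|x| ^+ 2)) ^+ al <= dl ^+ al.
    apply: lerXn2r; rewrite ?nnegrE ?(ltW dl0) // ler_pdivrMr // ler_peMr ?(ltW dl0) //.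
    by rewrite lerDl exprn_ge0.
  have h4 : dl ^+ al <= 8 ^+ al * (C * sumsq hs x).
    rewrite expr_div_n ler_pdivrMr // in h; apply: le_trans h _; rewrite mulrC ler_pM2l //.
    by rewrite ler_wpM2r // sumsq_ge0.
  apply: (@le_trans _ _ (2 ^+ (d * 2) * (8 ^+ al * (C * sumsq hs x)))); last first.
    by rewrite le_eqVlt; apply/orP; left; apply/eqP; ring.
  apply: ler_pM => //; rewrite ?exprn_ge0 ?addr_ge0 //; exact: le_trans h4.
have N0 : 0 < `|x| by apply: lt_trans x1.
have [j xj] : exists j, `|x 0 j| = `|x|.
  apply: contrapT => nj; suff : `|x| < `|x| by rewrite ltxx.
  apply: rvnorm_lt => // j; rewrite lt_neqAle rvnorm_coord andbT; apply/eqP => h.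
  by apply: nj; exists j.
have xj0 : x 0 j != 0 by rewrite -normr_gt0 xj.
pose y := chart j x; pose rho := dl / (8 * `|x| ^+ 2).
have r0 : 0 < rho by rewrite divr_gt0 // mulr_gt0 // exprn_gt0.
have r1 : rho <= 1.
  have N2 : `|x| <= `|x| ^+ 2 by rewrite expr2 ler_peMr ?ltW.
  by rewrite ler_pdivrMr ?mulr_gt0 ?exprn_gt0 //; move: dx x1 N2; lra.
have yj0 : y 0 j != 0 by rewrite /y mxE eqxx div1r invr_neq0.
have y1 : `|y| <= 1.
  apply: rvnorm_le => // i; rewrite /y mxE; case: eqP => _; rewrite normrM normfV xj ler_pdivrMr // mul1r.
    by rewrite normr1 ltW.
  exact: rvnorm_coord.
have [_ /(_ y rho y1 r0 r1)] := HC2 j.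
have nz' y' : `|y' - y| <= rho -> sumsq [seq chart_poly d j h | h <- hs] y' != 0.
  move=> yy; have [y'j near] := chart_near (ltW x1) xj dl0 dx yy.
  by rewrite sumsq_chart // mulf_neq0 ?expf_neq0 // nz.
move=> /(_ nz'); rewrite sumsq_chart // chartK // => h.
have yjE : (y 0 j) ^+ (d * 2) = (`|x| ^+ (d * 2))^-1.
  by rewrite mulnC !exprM /y mxE eqxx div1r exprVn -[x 0 j ^+ 2]real_normK ?num_real // xj exprVn.
have {}h : rho ^+ al * `|x| ^+ (d * 2) <= C * sumsq hs x.
  have NN : 0 < `|x| ^+ (d * 2) by rewrite exprn_gt0.
  rewrite -ler_pdivlMr //; apply: le_trans h _; rewrite yjE mulrCA mulrC.
  by rewrite ler_pM2r ?invr_gt0 // ler_wpM2r // sumsq_ge0.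
have h2 : (1 + `|x|) ^+ (d * 2) <= 2 ^+ (d * 2) * `|x| ^+ (d * 2).
  by rewrite -exprMn; apply: lerXn2r; rewrite ?nnegrE ?mulr_ge0 ?addr_ge0 //; move: x1; lra.
have h3 : (dl / (1 + `|x| ^+ 2)) ^+ al <= 8 ^+ al * rho ^+ al.
  have rr : 0 <= 8 * rho by apply: mulr_ge0 => //; exact: ltW.
  rewrite -exprMn; apply: lerXn2r; rewrite ?nnegrE //.
  have -> : 8 * rho = dl / `|x| ^+ 2 by rewrite /rho invfM mulrCA [8 * _]mulrA divff ?pnatr_eq0 // mul1r.
  by rewrite ler_pM2l // lef_pV2 ?posrE ?exprn_gt0 // lerDr.
apply: (@le_trans _ _ ((2 ^+ (d * 2) * `|x| ^+ (d * 2)) * (8 ^+ al * rho ^+ al))).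
  by apply: ler_pM; rewrite ?exprn_ge0 ?addr_ge0.
have -> : 2 ^+ (d * 2) * `|x| ^+ (d * 2) * (8 ^+ al * rho ^+ al) =
   2 ^+ (d * 2) * 8 ^+ al * (rho ^+ al * `|x| ^+ (d * 2)) by ring.
rewrite [leRHS]mulrC -[leRHS]mulrA ler_pM2l ?mulr_gt0 //.
Qed.

End chart.

Section growth.
Context {R : realType}.

Lemma monv_bound n (x : 'rV[R]_n) (m : multinom n) : `|monv x m| <= (1 + `|x|) ^+ mdeg m.
Proof.
rewrite /monv normr_prod mdegE -prodrXr; apply: ler_prod => i _; rewrite normr_ge0 normrX /=.
apply: lerXn2r; rewrite ?nnegrE ?addr_ge0 //.
by apply: le_trans (rvnorm_coord x i) _; rewrite lerDr.
Qed.

Lemma peval_monv n (p : mpoly n R) x : peval p x = \sum_(m <- msupp p) mcoeff m p * monv x m.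
Proof. by rewrite /peval mevalE. Qed.

Lemma peval_growth n (p : mpoly n R) d : mdle d p ->
  exists2 C, 0 < C & forall x, `|peval p x| <= C * (1 + `|x|) ^+ d.
Proof.
move=> pd; exists (1 + \sum_(m <- msupp p) `|mcoeff m p|).
  by rewrite ltr_wpDr // sumr_ge0.
move=> x; rewrite peval_monv; apply: le_trans (ler_norm_sum _ _ _) _.
rewrite mulrDl ler_wpDl ?mul1r ?exprn_ge0 ?addr_ge0 //.
rewrite mulr_suml big_seq [leRHS]big_seq; apply: ler_sum => m mp.
rewrite normrM ler_wpM2l //; apply: le_trans (monv_bound x m) _.
by apply: ler_weXn2l; [rewrite lerDl|exact: pd].
Qed.

Lemma expr1D_le (t : R) d : 0 <= t -> (1 + t) ^+ d <= 2 ^+ d * (1 + t ^+ d).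
Proof.
move=> t0; have [t1|t1] := leP t 1.
  apply: (@le_trans _ _ (2 ^+ d)).
    by apply: lerXn2r; rewrite ?nnegrE ?addr_ge0 //; move: t1; lra.
  by rewrite ler_peMr ?exprn_ge0 // lerDl exprn_ge0.
apply: (@le_trans _ _ ((2 * t) ^+ d)).
  by apply: lerXn2r; rewrite ?nnegrE ?addr_ge0 ?mulr_ge0 //; move: t1; lra.
by rewrite exprMn ler_wpM2l ?exprn_ge0 // lerDr.
Qed.

End growth.

(** * Systems of equations and inequalities *)

Section slack.
Context {R : realType} {N r : nat}.

Definition mlift (m : multinom N) : multinom (N + r) :=
  Multinom [tuple match fintype.split i with inl a => m a | inr _ => 0%N end | i < N + r].

Lemma mlift_l m a : mlift m (lshift r a) = m a.
Proof. by rewrite multinomE tnth_mktuple (unsplitK (inl a)). Qed.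

Lemma mlift_r m b : mlift m (rshift N b) = 0%N.
Proof. by rewrite multinomE tnth_mktuple (unsplitK (inr b)). Qed.

Definition plift (g : mpoly N R) : mpoly (N + r) R :=
  \sum_(m <- msupp g) mcoeff m g *: mpolyX R (mlift m).

Lemma mdle_plift d g : mdle d g -> mdle d (plift g).
Proof.
move=> gd; rewrite /plift big_seq_cond; apply: mdle_sum => m /andP[mg _]; apply: mdleZ; apply: mdle_mon.
rewrite mdegE big_split_ord /= [X in (_ + X)%N]big1 => [|b _]; last exact: mlift_r.
by rewrite addn0; apply: leq_trans (gd m mg); rewrite mdegE; apply: leq_sum => a _; rewrite mlift_l.
Qed.

Lemma peval_plift g x : peval (plift g) x = peval g (lsubmx x).
Proof.
rewrite [RHS]peval_monv /plift /peval raddf_sum /=; apply: eq_bigr => m _.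
rewrite mevalZ mevalX big_split_ord /= [X in _ * (_ * X)]big1 => [|b _]; last by rewrite mlift_r expr0.
by rewrite mulr1; congr (_ * _); apply: eq_bigr => a _; rewrite mlift_l mxE.
Qed.

Definition slackvar (i : 'I_r) : mpoly (N + r) R := mpolyX R (mnm_muln (mnm1 (rshift N i)) 2).

Lemma peval_slackvar i x : peval (slackvar i) x = x 0 (rshift N i) ^+ 2.
Proof.
rewrite /peval mevalX (bigD1 (rshift N i)) //= big1 => [|j ji]; rewrite mulmnE mnm1E.
  by rewrite eqxx mulr1.
by rewrite eq_sym (negPf ji) mul0n expr0.
Qed.

Lemma mdle_slackvar i d : (1 < d)%N -> mdle d (slackvar i).
Proof. by move=> d1; apply: mdle_mon; rewrite mdegMn mdeg1. Qed.

End slack.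

Section systems.
Context {R : realType}.

Definition sysdeg n d (p : system R n) : Prop :=
  (forall g, g \in p.1 -> mdle d g) /\ (forall h, h \in p.2 -> mdle d h).

(** Equals [sumsq] of [slack_system] when each slack variable is the square root of
    [max (g x) 0]. *)
Definition violation n (p : system R n) (x : 'rV[R]_n) : R :=
  \sum_(h <- p.2) peval h x ^+ 2 + \sum_(g <- p.1) Num.min (peval g x) 0 ^+ 2.

Definition slack_system n (p : system R n) : seq (mpoly (n + size p.1) R) :=
  [seq plift h | h <- p.2] ++
  [seq plift (nth 0 p.1 (i : 'I_(size p.1))) - slackvar i | i <- enum 'I_(size p.1)].

Lemma sumsq_eq0 n (hs : seq (mpoly n R)) x : sumsq hs x = 0 -> forall h, h \in hs -> peval h x = 0.
Proof.
move=> /eqP; rewrite /sumsq psumr_eq0 => [/allP H h /H/=|h _]; last exact: sqr_ge0.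
by rewrite sqrf_eq0 => /eqP.
Qed.

(** Lift [x] to [X = (x, z)] with [z_i ^ 2 = max (g_i x) 0]; zeros of the slack system near [X]
    project to solutions near [x]. As [z_i ^ 2] is at most a multiple of [(1 + |x|) ^ d] and
    [d >= 2], [1 + |X| ^ 2] is at most a multiple of [1 + |x| ^ d]: this is the origin of the
    denominator. *)
Lemma slack_bound n (p : system R n) d : (1 < d)%N -> sysdeg d p ->
  let al := (d * 2 * (3 * (d * 2) - 3) ^ (n + size p.1).-1)%N in
  exists2 c, 0 < c & forall x delta, 0 < delta -> delta <= 1 + `|x| ->
    (forall y, `|y - x| < delta -> ~ basic_closed p y) ->
    c * (1 + `|x|) ^+ (d * 2) * (delta / (1 + `|x| ^+ d)) ^+ al <= violation p x.
Proof.
move=> d1 [pd1 pd2] al; set r := size p.1.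
pose G (i : 'I_r) := nth 0 p.1 i.
have Gd i : mdle d (G i) by apply: pd1; exact: mem_nth.
have hsd h : h \in slack_system p -> mdle d h.
  rewrite mem_cat => /orP[/mapP[h' h'p ->]|/mapP[i _ ->]].
    by apply: mdle_plift; exact: pd2.
  by apply: mdleB; [apply: mdle_plift; exact: Gd|exact: mdle_slackvar].
have [c c0 H] := global_bound d1 hsd.
have /choice[C HC] : forall i : 'I_r, exists C, 0 < C /\ forall x, `|peval (G i) x| <= C * (1 + `|x|) ^+ d.
  by move=> i; have [C C0 h] := peval_growth (Gd i); exists C.
pose S := 1 + \sum_i C i.
have CS i : C i <= S.
  rewrite /S (bigD1 i) //= addrCA lerDl addr_ge0 // sumr_ge0 // => j _; rewrite ltW //; by case: (HC j).
have S1 : 1 <= S by rewrite lerDl sumr_ge0 // => j _; rewrite ltW //; case: (HC j).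
have S0 : 0 <= S := le_trans ler01 S1.
clearbody S; pose K := 1 + S * 2 ^+ d.
have K0 : 0 < K by rewrite ltr_wpDr // mulr_ge0 ?exprn_ge0.
exists (c / K ^+ al) => [|x dl dl0 dx nz]; first by rewrite divr_gt0 // exprn_gt0.
pose z : 'rV[R]_r := \row_i Num.sqrt (Num.max (peval (G i) x) 0).
pose X := row_mx x z.
have zz i : z 0 i ^+ 2 = Num.max (peval (G i) x) 0.
  by rewrite mxE sqr_sqrtr // le_max lexx orbT.
have xX : `|x| <= `|X|.
  apply: rvnorm_le => // i; apply: le_trans (rvnorm_coord X (lshift r i)); by rewrite row_mxEl.
have dpos : 0 < 1 + `|x| ^+ d by rewrite ltr_wpDr // exprn_ge0.
have XK : 1 + `|X| ^+ 2 <= K * (1 + `|x| ^+ d).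
  have x1 : 1 <= 1 + `|x| by rewrite lerDl.
  pose s := S * (1 + `|x|) ^+ d.
  have s0 : 0 <= s by rewrite mulr_ge0 ?exprn_ge0 ?addr_ge0.
  have Xs : `|X| ^+ 2 <= s.
    rewrite -[leRHS]sqr_sqrtr //; apply: lerXn2r; rewrite ?nnegrE ?sqrtr_ge0 //.
    apply: rvnorm_le => [|i]; first exact: sqrtr_ge0.
    rewrite -[leLHS]sqrtr_sqr ler_sqrt // mxE; case: splitP => j _.
      apply: (@le_trans _ _ ((1 + `|x|) ^+ 2)).
        rewrite -[leLHS]real_normK ?num_real //; apply: lerXn2r; rewrite ?nnegrE ?addr_ge0 //.
        by apply: le_trans (rvnorm_coord x j) _; rewrite lerDr.
      apply: (@le_trans _ _ ((1 + `|x|) ^+ d)); first exact: ler_weXn2l.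
      by rewrite ler_peMl ?exprn_ge0 ?addr_ge0.
    have e0 : 0 <= (1 + `|x|) ^+ d by rewrite exprn_ge0 ?addr_ge0.
    rewrite zz ge_max s0 andbT; apply: le_trans (ler_norm _) _.
    by have [_ h] := HC j; apply: le_trans (h x) _; rewrite ler_wpM2r.
  apply: (@le_trans _ _ (1 + S * 2 ^+ d * (1 + `|x| ^+ d))).
    rewrite lerD2l; apply: le_trans Xs _; rewrite /s -mulrA ler_wpM2l //.
    exact: expr1D_le.
  by rewrite /K mulrDl mul1r lerD2r lerDl exprn_ge0.
have viol : sumsq (slack_system p) X = violation p x.
  rewrite /sumsq big_cat /violation 2!big_map big_enum; congr (_ + _).
    by apply: eq_bigr => h _; rewrite peval_plift row_mxKl.
  rewrite [RHS](big_nth 0) big_mkord; apply: eq_bigr => i _.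
  rewrite pevalB peval_plift peval_slackvar row_mxKl row_mxEr zz -/(G i); congr (_ ^+ 2).
  by have [h|h] := leP (peval (G i) x) 0; rewrite ?subr0 ?subrr.
have nzX y : `|y - X| < dl -> sumsq (slack_system p) y != 0.
  move=> yX; apply/eqP => /sumsq_eq0 y0; apply: (nz (lsubmx y)).
    apply: le_lt_trans yX; apply: rvnorm_le => // i; rewrite !mxE.
    by have := rvnorm_coord (y - X) (lshift r i); rewrite mxE [(- X) _ _]mxE row_mxEl.
  split=> [g gp|h hp]; last first.
    by rewrite -peval_plift; apply: y0; rewrite mem_cat; apply/orP; left; apply: map_f.
  have ig : (index g p.1 < r)%N by rewrite index_mem.
  have := y0 (plift (G (Ordinal ig)) - slackvar (Ordinal ig)); rewrite mem_cat.
  rewrite [X in _ || X](map_f (fun i : 'I_r => plift (G i) - slackvar i)) ?mem_enum // orbT => /(_ isT) /eqP.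
  by rewrite pevalB subr_eq0 peval_plift peval_slackvar /G /= nth_index // => /eqP ->; exact: sqr_ge0.
have dX : dl <= 1 + `|X| by apply: le_trans dx _; rewrite lerD2l.
have := H X dl dl0 dX nzX; rewrite viol; apply: le_trans.
have -> (a b k : R) : c / k * a * b = c * (a * (b / k)) by rewrite mulrAC -!mulrA; congr (_ * _); ring.
have X0 : 0 < 1 + `|X| ^+ 2 by rewrite ltr_wpDr // exprn_ge0.
have b0 : 0 <= dl / (1 + `|x| ^+ d) / K by rewrite !divr_ge0 ?(ltW dl0) ?(ltW dpos) ?(ltW K0).
have b1 : 0 <= dl / (1 + `|X| ^+ 2) by rewrite divr_ge0 ?(ltW dl0) ?(ltW X0).
rewrite -expr_div_n -[leRHS]mulrA ler_pM2l //; apply: ler_pM.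
- by rewrite exprn_ge0 ?addr_ge0.
- by rewrite exprn_ge0.
- by apply: lerXn2r; rewrite ?nnegrE ?addr_ge0 // lerD2l.
apply: lerXn2r; rewrite ?nnegrE //.
by rewrite -mulrA ler_pM2l // -invfM lef_pV2 ?posrE ?mulr_gt0 // mulrC.
Qed.

End systems.

(** * Setting the value variables of the graph to zero *)

Section restriction.
Context {R : realType} {N k : nat}.

Definition mleft (m : multinom (N + k)) : multinom N := Multinom [tuple m (lshift k a) | a < N].

Definition mright (m : multinom (N + k)) : multinom k := Multinom [tuple m (rshift N b) | b < k].

Lemma mleftE m a : mleft m a = m (lshift k a).
Proof. by rewrite multinomE tnth_mktuple. Qed.

Lemma mrightE m b : mright m b = m (rshift N b).
Proof. by rewrite multinomE tnth_mktuple. Qed.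

Lemma mdeg_split m : mdeg m = (mdeg (mleft m) + mdeg (mright m))%N.
Proof.
rewrite mdegE big_split_ord /= !mdegE; congr (_ + _)%N; apply: eq_bigr => i _.
  by rewrite mleftE.
by rewrite mrightE.
Qed.

Lemma monv_row (x : 'rV[R]_N) (y : 'rV[R]_k) m :
  monv (row_mx x y) m = monv x (mleft m) * monv y (mright m).
Proof.
rewrite /monv big_split_ord /=; congr (_ * _); apply: eq_bigr => i _.
  by rewrite row_mxEl mleftE.
by rewrite row_mxEr mrightE.
Qed.

(** Given by monomials, so that the discarded ones visibly carry a factor from [y]. *)
Definition prestrict (h : mpoly (N + k) R) : mpoly N R :=
  \sum_(m <- msupp h | mdeg (mright m) == 0%N) mcoeff m h *: mpolyX R (mleft m).

Lemma mdle_prestrict d h : mdle d h -> mdle d (prestrict h).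
Proof.
move=> hd; rewrite /prestrict big_seq_cond; apply: mdle_sum => m /andP[mh _]; apply: mdleZ; apply: mdle_mon.
by apply: leq_trans (hd m mh); rewrite mdeg_split leq_addr.
Qed.

Lemma monv_deg0 n (x : 'rV[R]_n) m : mdeg m = 0%N -> monv x m = 1.
Proof.
move=> /eqP; rewrite mdegE sum_nat_eq0 => /forallP m0; apply: big1 => i _.
by have /eqP := m0 i => ->; rewrite expr0.
Qed.

Lemma monv_norm n (x : 'rV[R]_n) m : `|monv x m| <= `|x| ^+ mdeg m.
Proof.
rewrite /monv normr_prod mdegE -prodrXr; apply: ler_prod => i _; rewrite normr_ge0 normrX /=.
by apply: lerXn2r; rewrite ?nnegrE // rvnorm_coord.
Qed.

Lemma peval_prestrict h (x : 'rV[R]_N) :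
  peval (prestrict h) x = \sum_(m <- msupp h | mdeg (mright m) == 0%N) mcoeff m h * monv x (mleft m).
Proof.
by rewrite /prestrict /peval raddf_sum /=; apply: eq_bigr => m _; rewrite mevalZ mevalX.
Qed.

Lemma prestrict_split h x y : peval h (row_mx x y) = peval (prestrict h) x +
  \sum_(m <- msupp h | mdeg (mright m) != 0%N) mcoeff m h * (monv x (mleft m) * monv y (mright m)).
Proof.
rewrite peval_monv (bigID (fun m => mdeg (mright m) == 0%N)) /= peval_prestrict; congr (_ + _).
  by apply: eq_bigr => m /eqP m0; rewrite monv_row (monv_deg0 _ m0) mulr1.
by apply: eq_bigr => m _; rewrite monv_row.
Qed.

Lemma peval_prestrict0 h x : peval (prestrict h) x = peval h (row_mx x 0).
Proof.
rewrite prestrict_split big1 ?addr0 // => m m0.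
have := monv_norm 0 (mright m); rewrite normr0 expr0n (negPf m0) normr_le0 => /eqP ->.
by rewrite !mulr0.
Qed.

Lemma prestrict_near d h : mdle d h -> exists2 C, 0 < C & forall x y, `|y| <= 1 ->
  `|peval h (row_mx x y) - peval (prestrict h) x| <= C * (`|y| * (1 + `|x|) ^+ d).
Proof.
move=> hd; exists (1 + \sum_(m <- msupp h) `|mcoeff m h|).
  by rewrite ltr_wpDr // sumr_ge0.
move=> x y y1; rewrite prestrict_split addrAC subrr add0r; apply: le_trans (ler_norm_sum _ _ _) _.
have B0 : 0 <= `|y| * (1 + `|x|) ^+ d by rewrite mulr_ge0 // exprn_ge0 // addr_ge0.
rewrite mulrDl ler_wpDl ?mul1r // mulr_suml big_mkcond big_seq [leRHS]big_seq; apply: ler_sum => m mh.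
case: ifP => [m0|_]; last exact: mulr_ge0.
rewrite normrM ler_wpM2l // normrM mulrC; apply: ler_pM => //.
  apply: le_trans (monv_norm y _) _; rewrite -[leRHS]expr1; apply: ler_wiXn2l => //.
  by rewrite lt0n.
apply: le_trans (monv_bound x _) _; apply: ler_weXn2l; first by rewrite lerDl.
by apply: leq_trans (hd m mh); rewrite mdeg_split leq_addr.
Qed.

Definition restrict_system (p : system R (N + k)) : system R N :=
  ([seq prestrict g | g <- p.1], [seq prestrict h | h <- p.2]).

Lemma sysdeg_restrict d p : sysdeg d p -> sysdeg d (restrict_system p).
Proof. by move=> [d1 d2]; split=> _ /mapP[g gp ->]; apply: mdle_prestrict; [exact: d1|exact: d2]. Qed.

Lemma basic_restrict p x : basic_closed (restrict_system p) x -> basic_closed p (row_mx x 0).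
Proof.
by move=> [h1 h2]; split=> g gp; rewrite -peval_prestrict0; [apply: h1|apply: h2]; apply: map_f.
Qed.

(** The system holds at [(x, y)], and replacing [y] by 0 changes each polynomial by at most a
    multiple of [|y| * (1 + |x|) ^ d]. *)
Lemma violation_restrict d p : sysdeg d p -> exists2 C, 0 < C & forall x y, `|y| <= 1 ->
  basic_closed p (row_mx x y) ->
  violation (restrict_system p) x <= C * (`|y| * (1 + `|x|) ^+ d) ^+ 2.
Proof.
move=> [pd1 pd2].
have /choice[C HC] : forall h : mpoly (N + k) R, exists C, 0 < C /\ (mdle d h -> forall x y, `|y| <= 1 ->
    `|peval h (row_mx x y) - peval (prestrict h) x| <= C * (`|y| * (1 + `|x|) ^+ d)).
  move=> h; have [hd|nhd] := pselect (mdle d h).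
    by have [C C0 hC] := prestrict_near hd; exists C; split.
  by exists 1; split=> // /nhd.
exists (1 + \sum_(h <- p.2 ++ p.1) C h ^+ 2).
  by rewrite ltr_wpDr // sumr_ge0 // => h _; exact: sqr_ge0.
move=> x y y1 [b1 b2]; set B := `|y| * _.
have B0 : 0 <= B by rewrite mulr_ge0 // exprn_ge0 // addr_ge0.
rewrite mulrDl ler_wpDl ?mulr_ge0 ?sqr_ge0 // big_cat mulrDl !mulr_suml.
have aux (a b : R) : 0 <= b -> - b <= a -> a <= 0 -> a ^+ 2 <= b ^+ 2.
  by move=> b0 ab a0; rewrite -sqrrN; apply: lerXn2r; rewrite ?nnegrE; move: b0 ab a0; lra.
rewrite /violation !big_map; apply: lerD; rewrite big_seq [leRHS]big_seq; apply: ler_sum => h hp.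
  have [C0 /(_ (pd2 h hp) x y y1)] := HC h; rewrite (b2 h hp) sub0r normrN => hC.
  by rewrite -exprMn -[leLHS]real_normK ?num_real //; apply: lerXn2r; rewrite ?nnegrE // mulr_ge0 // ltW.
have [C0 /(_ (pd1 h hp) x y y1)] := HC h; rewrite -/B -exprMn => hC.
have CB : 0 <= C h * B by rewrite mulr_ge0 // ltW.
apply: aux => //; last by rewrite ge_min lexx orbT.
rewrite le_min oppr_le0 CB andbT.
have := b1 h hp; have := ler_norm (peval h (row_mx x y) - peval (prestrict h) x).
by move: hC; lra.
Qed.

Lemma tau_le2 (x : 'rV[R]_N) (dl : R) d : 0 < dl -> dl <= 1 + `|x| -> (0 < d)%N ->
  0 <= dl / (1 + `|x| ^+ d) <= 2.
Proof.
move=> dl0 dx d0; have den : 0 < 1 + `|x| ^+ d by rewrite ltr_wpDr // exprn_ge0.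
rewrite divr_ge0 ?(ltW dl0) ?(ltW den) //= ler_pdivrMr //.
have [x1|x1] := leP `|x| 1; first by have : 0 <= `|x| ^+ d by [rewrite exprn_ge0]; move: dx x1; lra.
have : `|x| <= `|x| ^+ d by rewrite -[leLHS]expr1; apply: ler_weXn2l; rewrite // ltW.
by move: dx x1; lra.
Qed.

(** The lower and upper bounds of the violation share the factor [(1 + |x|) ^ (2 * d)], which
    cancels; both sides are squares, and the root halves the exponent [al = 2 * ep]. Passing from
    [ep] to [e] costs a power of 2, the ratio [tau] being bounded by 2 instead of 1. *)
Lemma basic_graph_bound d K (p : system R (N + k)) : (1 < d)%N -> sysdeg d p ->
  ((N + size p.1).-1 <= K)%N -> let e := (d * (6 * d - 3) ^ K)%N in
  exists2 C, 0 < C & forall x y dl, 0 < dl -> dl <= 1 + `|x| -> `|y| <= 1 ->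
    basic_closed p (row_mx x y) ->
    (forall z, `|z - x| < dl -> ~ basic_closed p (row_mx z 0)) ->
    (dl / (1 + `|x| ^+ d)) ^+ e <= C * `|y|.
Proof.
move=> d1 pd pK e.
have [c c0 Hc] := slack_bound d1 (sysdeg_restrict pd).
have [C C0 HC] := violation_restrict pd.
rewrite /= size_map in Hc.
pose ep := (d * (6 * d - 3) ^ (N + size p.1).-1)%N.
have alE : (d * 2 * (3 * (d * 2) - 3) ^ (N + size p.1).-1)%N = (ep * 2)%N.
  by rewrite /ep; have -> : (3 * (d * 2) = 6 * d)%N by [lia]; rewrite mulnAC.
have epe : (ep <= e)%N.
  by rewrite leq_pmul2l ?(ltnW d1) //; apply: leq_pexp2l => //; move: d1; clear; lia.
exists (2 ^+ (e - ep) * (1 + C / c)) => [|x y dl dl0 dx y1 bp nz].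
  by rewrite mulr_gt0 ?exprn_gt0 // addr_gt0 // divr_gt0.
have /andP[t0 t2] := tau_le2 dl0 dx (ltnW d1); set tau := dl / _ in t0 t2 *.
have := le_trans (Hc x dl dl0 dx (fun z zx h => nz z zx (basic_restrict h))) (HC x y y1 bp).
rewrite alE -/tau => h.
have P0 : 0 < (1 + `|x|) ^+ (d * 2) by rewrite exprn_gt0 // ltr_wpDr.
have {}h : (tau ^+ ep) ^+ 2 <= C / c * `|y| ^+ 2.
  rewrite -exprM mulrAC ler_pdivlMr // mulrC -(ler_pM2r P0) mulrAC (le_trans h) //.
  by rewrite exprMn -exprM mulrA.
have h1 : tau ^+ ep <= (1 + C / c) * `|y|.
  have q0 : 0 < C / c by rewrite divr_gt0.
  have s0 : 0 <= (1 + C / c) * `|y| by rewrite mulr_ge0 // addr_ge0 // ltW.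
  rewrite -(@ler_pXn2r _ 2) ?nnegrE ?exprn_ge0 //; apply: le_trans h _; rewrite exprMn ler_wpM2r ?sqr_ge0 //.
  by move: q0; set q := C / c; nra.
rewrite -(subnK epe) exprD -[leRHS]mulrA subnK //; apply: ler_pM; rewrite ?exprn_ge0 //.
by apply: lerXn2r; rewrite ?nnegrE.
Qed.

Lemma graph_bound (X : set 'rV[R]_N) (F : 'rV[R]_N -> 'rV[R]_k) (D : seq (system R (N + k))) d K :
  (1 < d)%N -> graph X F = [set x | exists2 p, p \in D & basic_closed p x] ->
  (forall p, p \in D -> sysdeg d p /\ ((N + size p.1).-1 <= K)%N) ->
  let e := (d * (6 * d - 3) ^ K)%N in
  exists2 C, 0 < C & forall x dl, X x -> 0 < dl -> dl <= 1 + `|x| ->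
    (forall z, X z -> F z = 0 -> dl <= `|z - x|) ->
    (dl / (1 + `|x| ^+ d)) ^+ e <= C * `|F x|.
Proof.
move=> d1 gD HD e.
have /choice[C HC] : forall p : system R (N + k), exists C, 0 < C /\ (p \in D ->
    forall x y dl, 0 < dl -> dl <= 1 + `|x| -> `|y| <= 1 -> basic_closed p (row_mx x y) ->
    (forall z, `|z - x| < dl -> ~ basic_closed p (row_mx z 0)) ->
    (dl / (1 + `|x| ^+ d)) ^+ e <= C * `|y|).
  move=> p; have [pD|npD] := boolP (p \in D); last by exists 1.
  have [pd pK] := HD p pD; have [C C0 hC] := basic_graph_bound d1 pd pK.
  by exists C; split.
pose S := 2 ^+ e + \sum_(p <- D) C p.
have P2 : 0 < 2 ^+ e :> R by rewrite exprn_gt0.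
have sC : 0 <= \sum_(p <- D) C p by apply: sumr_ge0 => p _; rewrite ltW //; case: (HC p).
exists S => [|x dl Xx dl0 dx nz]; first by rewrite ltr_wpDr.
have /andP[t0 t2] := tau_le2 dl0 dx (ltnW d1).
(* For [|F x| >= 1] the bound [2 ^ e] of the left side suffices; the other case meets the condition
   [|y| <= 1]. *)
have [F1|F1] := leP 1 `|F x|.
  apply: (@le_trans _ _ (2 ^+ e)); first by apply: lerXn2r; rewrite ?nnegrE.
  by rewrite (le_trans (_ : _ <= S)) ?lerDl // ler_peMr // addr_ge0 // ltW.
have : graph X F (row_mx x (F x)) by exists x.
rewrite gD => -[p pD bp]; have [_ /(_ pD) hC] := HC p.
apply: le_trans (hC x (F x) dl dl0 dx (ltW F1) bp _) _.
  move=> z zx bz; have : graph X F (row_mx z 0) by rewrite gD; exists p.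
  move=> [w Xw /eq_row_mx[wz Fw0]]; subst w.
  by have := nz z Xw Fw0; rewrite leNgt zx.
rewrite ler_wpM2r // /S (perm_big _ (perm_to_rem pD)) big_cons /= addrCA lerDl addr_ge0 ?(ltW P2) //.
by apply: sumr_ge0 => q _; rewrite ltW //; case: (HC q).
Qed.

End restriction.

(** * Decomposition of closed semialgebraic sets *)

Section dfn_seq.
Context {R : realType} {k : nat}.

Lemma dfn_ex_seq (I : eqType) (s : seq I) (P : I -> 'rV[R]_k -> Prop) :
  (forall i, dfn (P i)) -> dfn (fun x => exists2 i, i \in s & P i x).
Proof.
move=> dP; apply: (@dfn_iff _ _ (fun x => ~ forall i, i \in s -> ~ P i x)) => [x|].
  split=> [h|[i si Pi] /(_ i si)//]; apply: contrapT => nex; apply: h => i si Pi.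
  by apply: nex; exists i.
by apply: dfn_not; apply: dfn_all_seq => i; exact: dfn_not.
Qed.

Lemma semialgebraic_dfn (S : set 'rV[R]_k) : semialgebraic S -> dfn S.
Proof.
move=> [D ->]; apply: dfn_ex_seq => p; apply: dfn_and; apply: dfn_all_seq => f.
  by apply: dfn_gt0; exact: polyf_peval.
by apply: dfn_eq; [exact: polyf_peval|exact: polyf_cst].
Qed.

End dfn_seq.

Section finiteness.
Context {R : realType} {n : nat}.
Implicit Types (p q : system R n) (D : seq (system R n)) (S : set 'rV[R]_n).

Definition union_of (B : system R n -> set 'rV[R]_n) D : set 'rV[R]_n :=
  [set x | exists2 p, p \in D & B p x].

Definition meet_system p q : system R n := (p.1 ++ q.1, p.2 ++ q.2).

Lemma basic_open_meet p q x : basic_open (meet_system p q) x <-> basic_open p x /\ basic_open q x.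
Proof.
split=> [[h1 h2]|[[p1 p2] [q1 q2]]].
  by split; split=> f fp; (apply: h1 || apply: h2); rewrite mem_cat fp ?orbT.
by split=> f; rewrite mem_cat => /orP[]; [exact: p1|exact: q1|exact: p2|exact: q2].
Qed.

Lemma basic_closed_meet p q x : basic_closed (meet_system p q) x <-> basic_closed p x /\ basic_closed q x.
Proof.
split=> [[h1 h2]|[[p1 p2] [q1 q2]]].
  by split; split=> f fp; (apply: h1 || apply: h2); rewrite mem_cat fp ?orbT.
by split=> f; rewrite mem_cat => /orP[]; [exact: p1|exact: q1|exact: p2|exact: q2].
Qed.

(** Distributivity of intersection over union, for open and closed basic sets at once. *)
Lemma union_of_inter (B : system R n -> set 'rV[R]_n) (I : eqType) (l : seq I) (P : I -> set 'rV[R]_n) :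
  (forall p q x, B (meet_system p q) x <-> B p x /\ B q x) -> (forall x, B ([::], [::]) x) ->
  (forall i, i \in l -> exists D, P i = union_of B D) ->
  exists D, [set x | forall i, i \in l -> P i x] = union_of B D.
Proof.
move=> BM B0; elim: l => [|i l IH] Pl.
  exists [:: ([::], [::])]; apply/seteqP; split=> // x _.
  by exists ([::], [::]); rewrite ?inE.
have [j jl|D2 E2] := IH; first by apply: Pl; rewrite inE jl orbT.
have [D1 E1] := Pl i (mem_head _ _).
exists [seq meet_system p q | p <- D1, q <- D2]; apply/seteqP; split=> x.
  move=> h; have : P i x by apply: h; exact: mem_head.
  rewrite E1 => -[p pD Bp].
  have : [set x | forall i, i \in l -> P i x] x by move=> j jl; apply: h; rewrite inE jl orbT.
  rewrite E2 => -[q qD Bq]; exists (meet_system p q); last exact/BM.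
  exact: allpairs_f.
move=> [_ /allpairsP[[p q] /= [pD qD ->]] /BM[Bp Bq]] j; rewrite inE => /predU1P[->|jl].
  by rewrite E1; exists p.
have : [set x | forall i, i \in l -> P i x] x by rewrite E2; exists q.
by apply.
Qed.

Lemma basic_open_compl p : exists D, ~` basic_open p = union_of (@basic_open R n) D.
Proof.
exists ([seq ([:: - g], [::]) | g <- p.1] ++ [seq ([::], [:: g]) | g <- p.1] ++
  [seq ([:: h], [::]) | h <- p.2] ++ [seq ([:: - h], [::]) | h <- p.2]).
have single (g : mpoly n R) x : 0 < peval g x -> basic_open ([:: g], [::]) x.
  by move=> gx; split=> // f; rewrite inE => /eqP ->.
apply/seteqP; split=> x.
  move=> nb; apply: contrapT => nu; apply: nb; split=> f fp.
    have [|fx|fx] := ltgtP 0 (peval f x) => //; exfalso; apply: nu.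
      exists ([:: - f], [::]); last by apply: single; rewrite pevalN oppr_gt0.
      by rewrite mem_cat; apply/orP; left; apply: (map_f (fun g => ([:: - g], [::]))).
    exists ([::], [:: f]); last by split=> // g; rewrite inE => /eqP ->.
    by rewrite !mem_cat; apply/orP; right; apply/orP; left; apply: (map_f (fun g => ([::], [:: g]))).
  have [fx|fx|->//] := ltgtP 0 (peval f x); exfalso; apply: nu.
    exists ([:: f], [::]); last exact: single.
    by rewrite !mem_cat (map_f (fun g => ([:: g], [::]))) ?orbT.
  exists ([:: - f], [::]); last by apply: single; rewrite pevalN oppr_gt0.
  by rewrite !mem_cat [X in _ || (_ || (_ || X))](map_f (fun g => ([:: - g], [::]))) ?orbT.
move=> [q + qx] [p1 p2]; rewrite !mem_cat => /or4P[] /mapP[f fp qE]; move: qx; rewrite qE => -[/= q1 q2].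
- by have := q1 _ (mem_head _ _); rewrite pevalN oppr_gt0 ltNge ltW // p1.
- by have := p1 f fp; rewrite q2 ?ltxx // mem_head.
- by have := q1 _ (mem_head _ _); rewrite p2 // ltxx.
- by have := q1 _ (mem_head _ _); rewrite pevalN p2 // oppr0 ltxx.
Qed.

Lemma semialgebraic_compl S : semialgebraic S -> exists D, ~` S = union_of (@basic_open R n) D.
Proof.
move=> [D ->]; have [|||D' E] := @union_of_inter (@basic_open R n) _ D (fun p => ~` basic_open p).
- exact: basic_open_meet.
- by move=> x; split.
- by move=> p _; exact: basic_open_compl.
exists D'; rewrite -E; apply/seteqP; split=> x h; first by move=> p pD px; apply: h; exists p.
by move=> [p pD px]; exact: (h p pD).
Qed.

Lemma fewest_ineqs_exists p : exists q, basic_closed q = basic_closed p /\ fewest_ineqs q.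
Proof.
pose P k := `[< exists q, basic_closed q = basic_closed p /\ size q.1 = k >].
have exP : exists k, P k by exists (size p.1); apply/asboolP; exists p.
have [k /asboolP[q [qp qk]] kmin] := ex_minnP exP.
exists q; split=> // q' q'q; rewrite qk; apply: kmin; apply/asboolP; exists q'; split=> //.
by rewrite q'q.
Qed.

Lemma closed_union_decomposition D : exists D', decomposition (union_of (@basic_closed R n) D) D'.
Proof.
have /choice[m Hm] := fewest_ineqs_exists.
exists (map m D); split; last by move=> _ /mapP[p _ ->]; case: (Hm p).
apply/seteqP; split=> x.
  by move=> [p pD px]; exists (m p); [exact: map_f|case: (Hm p) => ->].
by move=> [_ /mapP[p pD ->]]; case: (Hm p) => -> _ px; exists p.
Qed.

Lemma polyf_sqnorm : polyf (fun x : 'rV[R]_n => \sum_i x 0 i ^+ 2).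
Proof. by apply: polyf_sum => i; apply: polyfX; exact: polyf_coord. Qed.

Lemma compact_sqnorm_le (A : set 'rV[R]_n) (s : R) : 0 < s -> closed A ->
  compact (A `&` [set x | s * (\sum_i x 0 i ^+ 2) <= 1]).
Proof.
move=> s0 cA; apply: (@subclosed_compact _ _ [set x : 'rV[R]_n | `|x - 0| <= Num.sqrt s^-1]).
- apply: closedI => //; apply: closed_le_polyf; last exact: polyf_cst.
  by apply: polyfM; [exact: polyf_cst|exact: polyf_sqnorm].
- exact: closed_box_compact.
move=> x [_ /= sx]; rewrite subr0; apply: rvnorm_le => [|i]; first exact: sqrtr_ge0.
rewrite -sqrtr_sqr ler_sqrt ?invr_ge0 ?(ltW s0) // -div1r ler_pdivlMr // mulrC.
apply: le_trans sx; rewrite ler_pM2l // (bigD1 i) //= lerDl sumr_ge0 // => j _; exact: sqr_ge0.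
Qed.

(* Where [s * |x| ^ 2 <= 1] and [s <= p x ^ 2] the set is compact and [f] is bounded away from 0;
   by [dfn_region] this bound is a power of [s]. *)
Lemma polyf_lojasiewicz S (f p : 'rV[R]_n -> R) : dfn S -> closed S -> polyf f -> polyf p ->
  (forall x, 0 <= f x) -> (forall x, S x -> f x = 0 -> p x = 0) ->
  exists (M : nat) (c : R), [/\ (0 < M)%N, 0 < c & forall x, S x ->
    c * p x ^+ (2 * M) <= f x * ((1 + \sum_i x 0 i ^+ 2) * (1 + p x ^+ 2)) ^+ M].
Proof.
move=> dS cS fp pp f0 fp0; pose nn x : R := \sum_i (x : 'rV[R]_n) 0 i ^+ 2.
have nn0 x : 0 <= nn x by apply: sumr_ge0 => i _; exact: sqr_ge0.
pose phi (v : 'rV[R]_2) := exists x : 'rV[R]_n, S (rsubmx (row_mx v x)) /\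
  ((lsubmx (row_mx v x) 0 0 * nn (rsubmx (row_mx v x)) <= 1 /\
    lsubmx (row_mx v x) 0 0 <= p (rsubmx (row_mx v x)) ^+ 2) /\
   f (rsubmx (row_mx v x)) <= lsubmx (row_mx v x) 0 1).
have dphi : dfn phi.
  have pl i : polyf (fun z : 'rV[R]_(2 + n) => lsubmx z 0 i).
    by apply: (@polyf_lsubmx _ _ _ (fun v => v 0 i)); exact: polyf_coord.
  apply: (@dfn_ex _ 2 n (fun z => S (rsubmx z) /\ ((lsubmx z 0 0 * nn (rsubmx z) <= 1 /\
    lsubmx z 0 0 <= p (rsubmx z) ^+ 2) /\ f (rsubmx z) <= lsubmx z 0 1))).
  apply: dfn_and; first exact: dfn_rsubmx.
  apply: dfn_and; first apply: dfn_and.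
  - apply: dfn_le; last exact: polyf_cst.
    by apply: polyfM => //; apply: polyf_rsubmx; exact: polyf_sqnorm.
  - by apply: dfn_le => //; apply: polyfX; exact: polyf_rsubmx.
  - by apply: dfn_le => //; exact: polyf_rsubmx.
have phiE s r : phi (vec2 s r) <-> exists x, S x /\ ((s * nn x <= 1 /\ s <= p x ^+ 2) /\ f x <= r).
  by split=> -[x H]; exists x; move: H; rewrite row_mxKr row_mxKl !mxE.
have [N [s0 [s00 H]]] := dfn_region dphi.
(* If [phi] held on a region, the minimum of [f] over the compact set would be at most every small
   [r > 0], whereas it is positive. *)
have {}H s r : 0 < s < s0 -> 0 < r < s ^+ N -> ~ phi (vec2 s r).
  move: s r; case: H => // HT s _ ss _ _; have /andP[sgt0 _] := ss.
  pose A := S `&` [set x | s <= p x ^+ 2].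
  have cA : closed A.
    by apply: closedI => //; apply: closed_le_polyf; [exact: polyf_cst|exact: polyfX].
  have cK := compact_sqnorm_le sgt0 cA.
  have P0 : 0 < s ^+ N by rewrite exprn_gt0.
  have [nK|/existsNP] := pselect (forall x, ~ (A `&` [set x | s * (\sum_i x 0 i ^+ 2) <= 1]) x).
    have : phi (vec2 s (s ^+ N / 2)) by apply: HT => //; move: P0; lra.
    by move=> /phiE[x [Sx [[h1 h2] _]]]; exact: (nK x).
  move=> [x1 /contrapT Kx1].
  have [||x2 Kx2 min2] := @compact_EVT_min _ R f _ _ cK; first by exists x1.
    apply: continuous_subspaceT; exact: polyf_continuous.
  have fx2 : 0 < f x2.
    rewrite lt_neqAle f0 andbT eq_sym; apply/eqP => fx; move: Kx2; rewrite inE => -[[Sx sp] _].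
    by move: sp; rewrite /= (fp0 x2) // expr0n /= leNgt sgt0.
  pose r := Num.min (f x2) (s ^+ N) / 2.
  have r0 : 0 < Num.min (f x2) (s ^+ N) by rewrite lt_min fx2.
  have : phi (vec2 s r).
    apply: HT => //; have : Num.min (f x2) (s ^+ N) <= s ^+ N by rewrite ge_min lexx orbT.
    by rewrite /r; move: r0; lra.
  move=> /phiE[x [Sx [[h1 h2] fr]]].
  have := min2 x; rewrite inE => /(_ (conj (conj Sx h2) h1)) fx.
  have : Num.min (f x2) (s ^+ N) <= f x2 by rewrite ge_min lexx.
  by move: fr fx r0; rewrite /r; lra.
pose s1 := Num.min s0 1 / 2.
have m0 : 0 < Num.min s0 1 by rewrite lt_min s00 ltr01.
have s10 : 0 < s1 by rewrite divr_gt0.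
have s1s : s1 < s0 by have : Num.min s0 1 <= s0 by [rewrite ge_min lexx]; rewrite /s1; move: m0; lra.
have s11 : s1 < 1 by have : Num.min s0 1 <= 1 by [rewrite ge_min lexx orbT]; rewrite /s1; move: m0; lra.
exists N.+1, (s1 ^+ N.+1); split=> //; first by rewrite exprn_gt0.
move=> x Sx; pose W := (1 + nn x) * (1 + p x ^+ 2); rewrite -/(nn x) -/W.
have q0 : 0 <= p x ^+ 2 by exact: sqr_ge0.
have W0 : 0 < W by rewrite mulr_gt0 // ltr_wpDr.
have [px|px] := eqVneq (p x) 0.
  by rewrite px expr0n muln_eq0 /= mulr0 mulr_ge0 // exprn_ge0 // ltW.
have q1 : 0 < p x ^+ 2 by rewrite lt_neqAle q0 andbT eq_sym sqrf_eq0.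
(* This [s] meets all constraints at once: [s <= s1], [s <= p x ^ 2] and [s * nn x <= 1], since [W]
   is at least [p x ^ 2], 1 and [nn x * p x ^ 2]. *)
rewrite exprM -exprMn -ler_pdivrMr ?exprn_gt0 // -expr_div_n; set s := s1 * _ / _.
have sgt0 : 0 < s by rewrite divr_gt0 // mulr_gt0.
have WE : W = 1 + nn x + p x ^+ 2 + nn x * p x ^+ 2 by rewrite /W; ring.
have nnq : 0 <= nn x * p x ^+ 2 by rewrite mulr_ge0.
have s_lt : s <= s1.
  by rewrite ler_pdivrMr // ler_pM2l // WE; have := nn0 x; move: nnq; lra.
have sq : s <= p x ^+ 2.
  rewrite ler_pdivrMr // mulrC ler_pM2l //; apply: (le_trans (ltW s11)).
  by rewrite WE; have := nn0 x; move: nnq q0; lra.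
have sn : s * nn x <= 1.
  rewrite mulrAC ler_pdivrMr // mul1r -mulrA; apply: (@le_trans _ _ (p x ^+ 2 * nn x)).
    by rewrite ler_piMl ?(ltW s11) // mulr_ge0.
  by rewrite WE mulrC; have := nn0 x; move: q0; lra.
have s1' : s <= 1 by apply: le_trans (ltW s11).
apply: (@le_trans _ _ (s ^+ N)).
  by apply: ler_wiXn2l => //; exact: ltW.
rewrite leNgt; apply/negP => fs.
have P0 : 0 < s ^+ N by rewrite exprn_gt0.
apply: (H s ((f x + s ^+ N) / 2)); first by rewrite sgt0 (le_lt_trans s_lt).
  by move: (f0 x) fs P0; lra.
by apply/phiE; exists x; split=> //; split=> //; move: fs; lra.
Qed.

(** On the part of [S] where all [g >= 0], the sum [f] of the squares of the [h] vanishes only where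
    the product [P] of the [g] does. So, with [W] the weight of [polyf_lojasiewicz],
    [q = f * W ^ M - c * P ^ (2 * M)] is nonnegative there, while [q < 0] on the basic open set. The
    sets [q >= 0] and [- g >= 0] then cover [S] and miss that set. *)
Lemma separate_basic_open S p : dfn S -> closed S -> basic_open p `<=` ~` S ->
  exists D, S `<=` union_of (@basic_closed R n) D /\
    basic_open p `<=` ~` union_of (@basic_closed R n) D.
Proof.
move=> dS cS pS.
pose f x := sumsq p.2 x; pose P (x : 'rV[R]_n) := \prod_(g <- p.1) peval g x.
have fp : polyf f by apply: polyf_sum => h; apply: polyfX; exact: polyf_peval.
have pp : polyf P by apply: polyf_prod => h; exact: polyf_peval.
pose A := S `&` [set x | forall g, g \in p.1 -> 0 <= peval g x].
have dA : dfn A.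
  apply: dfn_and => //; apply: dfn_all_seq => g.
  by apply: dfn_le; [exact: polyf_cst|exact: polyf_peval].
have cA : closed A.
  apply: closedI => //.
  rewrite (_ : mkset _ = \bigcap_(g in [set g | g \in p.1]) [set x | 0 <= peval g x]) //.
  apply: closed_bigI => g _; apply: closed_le_polyf; [exact: polyf_cst|exact: polyf_peval].
have fA x : A x -> f x = 0 -> P x = 0.
  move=> [Sx gx] fx; apply/eqP; rewrite prodf_seq_eq0.
  apply: contrapT => /negP/hasPn nz; apply: (pS x) => //; split=> [g gp|h hp]; last exact: sumsq_eq0 hp.
  rewrite lt_neqAle gx // andbT eq_sym; exact: nz g gp.
have [M [c [M0 c0 HM]]] := polyf_lojasiewicz dA cA fp pp (fun x => sumsq_ge0 p.2 x) fA.
have [q qE] : polyf (fun x => f x * ((1 + \sum_i x 0 i ^+ 2) * (1 + P x ^+ 2)) ^+ M - c * P x ^+ (2 * M)).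
  apply: polyfB; apply: polyfM => //; try exact: polyfX; try exact: polyf_cst.
  apply: polyfX; apply: polyfM; apply: polyfD; try exact: polyf_cst; last exact: polyfX.
  exact: polyf_sqnorm.
exists (([:: q], [::]) :: [seq ([:: - g], [::]) | g <- p.1]); split=> x.
  move=> Sx; have [[g gp gx]|nog] := pselect (exists2 g, g \in p.1 & peval g x < 0).
    exists ([:: - g], [::]).
      by rewrite inE (map_f (fun g => ([:: - g], [::]))) ?orbT.
    by split=> // g'; rewrite inE => /eqP ->; rewrite pevalN oppr_ge0 ltW.
  exists ([:: q], [::]); first exact: mem_head.
  split=> // g'; rewrite inE => /eqP ->; rewrite -qE subr_ge0; apply: HM; split=> // g gp.
  by rewrite leNgt; apply/negP => gx; apply: nog; exists g.
move=> [p1 p2] [q' + q'x]; rewrite inE => /predU1P[qq|/mapP[g gp qq]]; move: q'x; rewrite qq => -[/= h _].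
  have := h q (mem_head _ _); rewrite -qE.
  have -> : f x = 0 by rewrite /f /sumsq big_seq big1 // => g gp; rewrite p2 // expr0n.
  rewrite mul0r sub0r oppr_ge0 leNgt mulr_gt0 // exprn_gt0 // /P big_seq prodr_gt0 // => g gp; exact: p1.
by have := h _ (mem_head _ _); rewrite pevalN oppr_ge0 leNgt p1.
Qed.

(** The complement of [S] is a finite union of basic open sets; intersecting the closed sets that
    separate [S] from each of them leaves exactly [S]. *)
Lemma finiteness S : closed S -> semialgebraic S -> exists D, decomposition S D.
Proof.
move=> cS sS; have dS := semialgebraic_dfn sS.
have [U EU] := semialgebraic_compl sS.
have /choice[T HT] : forall p, exists D, p \in U ->
    S `<=` union_of (@basic_closed R n) D /\ basic_open p `<=` ~` union_of (@basic_closed R n) D.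
  move=> p; have [pU|npU] := boolP (p \in U); last by exists [::].
  have [|D HD] := separate_basic_open (p := p) dS cS; last by exists D.
  by move=> x px; rewrite EU; exists p.
have [|||D E] := @union_of_inter (@basic_closed R n) _ U (fun p => union_of (@basic_closed R n) (T p)).
- exact: basic_closed_meet.
- by move=> x; split.
- by move=> p _; exists (T p).
suff -> : S = union_of (@basic_closed R n) D by exact: closed_union_decomposition.
rewrite -E; apply/seteqP; split=> x.
  by move=> Sx p pU; have [h _] := HT p pU; exact: h.
move=> h; apply: contrapT => nS; have : (~` S) x by [].
by rewrite EU => -[p pU px]; have [_ /(_ x px)] := HT p pU; apply; exact: h.
Qed.

End finiteness.

(** * Distance to the zero set and exponent at infinity *)

Section conclusion.
Context {R : realType}.

Lemma norm_le_enorm n (x : 'rV[R]_n) : `|x| <= enorm x.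
Proof.
apply: rvnorm_le => [|i]; first exact: sqrtr_ge0.
rewrite -sqrtr_sqr ler_sqrt; last by apply: sumr_ge0 => j _; exact: sqr_ge0.
by rewrite (bigD1 i) //= lerDl sumr_ge0 // => j _; exact: sqr_ge0.
Qed.

Lemma enorm_le_norm n (x : 'rV[R]_n) : enorm x <= n.+1%:R * `|x|.
Proof.
have b0 : 0 <= n.+1%:R * `|x| by rewrite mulr_ge0.
rewrite -[leRHS](ger0_norm b0) -sqrtr_sqr ler_sqrt ?sqr_ge0 //.
apply: (@le_trans _ _ (\sum_(i < n) `|x| ^+ 2)).
  apply: ler_sum => i _; rewrite -[leLHS]real_normK ?num_real //.
  by apply: lerXn2r; rewrite ?nnegrE // rvnorm_coord.
rewrite sumr_const card_ord -[leLHS]mulr_natl exprMn ler_wpM2r ?sqr_ge0 //.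
by rewrite -natrX ler_nat; lia.
Qed.

Lemma graph_closed N m (X : set 'rV[R]_N) (F : 'rV[R]_N -> 'rV[R]_m) :
  closed X -> {within X, continuous F} -> closed (graph X F).
Proof.
move=> cX /subspace_continuousP cF w cw.
pose x := lsubmx w; pose y := rsubmx w.
have near e : 0 < e -> exists z, [/\ X z, `|z - x| < e & `|F z - y| < e].
  move=> e0; have [_ [[z Xz <-] /= zw]] := cw _ (nbhsx_ballx w e e0).
  exists z; split=> //; rewrite distrC; move: zw; rewrite -ball_normE /=; apply: le_lt_trans.
    apply: rvnorm_le => // i; have := rvnorm_coord (w - row_mx z (F z)) (lshift m i).
    by rewrite !mxE (unsplitK (inl i)).
  apply: rvnorm_le => // i; have := rvnorm_coord (w - row_mx z (F z)) (rshift N i).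
  by rewrite !mxE (unsplitK (inr i)).
have Xx : X x.
  apply: cX => B /nbhs_ballP[e /= e0 He]; have [z [Xz zx _]] := near e e0.
  by exists z; split=> //; apply: He; rewrite -ball_normE /= distrC.
exists x => //; suff -> : F x = y by rewrite hsubmxK.
apply/eqP; rewrite -subr_eq0 -normr_le0; apply/ler_addgt0Pl => e e0; rewrite addr0.
have e20 : 0 < e / 2 by rewrite divr_gt0.
have := cF x Xx; move/cvgrPdist_lt => /(_ _ e20); rewrite near_withinE => /nbhs_ballP[dl /= dl0 Hd].
have m0 : 0 < Num.min dl (e / 2) by rewrite lt_min dl0.
have [z [Xz]] := near _ m0; rewrite !lt_min => /andP[zx _] /andP[_ zy].
have := Hd z; rewrite -ball_normE /= distrC => /(_ zx Xz) Fz.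
by rewrite -(subrK (F z) (F x)) -addrA (le_trans (ler_normD _ _)) //; move: Fz zy; lra.
Qed.

Lemma nat_minP (A : set nat) k : A k -> A (nat_min A) /\ forall j, A j -> (nat_min A <= j)%N.
Proof.
move=> Ak; have exA : exists i, `[< A i >] by exists k; apply/asboolP.
have [i /asboolP Ai imin] := ex_minnP exA.
have : [set i | A i /\ forall j, A j -> (i <= j)%N] (nat_min A).
  by apply: (xgetPex 0%N); exists i; split=> // j Aj; apply: imin; apply/asboolP.
by [].
Qed.

(** [finiteness] provides a decomposition, so the minimum in [rnum] is attained; a decomposition
    attaining it is a candidate for [kappa], whose minimum is therefore attained as well. *)
Lemma kappa_decomposition n (S : set 'rV[R]_n) : closed S -> semialgebraic S ->
  exists D, S = union_of (@basic_closed R n) D /\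
    forall p, p \in D -> sysdeg (kappa S) p /\ (size p.1 <= rnum S)%N.
Proof.
move=> cS sS; have [D0 D0S] := finiteness cS sS.
have [[D1 D1S rE] _] := @nat_minP [set max_ineqs D | D in decomposition S] (max_ineqs D0) (ex_intro2 _ _ D0 D0S erefl).
have D1r p : p \in D1 -> (size p.1 <= rnum S)%N.
  by move=> pD; rewrite /rnum -rE /max_ineqs (perm_big _ (perm_to_rem pD)) big_cons leq_maxl.
have [[D [[DE _] Dr] kE] _] := @nat_minP [set max_deg D | D in [set D | decomposition S D /\
  forall p, p \in D -> (size p.1 <= rnum S)%N]] (max_deg D1) (ex_intro2 _ _ D1 (conj D1S D1r) erefl).
exists D; split=> // p pD; split; last exact: Dr.
have fk f : f \in p.1 ++ p.2 -> mdle (kappa S) f.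
  move=> fp m mf; apply: (@leq_trans (pdeg f)).
    by have := mmeasure_mnm_lt mdeg mf; rewrite /pdeg; case: (mmeasure _ _).
  rewrite /kappa -kE /max_deg (perm_big _ (perm_to_rem pD)) big_cons; apply: leq_trans (leq_maxl _ _).
  by rewrite (perm_big _ (perm_to_rem fp)) big_cons leq_maxl.
by split=> f fp; apply: fk; rewrite mem_cat fp ?orbT.
Qed.

(** Turns a Euclidean distance into an admissible max-norm radius: [n.+1] compares the norms and is
    positive also for [n = 0], and [1 + |z0|], with [z0] in [Z], enforces the limit [1 + |x|]. For
    empty [Z], the convention [dist = 1] allows [K = 1]. *)
Lemma dist_scale n (Z : set 'rV[R]_n) : exists2 K, 0 < K & forall x,
  [/\ 0 <= dist x Z, dist x Z / K <= 1 + `|x| & forall z, Z z -> dist x Z / K <= `|z - x|].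
Proof.
rewrite /dist; case: asboolP => [Z0|Z0].
  by exists 1 => // x; split=> [//||z]; rewrite ?divr1 ?lerDl // Z0.
have /set0P[z0 Zz0] : Z != set0 by apply/eqP.
have n0 : 0 < n.+1%:R :> R by rewrite ltr0n.
have z1 : 1 <= 1 + `|z0| by rewrite lerDl.
have z2 : 0 < 1 + `|z0| := lt_le_trans ltr01 z1.
exists (n.+1%:R * (1 + `|z0|)) => [|x]; first exact: mulr_gt0.
have i_le z : Z z -> inf [set enorm (x - a) | a in Z] <= n.+1%:R * `|z - x|.
  move=> Zz; rewrite distrC; apply: le_trans (enorm_le_norm _); apply: ge_inf; last by exists z.
  by exists 0 => _ [a _ <-]; exact: sqrtr_ge0.
split=> [||z Zz].
- by apply: lb_le_inf; [exists (enorm (x - z0)); exists z0|move=> _ [a _ <-]; exact: sqrtr_ge0].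
- rewrite ler_pdivrMr ?mulr_gt0 //; apply: le_trans (i_le z0 Zz0) _; rewrite mulrCA ler_pM2l //.
  apply: le_trans (ler_normB _ _) _; have := mulr_ge0 (normr_ge0 x) (normr_ge0 z0); lra.
- rewrite ler_pdivrMr ?mulr_gt0 //; apply: le_trans (i_le z Zz) _; rewrite mulrCA ler_pM2l //.
  by rewrite ler_peMr.
Qed.

Lemma dist_bound N m (X : set 'rV[R]_N) (F : 'rV[R]_N -> 'rV[R]_m) d e C :
  (0 < e)%N -> 0 < C -> let Z := F @^-1` [set 0] `&` X in
  (forall x dl, X x -> 0 < dl -> dl <= 1 + `|x| -> (forall z, X z -> F z = 0 -> dl <= `|z - x|) ->
    (dl / (1 + `|x| ^+ d)) ^+ e <= C * `|F x|) ->
  exists c, 0 < c /\ forall x, X x -> c * (dist x Z / (1 + enorm x ^+ d)) ^+ e <= enorm (F x).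
Proof.
move=> e0 C0 Z H; have [K K0 HK] := dist_scale Z.
have P0 : 0 < K ^+ e by rewrite exprn_gt0.
exists (K ^+ e * C)^-1; split=> [|x Xx]; first by rewrite invr_gt0 mulr_gt0.
have [dist0 d1 d2] := HK x.
(* Radii must be positive; at distance 0 the left side vanishes because [e > 0]. *)
have [->|/eqP dn0] := eqVneq (dist x Z) 0; first by rewrite mul0r expr0n gtn_eqF // mulr0 sqrtr_ge0.
have dist_gt0 : 0 < dist x Z by rewrite lt_neqAle dist0 andbT eq_sym; apply/eqP.
rewrite mulrC ler_pdivrMr ?mulr_gt0 // [leRHS]mulrC -[leRHS]mulrA.
have den : 0 < 1 + `|x| ^+ d by rewrite ltr_wpDr // exprn_ge0.
have den' : 1 + `|x| ^+ d <= 1 + enorm x ^+ d.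
  by rewrite lerD2l; apply: lerXn2r; rewrite ?nnegrE ?sqrtr_ge0 // norm_le_enorm.
have t0 : 0 <= dist x Z / K / (1 + `|x| ^+ d) by rewrite !divr_ge0 // ltW.
have h := H x (dist x Z / K) Xx (divr_gt0 dist_gt0 K0) d1 (fun z Xz Fz => d2 z (conj Fz Xz)).
apply: (@le_trans _ _ (K ^+ e * (dist x Z / K / (1 + `|x| ^+ d)) ^+ e)).
  rewrite -exprMn; apply: lerXn2r; rewrite ?nnegrE ?mulr_ge0 ?invr_ge0 ?(ltW K0) //.
    by rewrite ltW // (lt_le_trans den).
  rewrite mulrA mulrCA divff ?gt_eqF // mulr1 ler_pM2l // lef_pV2 ?posrE //.
  exact: lt_le_trans den'.
by rewrite ler_pM2l //; apply: le_trans h _; rewrite ler_pM2l // norm_le_enorm.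
Qed.

(** With all zeros in the ball of radius [B], a point with [|x| >= 2 * B] is at distance at least
    [|x| / 2] from them. This serves as radius, and [|x| / 2 / (1 + |x| ^ d) >= |x| ^ (1 - d) /
    4]. *)
Lemma loj_infty_bound N m (X : set 'rV[R]_N) (F : 'rV[R]_N -> 'rV[R]_m) d e C :
  (0 < d)%N -> 0 < C -> compact (F @^-1` [set 0] `&` X) ->
  (forall x dl, X x -> 0 < dl -> dl <= 1 + `|x| -> (forall z, X z -> F z = 0 -> dl <= `|z - x|) ->
    (dl / (1 + `|x| ^+ d)) ^+ e <= C * `|F x|) ->
  (((1 - d%:R) * e%:R)%:E <= loj_infty X F)%E.
Proof.
move=> d0 C0 /compact_bounded[M [_ HM]] H.
pose B := `|M| + 1; have B1 : 1 <= B by rewrite lerDr.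
have ZB z : X z -> F z = 0 -> `|z| <= B.
  by move=> Xz Fz; apply: (HM B) => //; apply: le_lt_trans (ler_norm _) _; rewrite /B ltrDl.
have n0 : 0 < N.+1%:R :> R by rewrite ltr0n.
have P0 : 0 < 4 ^+ e :> R by rewrite exprn_gt0.
apply: ereal_sup_ubound; exists ((1 - d%:R) * e%:R) => //.
exists (4 ^+ e * C)^-1, (N.+1%:R * (2 * B)); split.
- by rewrite invr_gt0 mulr_gt0.
- by rewrite !mulr_gt0 // (lt_le_trans ltr01).
move=> x Xx xr; have {}xr : 2 * B <= `|x|.
  by rewrite -(ler_pM2l n0) (le_trans xr) // enorm_le_norm.
have x1 : 1 <= `|x| by move: xr B1; lra.
have x0 : 0 < `|x| := lt_le_trans ltr01 x1.
have E0 : 0 < enorm x := lt_le_trans x0 (norm_le_enorm x).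
have dx : `|x| / 2 <= 1 + `|x| by move: x1; lra.
have dz z : X z -> F z = 0 -> `|x| / 2 <= `|z - x|.
  move=> Xz Fz; have := ler_normB (z - x) z; rewrite addrAC subrr add0r normrN.
  by have := ZB z Xz Fz; move: xr; lra.
have := H x (`|x| / 2) Xx (divr_gt0 x0 (ltr0n _ 2)) dx dz.
have -> : (1 - d%:R) * e%:R = - (d.-1 * e)%:R :> R.
  by rewrite natrM -[in LHS](prednK d0) -natr1; ring.
rewrite powRN powR_mulrn ?(ltW E0) // exprM -exprVn => h.
rewrite mulrC ler_pdivrMr ?mulr_gt0 // [leRHS]mulrC -[leRHS]mulrA.
apply: (@le_trans _ _ (4 ^+ e * (`|x| / 2 / (1 + `|x| ^+ d)) ^+ e)); last first.
  by rewrite ler_pM2l //; apply: le_trans h _; rewrite ler_pM2l // norm_le_enorm.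
have den : 0 < 1 + `|x| ^+ d by rewrite ltr_wpDr // exprn_ge0.
have xd : 0 < `|x| ^+ d.-1 by rewrite exprn_gt0.
rewrite -exprMn; apply: lerXn2r; rewrite ?nnegrE ?invr_ge0 ?exprn_ge0 ?(ltW E0) //.
apply: (@le_trans _ _ (`|x| ^+ d.-1)^-1).
  by rewrite lef_pV2 ?posrE ?exprn_gt0 //; apply: lerXn2r; rewrite ?nnegrE ?(ltW E0) // norm_le_enorm.
rewrite mulrA ler_pdivlMr // ler_pdivrMl //.
have -> : `|x| ^+ d = `|x| * `|x| ^+ d.-1 by rewrite -exprS prednK.
have : 1 <= `|x| ^+ d.-1 by rewrite -(expr1n _ d.-1); apply: lerXn2r; rewrite ?nnegrE.
by move: x1; set a := `|x|; set b := a ^+ _; nra.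
Qed.

End conclusion.

Theorem corollary2p3 (R : realType) (N m : nat) (X : set 'rV[R]_N)
    (F : 'rV[R]_N -> 'rV[R]_m)
    (X_closed : closed X) (X_semialg : semialgebraic X)
    (F_cont : {within X, continuous F}) (F_semialg : semialgebraic_map X F) :
  let Y := graph X F in
  let Z := F @^-1` [set 0] `&` X in
  let d := maxn 2 (maxn (kappa X) (kappa Y)) in
  let r := (rnum X + rnum Y)%N in
  let e := (d * (6 * d - 3) ^ (N + r - 1))%N in
  (exists C : R, 0 < C /\
     forall x, X x -> C * (dist x Z / (1 + enorm x ^+ d)) ^+ e <= enorm (F x)) /\
  (unbounded X -> compact Z ->
     (((1 - d%:R) * e%:R)%:E <= loj_infty X F)%E).
Proof.
move=> Y Z d r e.
have [D [YD HD]] := kappa_decomposition (graph_closed X_closed F_cont) F_semialg.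
have d1 : (1 < d)%N by rewrite leq_maxl.
have kd : (kappa Y <= d)%N by rewrite /d !leq_max leqnn !orbT.
have e0 : (0 < e)%N by rewrite muln_gt0 expn_gt0 (ltnW d1) /=; move: d1; clear; lia.
(* Each piece has at most [rnum Y <= r] inequalities, so its own exponent fits under the common
   [N + r - 1]. *)
have HD' p : p \in D -> sysdeg d p /\ ((N + size p.1).-1 <= N + r - 1)%N.
  move=> pD; have [[h1 h2] hs] := HD p pD; split.
    by split=> f fp; apply: mdle_le kd _; [exact: h1|exact: h2].
  by move: hs; rewrite -/Y /r; move: (size p.1) (rnum X) (rnum Y); clear; lia.
have [C C0 HC] := graph_bound d1 YD HD'.
split; first exact: dist_bound e0 C0 HC.
by move=> _ cZ; exact: loj_infty_bound (ltnW d1) C0 cZ HC.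
Qed.
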